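(* Let $\alpha_0\in(0,\tfrac23)$ and $K\in[1,\infty)$. Then there exist $\alpha=\alpha(\alpha_0)>0$ and $T^*=T^*(\alpha,K)\in(0,\infty)$ such that for every $Y_0\in\mathcal C^{-\alpha_0}$ and $\underline Z\in\mathcal Z$ with $\|Y_0\|_{\mathcal C^{-\alpha_0}}+\sup_{0<t\le T^*}\|\underline Z_t\|_{\mathcal Z_\alpha}\le K$, the set $S^{T^*}(Y_0,\underline Z)$ is a singleton.
   Context: Let $\mathbb T^2=\mathbb R^2/\mathbb Z^2$; all functions and distributions are complex valued on $\mathbb T^2$. $B^\alpha_{p,q}$ denotes the (Littlewood–Paley) Besov space on $\mathbb T^2$, $\mathcal C^\alpha:=B^\alpha_{\infty,\infty}$, $B^\alpha_p:=B^\alpha_{p,\infty}$. Fix $\mu>0$, $\nu\in\mathbb C$ with $\operatorname{Re}\nu>0$, $\lambda\in\mathbb R$. Let $A:=(i+\mu)\Delta-1$ with semigroup $(e^{tA})_{t\ge0}$. For $\alpha_1>\alpha>0$, the product of $f\in\mathcal C^{\alpha_1}$ and $g\in\mathcal C^{-\alpha}$ is the continuous extension of pointwise multiplication (an element of $\mathcal C^{-\alpha}$). A quadruple $\underline Z=(Z,Z^2,|Z|^2,|Z|^2Z)$ consists of four distribution-valued paths; the symbols $Z^2,|Z|^2,|Z|^2Z$ are merely names of independent components, not functions of $Z$. Set $\|\underline Z_t\|_{\mathcal Z_\alpha}:=\max\{\|Z(t)\|_{\mathcal C^{-\alpha}},\,t^\alpha\|Z^2(t)\|_{\mathcal C^{-\alpha}},\,t^\alpha\||Z|^2(t)\|_{\mathcal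 C^{-\alpha}},\,t^\alpha\||Z|^2Z(t)\|_{\mathcal C^{-\alpha}}\}$. $\mathcal Z$ is the set of such $\underline Z$ with $Z\in C([0,\infty);\mathcal C^{-\alpha})$ and the other three components in $C((0,\infty);\mathcal C^{-\alpha})$ for every $\alpha>0$, and $\sup_{0<t\le T}\|\underline Z_t\|_{\mathcal Z_\alpha}<\infty$ for all $T,\alpha\in(0,\infty)$. Define $\Psi(Y,\underline Z):=(1+\lambda)(Z+Y)-\nu\big(|Y|^2Y+2Z|Y|^2+\bar ZY^2+2|Z|^2Y+Z^2\bar Y+|Z|^2Z\big)$ (bar = complex conjugation). Solutions: for $Y_0\in\mathcal C^{-\alpha_0}$, $\underline Z\in\mathcal Z$, $T>0$, a function $Y$ is a solution over $[0,T]$ if (i) there exist $\alpha_1>0$ and $\gamma\in(0,\tfrac13)$ with $Y\in C((0,T];\mathcal C^{\alpha_1})$ and $\sup_{0<t\le T}t^\gamma\|Y_t\|_{\mathcal C^{\alpha_1}}<\infty$, and (ii) $Y_t=e^{tA}Y_0+\int_0^te^{(t-s)A}\Psi(Y_s,\underline Z_s)\,ds$ for all $t\in(0,T]$. $S^T(Y_0,\underline Z)$ denotes the set of such solutions. *)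

(* Defs.v *)
From HB Require Import structures.
From mathcomp Require Import all_boot all_order all_algebra.
From mathcomp Require Import all_classical all_reals all_analysis.
From mathcomp Require Import complex.
Set Implicit Arguments. Unset Strict Implicit. Unset Printing Implicit Defensive.
Import Order.TTheory GRing.Theory Num.Theory.
Import numFieldNormedType.Exports.
Local Open Scope classical_set_scope.
Local Open Scope ring_scope.
Local Open Scope complex_scope.

Section Defs.
Variable R : realType.

Definition cmod (z : R[i]) : R := Num.sqrt (complex.Re z ^+ 2 + complex.Im z ^+ 2).
Definition cconj (z : R[i]) : R[i] := complex.Re z +i* (- complex.Im z).
Definition cexpi (theta : R) : R[i] := cos (2 * pi * theta) +i* sin (2 * pi * theta).
Definition clim (u : nat -> R[i]) : R[i] :=
  limn (fun n => complex.Re (u n)) +i* limn (fun n => complex.Im (u n)).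
Definition cintegral (a b : R) (f : R -> R[i]) : R[i] :=
  Rintegral lebesgue_measure `[a, b] (fun s => complex.Re (f s)) +i*
  Rintegral lebesgue_measure `[a, b] (fun s => complex.Im (f s)).
Definition cintegrable (a b : R) (f : R -> R[i]) : Prop :=
  lebesgue_measure.-integrable `[a, b] (fun s => (complex.Re (f s))%:E) /\
  lebesgue_measure.-integrable `[a, b] (fun s => (complex.Im (f s))%:E).

(* A distribution u on T^2 is identified with its family of Fourier
   coefficients (u(e_{-k}))_{k in Z^2}, u = sum_k u(k) e_k,
   e_k(x) = exp(2 pi i k.x). *)
Definition distr := int * int -> R[i].
Definition dadd (u v : distr) : distr := fun k => u k + v k.
Definition dscale (c : R[i]) (u : distr) : distr := fun k => c * u k.
Definition dconj (u : distr) : distr := fun k => cconj (u (- k.1, - k.2)%R).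

Definition pdiff (b : bool) (f : R -> R -> R) : R -> R -> R :=
  fun x y => if b then derive1 (fun s => f s y) x else derive1 (fun s => f x s) y.
Definition iter_pdiff (s : seq bool) (f : R -> R -> R) := foldr pdiff f s.
Definition smooth2 (f : R -> R -> R) : Prop :=
  forall s : seq bool,
    (forall x y, derivable (fun t => iter_pdiff s f t y) x 1 /\
                 derivable (fun t => iter_pdiff s f x t) y 1) /\
    continuous (fun p : R * R => iter_pdiff s f p.1 p.2).
Definition radial2 (f : R -> R -> R) : Prop :=
  forall x y x' y', x ^+ 2 + y ^+ 2 = x' ^+ 2 + y' ^+ 2 -> f x y = f x' y'.

(* (chi, rho) is a dyadic partition of unity in the sense of
   Bahouri--Chemin--Danchin: smooth radial functions with values in [0,1],
   supp chi in the ball of radius 4/3, supp rho in the annulus 3/4 <= |xi| <= 8/3,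
   and chi + sum_{j >= 0} rho(2^-j .) = 1. *)
Definition dyadic_partition (chi rho : R -> R -> R) : Prop :=
  [/\ smooth2 chi /\ smooth2 rho, radial2 chi /\ radial2 rho,
   (forall x y, 0 <= chi x y <= 1 /\ 0 <= rho x y <= 1),
   (forall x y, chi x y != 0 -> x ^+ 2 + y ^+ 2 <= (4 / 3) ^+ 2) &
   (forall x y, rho x y != 0 ->
        (3 / 4) ^+ 2 <= x ^+ 2 + y ^+ 2 <= (8 / 3) ^+ 2) /\
   (forall x y, (fun N : nat => chi x y +
        \sum_(j < N) rho (x / 2 ^+ j) (y / 2 ^+ j)) @ \oo --> (1 : R))].

Variables chi rho : R -> R -> R.

(* Littlewood--Paley weights; block n : nat corresponds to Delta_{n-1},
   i.e. n = 0 is Delta_{-1} (weight chi), n = m+1 is Delta_m (weight rho(2^-m .)) *)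
Definition lp_weight (n : nat) (k : int * int) : R :=
  if n is m.+1 then rho (k.1%:~R / 2 ^+ m) (k.2%:~R / 2 ^+ m)
  else chi k.1%:~R k.2%:~R.

Definition box_pt (N : nat) (a b : 'I_(2 * N).+1) : int * int :=
  ((a%:Z - N%:Z)%R, (b%:Z - N%:Z)%R).

(* Delta_{n-1} u, a trigonometric polynomial (the weight vanishes outside the
   box of radius 2^(n+1)) *)
Definition lp_block (n : nat) (u : distr) (x y : R) : R[i] :=
  let N := (2 ^ n.+1)%N in
  \sum_(a < (2 * N).+1) \sum_(b < (2 * N).+1)
    (lp_weight n (box_pt a b))%:C * u (box_pt a b) *
    cexpi ((box_pt a b).1%:~R * x + (box_pt a b).2%:~R * y).

Definition sup_norm (f : R -> R -> R[i]) : \bar R :=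
  ereal_sup [set (cmod (f x y))%:E | x in [set: R] & y in [set: R]].
Definition besov_norm (s : R) (u : distr) : \bar R :=
  ereal_sup [set ((2 `^ ((n%:R - 1) * s))%:E * sup_norm (lp_block n u))%E
            | n in [set: nat]].
Definition holder (s : R) : set distr := [set u | (besov_norm s u < +oo)%E].

Definition lp_partial (N : nat) (u : distr) : distr :=
  fun k => (\sum_(n < N) lp_weight n k)%:C * u k.

(* product of distributions: limit of the products of the (trigonometric
   polynomial) regularisations S_N f * S_N g.  For f in C^{a1}, g in C^{-a},
   a1 > a > 0, this is the continuous extension of pointwise multiplication. *)
Definition dmul (f g : distr) : distr :=
  fun k => clim (fun N =>
    let M := (2 ^ N.+1)%N in
    \sum_(a < (2 * M).+1) \sum_(b < (2 * M).+1)
      lp_partial N f (box_pt a b) *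
      lp_partial N g ((k.1 - (box_pt a b).1)%R, (k.2 - (box_pt a b).2)%R)).

(* ---------- the semigroup e^{tA}, A = (i + mu) Laplacian - 1 ---------- *)
Definition heat_mult (mu t : R) (k : int * int) : R[i] :=
  let k2 := (k.1%:~R ^+ 2 + k.2%:~R ^+ 2 : R) in
  (expR (- t * (4 * pi ^+ 2 * mu * k2 + 1)))%:C *
  (cos (- 4 * pi ^+ 2 * t * k2) +i* sin (- 4 * pi ^+ 2 * t * k2)).
Definition semigroup (mu t : R) (u : distr) : distr :=
  fun k => heat_mult mu t k * u k.

Record quad := Quad { qZ : R -> distr; qZ2 : R -> distr;
                      qZabs2 : R -> distr; qZabs2Z : R -> distr }.

Definition Psi (lam : R) (nu : R[i]) (Y Z Z2 Zabs2 Zabs2Z : distr) : distr :=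
  let Yabs2 := dmul Y (dconj Y) in
  dadd (dscale ((1 + lam)%:C) (dadd Z Y))
   (dscale (- nu)
     (dadd (dmul Yabs2 Y)
     (dadd (dscale 2%:C (dmul Z Yabs2))
     (dadd (dmul (dconj Z) (dmul Y Y))
     (dadd (dscale 2%:C (dmul Zabs2 Y))
     (dadd (dmul Z2 (dconj Y)) Zabs2Z)))))).

Definition PsiQ (lam : R) (nu : R[i]) (Y : distr) (Zq : quad) (s : R) : distr :=
  Psi lam nu Y (qZ Zq s) (qZ2 Zq s) (qZabs2 Zq s) (qZabs2Z Zq s).

Definition cont_path (s : R) (D : set R) (p : R -> distr) : Prop :=
  (forall t, D t -> holder s (p t)) /\
  forall t, D t -> forall eps : R, 0 < eps -> exists2 del : R, 0 < del &
    forall r, D r -> `|r - t| < del ->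
      (besov_norm s (dadd (p r) (dscale ((-1)%R) (p t))) < eps%:E)%E.

Definition Znorm (a : R) (Zq : quad) (t : R) : \bar R :=
  maxe (besov_norm (- a) (qZ Zq t))
  (maxe ((t `^ a)%:E * besov_norm (- a) (qZ2 Zq t))
  (maxe ((t `^ a)%:E * besov_norm (- a) (qZabs2 Zq t))
        ((t `^ a)%:E * besov_norm (- a) (qZabs2Z Zq t))))%E.

Definition in_calZ (Zq : quad) : Prop :=
  forall a : R, 0 < a ->
    [/\ cont_path (- a) `[0, +oo[ (qZ Zq),
        cont_path (- a) `]0, +oo[ (qZ2 Zq),
        cont_path (- a) `]0, +oo[ (qZabs2 Zq),
        cont_path (- a) `]0, +oo[ (qZabs2Z Zq) &
        forall T : R, 0 < T ->
          exists M : R, forall t, t \in `]0, T] -> (Znorm a Zq t <= M%:E)%E].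

Definition is_solution (mu lam : R) (nu : R[i]) (T : R) (Y0 : distr)
    (Zq : quad) (Y : R -> distr) : Prop :=
  (exists a1 : R, exists gam : R,
     [/\ 0 < a1, 0 < gam < 3^-1,
         cont_path a1 `]0, T] Y &
         exists M : R, forall t, t \in `]0, T] ->
           ((t `^ gam)%:E * besov_norm a1 (Y t) <= M%:E)%E]) /\
  forall t, t \in `]0, T] -> forall k : int * int,
    cintegrable 0 t (fun s => heat_mult mu (t - s) k * PsiQ lam nu (Y s) Zq s k) /\
    Y t k = heat_mult mu t k * Y0 k +
            cintegral 0 t (fun s => heat_mult mu (t - s) k * PsiQ lam nu (Y s) Zq s k).

End Defs.

(* Main.v *)
(* For [u] in [C^-a] and [Y] in [C^b] with [0 < a < b], [Psi] maps into [C^-a] with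
   cubic growth, and the heat semigroup gains [a + b] derivatives at the price
   [(t - s)^(-(a + b)/2)].  Hence the Duhamel map contracts, on a small ball and
   for a short time, in the norm [sup t^gam |Y_t|_(C^b)], [gam = (b + a0) / 2 < 1/3],
   and its fixed point is a solution.  Two arbitrary solutions, with possibly
   different exponents, are compared in a common weaker norm of the same kind,
   where a weight [exp (- be t)] with large [be] makes the difference estimate a
   contraction on the whole interval.  The linear estimates rest on one Fourier
   multiplier bound: a finitely supported symbol is a combination of translated
   Fejer triangles with its second differences as coefficients, so its norm on
   [L^oo] is controlled by their sum. *)
From Pilot Require Import Defs.
From HB Require Import structures.
From mathcomp Require Import all_boot all_order all_algebra.
From mathcomp Require Import all_classical all_reals all_analysis measurable_realfun.
From mathcomp Require Import complex.
From mathcomp Require Import zify ring lra.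
Import Pilot.Defs.
Set Implicit Arguments. Unset Strict Implicit. Unset Printing Implicit Defensive.
Import Order.TTheory GRing.Theory Num.Theory.
Import numFieldNormedType.Exports.
Local Open Scope classical_set_scope.
Local Open Scope ring_scope.
Local Open Scope complex_scope.

(** * Trigonometric polynomials and Fourier multipliers *)

Section TrigPoly.
Variable R : realType.
Implicit Types (z w : R[i]) (f g : distr R) (k : int * int) (N M : nat).

(** The threshold [2 / 3] comes from integrability at time [0]: the cubic term costs [s^-(3 gam)],
    and [3 gam < 1] for some [b > 0] means [a0 < 2 / 3]. Products with the components of [Z] cost at
    most [s^-(a + 2 gam)], which is no worse once [a <= gam]. Distributions are coefficient
    families, so the estimates are kept finite: a block is a trigonometric polynomial, bounds on it
    pass through coefficientwise limits and integrals because finitely many coefficients enter, and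
    averages over the torus become averages over fine grids, exact for polynomials. The obstacle is
    uniformity in the block index: summing absolute values of coefficients loses a power of [2 ^ n].
    Mixed second differences of a symbol living at scale [N] are of size [N^-4], which pays for the
    [N ^ 2] points of the box and the [N ^ 2] in front of the triangles. Time regularity is also
    proved coefficient by coefficient, where the backward factor [heat_mult mu (- s) k] is a bounded
    number, and then lifted to a slightly weaker Hölder space. *)

Lemma cmodE z : cmod z = Normc.normc z.
Proof. by case: z. Qed.

Lemma cmod_ge0 z : 0 <= cmod z.
Proof. exact: sqrtr_ge0. Qed.

Lemma cmodM z w : cmod (z * w) = cmod z * cmod w.
Proof. by rewrite !cmodE Normc.normcM. Qed.

Lemma cmodD z w : cmod (z + w) <= cmod z + cmod w.
Proof. by rewrite !cmodE le_normcD. Qed.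

Lemma cmodN z : cmod (- z) = cmod z.
Proof. by rewrite !cmodE normcN. Qed.

Lemma cmod0 : cmod (0 : R[i]) = 0.
Proof. by rewrite cmodE Normc.normc0. Qed.

Lemma cmodR (r : R) : cmod r%:C = `|r|.
Proof. by rewrite /cmod /= expr0n addr0 sqrtr_sqr. Qed.

Lemma natC n : n%:R = n%:R%:C :> R[i].
Proof. by rewrite -(rmorph_nat (real_complex R)). Qed.

Lemma cmod_eq0 z : cmod z = 0 -> z = 0.
Proof. by rewrite cmodE => /Normc.eq0_normc. Qed.

Lemma cmod_sum (I : Type) (r : seq I) (P : pred I) (F : I -> R[i]) :
  cmod (\sum_(i <- r | P i) F i) <= \sum_(i <- r | P i) cmod (F i).
Proof.
elim/big_rec2: _ => [|i y x _ h]; first by rewrite cmod0.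
by rewrite (le_trans (cmodD _ _))// lerD2l.
Qed.

Lemma Re_le_cmod z : `|complex.Re z| <= cmod z.
Proof. by rewrite /cmod -sqrtr_sqr ler_wsqrtr// lerDl sqr_ge0. Qed.

Lemma Im_le_cmod z : `|complex.Im z| <= cmod z.
Proof. by rewrite /cmod -sqrtr_sqr ler_wsqrtr// lerDr sqr_ge0. Qed.

Lemma cmod_ReIm z : cmod z <= `|complex.Re z| + `|complex.Im z|.
Proof.
rewrite /cmod -[leRHS]ger0_norm ?addr_ge0// -sqrtr_sqr ler_wsqrtr//.
rewrite sqrrD !real_normK ?num_real//.
have : 0 <= `|complex.Re z| * `|complex.Im z| by rewrite mulr_ge0.
by lra.
Qed.

Lemma complexReD z w : complex.Re (z + w) = complex.Re z + complex.Re w.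
Proof. by case: z; case: w. Qed.

Lemma complexImD z w : complex.Im (z + w) = complex.Im z + complex.Im w.
Proof. by case: z; case: w. Qed.

Lemma complexReM z w :
  complex.Re (z * w) =
  complex.Re z * complex.Re w - complex.Im z * complex.Im w.
Proof. by case: z; case: w. Qed.

Lemma complexImM z w :
  complex.Im (z * w) =
  complex.Re z * complex.Im w + complex.Im z * complex.Re w.
Proof. by case: z => a b; case: w => c d /=; rewrite addrC. Qed.

Lemma complex_eqP z w :
  complex.Re z = complex.Re w -> complex.Im z = complex.Im w -> z = w.
Proof. by case: z; case: w => ? ? ? ? /= -> ->. Qed.

Lemma cconjM z w : cconj (z * w) = cconj z * cconj w.
Proof. by case: z => a b; case: w => c d; apply: complex_eqP => /=; ring. Qed.

Lemma cconjD z w : cconj (z + w) = cconj z + cconj w.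
Proof. by case: z => a b; case: w => c d; apply: complex_eqP => /=; ring. Qed.

Lemma cconjB z w : cconj (z - w) = cconj z - cconj w.
Proof. by case: z => a b; case: w => c d; apply: complex_eqP => /=; ring. Qed.

Lemma cconjK z : cconj (cconj z) = z.
Proof. by apply: complex_eqP => //=; rewrite opprK. Qed.

Lemma cconj0 : cconj (0 : R[i]) = 0.
Proof. by apply: complex_eqP => /=; rewrite ?oppr0. Qed.

Lemma cmod_conj z : cmod (cconj z) = cmod z.
Proof. by rewrite /cmod /= sqrrN. Qed.

Lemma cconj_sum (I : Type) (r : seq I) (P : pred I) (F : I -> R[i]) :
  cconj (\sum_(i <- r | P i) F i) = \sum_(i <- r | P i) cconj (F i).
Proof. by elim/big_rec2: _ => [|i y x _ <-]; rewrite ?cconj0// cconjD. Qed.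

Lemma mul_cconj z : z * cconj z = (cmod z ^+ 2)%:C.
Proof.
case: z => a b; apply: complex_eqP => /=; last by ring.
by rewrite sqr_sqrtr ?addr_ge0 ?sqr_ge0//=; ring.
Qed.

Lemma cexpi0 : cexpi (0 : R) = 1.
Proof. by rewrite /cexpi mulr0 cos0 sin0. Qed.

Lemma cexpiD (s t : R) : cexpi (s + t) = cexpi s * cexpi t.
Proof.
by apply: complex_eqP => /=; rewrite mulrDr ?cosD ?sinD//; ring.
Qed.

Lemma cconj_cexpi (s : R) : cconj (cexpi s) = cexpi (- s).
Proof. by rewrite /cconj /cexpi /= mulrN cosN sinN. Qed.

Lemma cmod_cexpi (s : R) : cmod (cexpi s) = 1.
Proof. by rewrite /cmod /= cos2Dsin2 sqrtr1. Qed.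

Lemma cexpiMn (s : R) n : cexpi (n%:R * s) = cexpi s ^+ n.
Proof.
elim: n => [|n ih]; first by rewrite mul0r cexpi0.
by rewrite -natr1 mulrDl mul1r cexpiD ih exprSr.
Qed.

Lemma cexpi_nat n : cexpi (n%:R : R) = 1.
Proof.
rewrite -[n%:R]mulr1 cexpiMn.
suff -> : cexpi (1 : R) = 1 by rewrite expr1n.
by rewrite /cexpi mulr1 mulr_natl cos2pi sin2pi.
Qed.

Lemma cexpi_neq1 (s : R) : 0 < s < 1 -> cexpi s != 1.
Proof.
move=> /andP[s0 s1]; apply/eqP => /(congr1 (@complex.Re R)) /=.
rewrite -mulrA mulrDl mul1r cosD -!expr2 cos2sin2 => h.
have : 0 < sin (pi * s) by apply: sin_gt0_pi; rewrite mulr_gt0 ?pi_gt0// gtr_pMr ?pi_gt0.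
move=> h0; have : 0 < sin (pi * s) ^+ 2 by rewrite exprn_gt0.
by lra.
Qed.

Definition zr N : seq int := [seq (a%:Z - N%:Z)%R | a <- iota 0 (2 * N).+1].
Definition zbox N : seq (int * int) := [seq (a, b) | a <- zr N, b <- zr N].

Lemma mem_zr N (z : int) : (z \in zr N) = (absz z <= N)%N.
Proof.
apply/mapP/idP => [[a]|h]; first by rewrite mem_iota => h ->; lia.
exists (absz (z + N%:Z)); first by rewrite mem_iota; lia.
by lia.
Qed.

Lemma uniq_zr N : uniq (zr N).
Proof. by rewrite map_inj_uniq ?iota_uniq// => a b h; lia. Qed.

Lemma mem_zbox N k : (k \in zbox N) = (absz k.1 <= N)%N && (absz k.2 <= N)%N.
Proof.
case: k => a b /=; rewrite -!mem_zr; apply/allpairsP/idP.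
  by move=> [[c d] /= [? ? [-> ->]]]; apply/andP.
by move=> /andP[? ?]; exists (a, b).
Qed.

Lemma uniq_zbox N : uniq (zbox N).
Proof. by rewrite allpairs_uniq ?uniq_zr// => -[? ?] [? ?]. Qed.

Lemma sum_box_pt N (F : int * int -> R[i]) :
  \sum_(a < (2 * N).+1) \sum_(b < (2 * N).+1) F (box_pt a b) =
  \sum_(k <- zbox N) F k.
Proof.
have io (G : nat -> R[i]) :
    \sum_(a < (2 * N).+1) G a = \sum_(a <- iota 0 (2 * N).+1) G a.
  by rewrite -(big_mkord xpredT G) /index_iota subn0.
rewrite big_allpairs big_map /=.
rewrite (io (fun a => \sum_(b < (2 * N).+1) F (a%:Z - N%:Z, b%:Z - N%:Z))).
apply: eq_bigr => a _; rewrite big_map.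
by rewrite (io (fun b => F (a%:Z - N%:Z, b%:Z - N%:Z))).
Qed.

Definition suppin N f := forall k, f k != 0 -> k \in zbox N.

Lemma sum_supp (T : eqType) (s1 s2 : seq T) (F : T -> R[i]) :
  uniq s1 -> uniq s2 ->
  (forall t, F t != 0 -> t \in s1) -> (forall t, F t != 0 -> t \in s2) ->
  \sum_(t <- s1) F t = \sum_(t <- s2) F t.
Proof.
move=> u1 u2 h1 h2.
have E s : \sum_(t <- s) F t = \sum_(t <- [seq t <- s | F t != 0]) F t.
  rewrite big_filter [RHS]big_mkcond; apply: eq_bigr => t _.
  by case: ifPn => // /negbNE/eqP.
rewrite (E s1) (E s2); apply/perm_big/uniq_perm; rewrite ?filter_uniq// => t.
by rewrite !mem_filter; case: (boolP (F t != 0)) => //= ht; rewrite h1 ?h2.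
Qed.

Lemma sum_reindex (T : eqType) (s1 s2 : seq T) (F : T -> R[i]) (p q : T -> T) :
  cancel p q -> cancel q p -> uniq s1 -> uniq s2 ->
  (forall t, F t != 0 -> t \in s1) -> (forall t, F t != 0 -> q t \in s2) ->
  \sum_(t <- s1) F t = \sum_(t <- s2) F (p t).
Proof.
move=> pq qp u1 u2 h1 h2; rewrite -(big_map p xpredT F).
apply: sum_supp => //; first by rewrite map_inj_uniq//; exact: can_inj pq.
by move=> t /h2 ht; rewrite -(qp t) map_f.
Qed.

Lemma suppin_widen N N' f : (N <= N')%N -> suppin N f -> suppin N' f.
Proof. by move=> NN' h k /h; rewrite !mem_zbox => /andP[? ?]; apply/andP; split; lia. Qed.

Definition ee k (x y : R) : R[i] := cexpi (k.1%:~R * x + k.2%:~R * y).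

Definition ev N f (x y : R) : R[i] := \sum_(k <- zbox N) f k * ee k x y.

Lemma ev_supp N N' f x y : suppin N f -> suppin N' f -> ev N f x y = ev N' f x y.
Proof.
move=> h h'; apply: sum_supp; rewrite ?uniq_zbox// => k hk.
  by apply: h; apply: contraNneq hk => ->; rewrite mul0r.
by apply: h'; apply: contraNneq hk => ->; rewrite mul0r.
Qed.

(** A sup norm bound for the trigonometric polynomial with coefficients [f]. The degree is
    existential, since by [ev_supp] the value does not depend on the box, and bounds can then be
    combined without tracking degrees. *)
Definition linf f (C : R) :=
  exists2 N, suppin N f & forall x y, cmod (ev N f x y) <= C.

Lemma linf_ev N f C : linf f C -> suppin N f -> forall x y, cmod (ev N f x y) <= C.
Proof. by move=> [N' h h'] hN x y; rewrite (ev_supp _ _ hN h). Qed.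

Lemma linf_ge0 f C : linf f C -> 0 <= C.
Proof. by move=> [N _ /(_ 0 0)]; apply: le_trans; rewrite cmod_ge0. Qed.

Lemma linf_le f C C' : C <= C' -> linf f C -> linf f C'.
Proof. by move=> h [N hN hf]; exists N => // x y; apply: le_trans (hf x y) h. Qed.

Lemma linf_eq f g C : (forall k, f k = g k) -> linf f C -> linf g C.
Proof. by move=> /funext ->. Qed.

Lemma linf0 : linf (fun=> 0) 0.
Proof.
exists 0%N => [k|x y]; first by rewrite eqxx.
by rewrite /ev big1 ?cmod0// => k _; rewrite mul0r.
Qed.

Lemma linfD f g C D : linf f C -> linf g D -> linf (fun k => f k + g k) (C + D).
Proof.
move=> [N hN hf] [M hM hg]; exists (maxn N M).
  move=> k h; have [fk|fk] := eqVneq (f k) 0.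
    by apply: (suppin_widen (leq_maxr N M) hM); move: h; rewrite fk add0r.
  exact: (suppin_widen (leq_maxl N M) hN).
move=> x y; have -> : ev (maxn N M) (fun k => f k + g k) x y = ev N f x y + ev M g x y.
  rewrite (ev_supp _ _ hN (suppin_widen (leq_maxl N M) hN)).
  rewrite (ev_supp _ _ hM (suppin_widen (leq_maxr N M) hM)).
  by rewrite /ev -big_split; apply: eq_bigr => k _; rewrite mulrDl.
by apply: le_trans (cmodD _ _) _; apply: lerD.
Qed.

Lemma linfZ f C c : linf f C -> linf (fun k => c * f k) (cmod c * C).
Proof.
move=> [N hN hf]; exists N => [k h|x y].
  by apply: hN; apply: contraNneq h => ->; rewrite mulr0.
have -> : ev N (fun k => c * f k) x y = c * ev N f x y.
  by rewrite /ev mulr_sumr; apply: eq_bigr => k _; rewrite mulrA.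
by rewrite cmodM ler_wpM2l ?cmod_ge0.
Qed.

Lemma linfB f g C D : linf f C -> linf g D -> linf (fun k => f k - g k) (C + D).
Proof.
move=> hf /(linfZ (-1)); rewrite cmodN -[1]/(1%:C) cmodR normr1 mul1r.
by move/(linfD hf); apply: linf_eq => k; rewrite mulN1r.
Qed.

Lemma linf_sum (I : Type) (r : seq I) (P : pred I) (F : I -> distr R) (C : I -> R) :
  (forall i, P i -> linf (F i) (C i)) ->
  linf (fun k => \sum_(i <- r | P i) F i k) (\sum_(i <- r | P i) C i).
Proof.
move=> h; elim: r => [|i r ih].
  by rewrite big_nil; apply: linf_eq linf0 => k; rewrite big_nil.
rewrite big_cons; case: (boolP (P i)) => Pi.
  by apply: linf_eq (linfD (h _ Pi) ih) => k; rewrite big_cons Pi.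
by apply: linf_eq ih => k; rewrite big_cons (negbTE Pi).
Qed.

Lemma dconj_suppin N f : suppin N f -> suppin N (dconj f).
Proof.
move=> h k hk; have : f (- k.1, - k.2) != 0.
  by apply: contraNneq hk; rewrite /dconj => ->; rewrite cconj0.
by move/h; rewrite !mem_zbox /= !abszN.
Qed.

Lemma linf_dconj f C : linf f C -> linf (dconj f) C.
Proof.
move=> [N hN hf]; exists N => [|x y]; first exact: dconj_suppin.
rewrite -(cmod_conj (ev _ _ _ _)).
suff -> : cconj (ev N (dconj f) x y) = ev N f x y by [].
rewrite /ev cconj_sum; symmetry.
rewrite (@sum_reindex _ _ (zbox N) _ (fun k => (- k.1, - k.2)) (fun k => (- k.1, - k.2))).
- apply: eq_bigr => -[a b] _; rewrite cconjM cconjK cconj_cexpi /=.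
  by congr (_ * cexpi _); rewrite !mulrNz; ring.
- by move=> [a b] /=; rewrite !opprK.
- by move=> [a b] /=; rewrite !opprK.
- exact: uniq_zbox.
- exact: uniq_zbox.
- by move=> k hk; apply: hN; apply: contraNneq hk => ->; rewrite mul0r.
- move=> k hk; rewrite mem_zbox /= !abszN -mem_zbox; apply: hN.
  by apply: contraNneq hk => ->; rewrite mul0r.
Qed.

(** These are the coefficients of the product of [ev M f] with the polynomial of [g]; it is the full
    convolution as soon as [f] is supported in [zbox M]. *)
Definition fconv M f g : distr R :=
  fun k => \sum_(a <- zbox M) f a * g (k.1 - a.1, k.2 - a.2).

Lemma eeD k1 k2 x y : ee (k1.1 + k2.1, k1.2 + k2.2) x y = ee k1 x y * ee k2 x y.
Proof. by rewrite /ee -cexpiD /= !rmorphD /=; congr cexpi; ring. Qed.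

Lemma fconv_suppin M M' f g : suppin M' g -> suppin (M + M') (fconv M f g).
Proof.
move=> hg k hk; apply/negbNE/negP => kn; move/eqP: hk; apply.
rewrite /fconv big_seq big1// => a; rewrite mem_zbox => /andP[a1 a2].
have [->|/hg] := eqVneq (g (k.1 - a.1, k.2 - a.2)) 0; first by rewrite mulr0.
by move: kn; rewrite !mem_zbox /= => h1 /andP[? ?]; exfalso; move/negP: h1; apply; apply/andP; split; lia.
Qed.

Lemma ev_fconv M M' f g x y : suppin M' g ->
  ev (M + M') (fconv M f g) x y = ev M f x y * ev M' g x y.
Proof.
move=> hg; rewrite /ev /fconv mulr_suml.
under eq_bigr do rewrite mulr_suml.
rewrite exchange_big /= big_seq [RHS]big_seq; apply: eq_bigr => a.
rewrite mem_zbox => /andP[a1 a2].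
rewrite mulr_sumr; symmetry.
pose p k := (k.1 - a.1, k.2 - a.2); pose q k := (k.1 + a.1, k.2 + a.2).
have pq : cancel p q by move=> [? ?]; rewrite /p /q /= !subrK.
have qp : cancel q p by move=> [? ?]; rewrite /p /q /= !addrK.
rewrite (sum_reindex pq qp (uniq_zbox M') (uniq_zbox (M + M'))).
- apply: eq_bigr => k _; have -> : ee k x y = ee (p k) x y * ee a x y.
    by rewrite -eeD /p /= !subrK; case: k.
  by rewrite -/(p k); ring.
- by move=> k hk; apply: hg; apply: contraNneq hk => ->; rewrite mul0r mulr0.
- move=> k hk; have : k \in zbox M'.
    by apply: hg; apply: contraNneq hk => ->; rewrite mul0r mulr0.
  by rewrite !mem_zbox /= => /andP[? ?]; apply/andP; split; lia.
Qed.

Lemma linf_fconv M f g C D : suppin M f ->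
  linf f C -> linf g D -> linf (fconv M f g) (C * D).
Proof.
move=> hM hf [M' hM' hg]; exists (M + M')%N; first exact: fconv_suppin.
move=> x y; rewrite ev_fconv// cmodM ler_pM ?cmod_ge0//.
exact: linf_ev hf hM _ _.
Qed.

(** * Grid averages, Fejer kernels and the multiplier bound *)

Lemma cexpi_int (q : int) : cexpi (q%:~R : R) = 1.
Proof.
case: q => n; first exact: cexpi_nat.
by rewrite NegzE mulrNz -cconj_cexpi cexpi_nat; apply: complex_eqP => //=; rewrite oppr0.
Qed.

(** Geometric series of an [M]-th root of unity. The bound on [q] excludes aliasing: no nonzero
    multiple of [M] is in range. *)
Lemma grid_sum M (q : int) : (absz q < M)%N ->
  \sum_(p < M) cexpi (q%:~R * (p%:R / M%:R)) = (q == 0)%:R * M%:R :> R[i].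
Proof.
move=> qM; have M0 : (M%:R : R) != 0 by rewrite pnatr_eq0; lia.
have [->|q0] := eqVneq q 0.
  by under eq_bigr do rewrite mul0r cexpi0; rewrite sumr_const card_ord mul1r.
pose z := cexpi (q%:~R / M%:R : R).
have z1 : z != 1.
  have h n : (0 < n < M)%N -> cexpi (n%:R / M%:R : R) != 1.
    move=> /andP[n0 nM]; apply: cexpi_neq1.
    by rewrite divr_gt0 ?ltr0n//= ?ltr_pdivrMr ?mul1r ?ltr_nat ?ltr0n; lia.
  rewrite /z; case: q qM q0 {z} => n qM q0; first by apply: h; lia.
  apply/eqP => e; have /eqP := h n.+1 ltac:(lia); apply.
  move/(congr1 (@cconj R)): e; rewrite cconj_cexpi NegzE mulrNz mulNr opprK => ->.
  by apply: complex_eqP => //=; rewrite oppr0.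
have -> : \sum_(p < M) cexpi (q%:~R * (p%:R / M%:R)) = \sum_(p < M) z ^+ p.
  by apply: eq_bigr => p _; rewrite /z -cexpiMn; congr cexpi; field.
have : (z - 1) * (\sum_(p < M) z ^+ p) = 0.
  rewrite -subrX1 -cexpiMn mulrC divfK//; by rewrite cexpi_int subrr.
move/eqP; rewrite mulf_eq0 subr_eq0 (negbTE z1) /= => /eqP ->.
by rewrite mul0r.
Qed.

Definition DK A (s : R) : R[i] := \sum_(a < A) cexpi (a%:R * s).

Lemma sum_DK A B s (j : R) :
  \sum_(a < A) \sum_(b < B) cexpi ((b%:R - a%:R + j) * s) =
  cconj (DK A s) * DK B s * cexpi (j * s).
Proof.
rewrite /DK cconj_sum !mulr_suml; apply: eq_bigr => a _.
rewrite mulr_sumr mulr_suml; apply: eq_bigr => b _.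
by rewrite cconj_cexpi -!cexpiD; congr cexpi; ring.
Qed.

(** Parseval on the grid: expanding the square leaves the diagonal terms, because the frequencies of
    [DK A] differ by less than [M]. *)
Lemma grid_DK A M : (A <= M)%N -> (0 < M)%N ->
  \sum_(p < M) cmod (DK A (p%:R / M%:R)) ^+ 2 = A%:R * M%:R.
Proof.
move=> AM M0; apply: (@complexI R); rewrite rmorph_sum /=.
have h (p : 'I_M) : (cmod (DK A (p%:R / M%:R)) ^+ 2)%:C =
    \sum_(a < A) \sum_(b < A) cexpi (((b%:Z - a%:Z)%R)%:~R * (p%:R / M%:R)) :> R[i].
  rewrite -mul_cconj mulrC -[LHS]mulr1 -(cexpi0) -(mul0r (p%:R / M%:R : R)) -sum_DK.
  by apply: eq_bigr => a _; apply: eq_bigr => b _; rewrite addr0 rmorphB.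
under eq_bigr do rewrite h.
rewrite exchange_big /=; under eq_bigr do rewrite exchange_big /=.
have h2 (a : 'I_A) : \sum_(b < A) \sum_(p < M)
   cexpi (((b%:Z - a%:Z)%R)%:~R * (p%:R / M%:R)) = M%:R :> R[i].
  rewrite (bigD1 a)//= [X in _ + X]big1 => [|b ba]; rewrite grid_sum.
  - by rewrite subrr eqxx mul1r addr0.
  - by have := ltn_ord a; lia.
  - rewrite subr_eq0 eqz_nat; case: eqP; rewrite ?mul0r// => e.
    by move: ba; rewrite -val_eqE /= e eqxx.
  - by have := ltn_ord a; have := ltn_ord b; lia.
under eq_bigr do rewrite h2.
by rewrite sumr_const card_ord -[LHS]mulr_natl rmorphM /= !rmorph_nat.
Qed.

Definition coord (c : bool) k : int := if c then k.1 else k.2.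

(** Fourier coefficient of [cconj (DK A) * DK B / A], counted by pairs of frequencies. For [A <= B]
    it is a trapezoid, equal to [1] on [0 <= q <= B - A] and zero outside [- A < q < B]; [A = B]
    gives the Fejer triangle. *)
Definition Umult A B (q : int) : R :=
  (\sum_(a < A) \sum_(b < B) ((b%:Z - a%:Z)%R == q)%:R) / A%:R.

Lemma ee_shift c k (s x y : R) :
  ee k (if c then x - s else x) (if c then y else y - s) =
  ee k x y * cexpi (- (coord c k)%:~R * s).
Proof. by rewrite /ee -cexpiD /coord; case: c; congr cexpi; ring. Qed.

(* The kernel of [Umult] is [cconj (DK A) * DK B / A], whose absolute value
   has mean at most [(A + B) / (2 A)] by AM-GM and Parseval on a fine grid. *)
Lemma linf_Umult c A B (j : int) f F : (0 < A)%N -> linf f F ->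
  linf (fun k => (Umult A B (coord c k - j))%:C * f k)
       ((A%:R + B%:R) / (2 * A%:R) * F).
Proof.
move=> A0 lf; have [N hN hf] := lf; have F0 := linf_ge0 lf.
have A0' : (A%:R : R) != 0 by rewrite pnatr_eq0; lia.
exists N => [k h|x y].
  by apply: hN; apply: contraNneq h => ->; rewrite mulr0.
(* The grid is finer than every frequency [b - a + j - coord c k] with [k] in the box, so [grid_sum]
   makes the average exact. *)
pose M := (N + absz j + A + B).+1.
have M0' : (M%:R : R) != 0 by rewrite pnatr_eq0.
pose s (p : 'I_M) : R := p%:R / M%:R.
pose D p : R[i] := cconj (DK A (s p)) * DK B (s p) * cexpi (j%:~R * s p).
have -> : ev N (fun k => (Umult A B (coord c k - j))%:C * f k) x y =
    (A%:R * M%:R)^-1%:C * \sum_(p < M) D p *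
       ev N f (if c then x - s p else x) (if c then y else y - s p).
  rewrite /ev; under [in RHS]eq_bigr do rewrite mulr_sumr.
  rewrite exchange_big /= mulr_sumr big_seq [RHS]big_seq; apply: eq_bigr => k.
  rewrite mem_zbox => kN.
  under [in RHS]eq_bigr do rewrite ee_shift.
  have -> : \sum_(p < M) D p * (f k * (ee k x y * cexpi (- (coord c k)%:~R * s p)))
     = f k * ee k x y * \sum_(p < M) D p * cexpi (- (coord c k)%:~R * s p).
    by rewrite mulr_sumr; apply: eq_bigr => p _; ring.
  suff -> : \sum_(p < M) D p * cexpi (- (coord c k)%:~R * s p) =
     (M%:R * A%:R * Umult A B (coord c k - j))%:C.
    transitivity (((A%:R * M%:R)^-1 * (M%:R * A%:R *
        Umult A B (coord c k - j)))%:C * (f k * ee k x y)).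
      by rewrite mulrA; congr (_%:C * f k * _); field; rewrite A0' M0'.
    by rewrite (rmorphM (real_complex R) _^-1) /=; ring.
  have h (p : 'I_M) : D p * cexpi (- (coord c k)%:~R * s p) =
     \sum_(a < A) \sum_(b < B)
        cexpi ((b%:Z - a%:Z + j - coord c k)%:~R * (p%:R / M%:R)).
    rewrite /D -mulrA -cexpiD -mulrDl -sum_DK.
    apply: eq_bigr => a _; apply: eq_bigr => b _; congr cexpi.
    by rewrite /s; congr (_ * _); rewrite !(rmorphB, rmorphD) /=; ring.
  under eq_bigr do rewrite h.
  rewrite exchange_big /=; under eq_bigr do rewrite exchange_big /=.
  rewrite /Umult; set S := (X in X / _).
  have -> : M%:R * A%:R * (S / A%:R) = S * M%:R by field.
  rewrite rmorphM rmorph_sum mulr_suml /= rmorph_nat; apply: eq_bigr => a _.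
  rewrite rmorph_sum mulr_suml; apply: eq_bigr => b _.
  rewrite grid_sum ?rmorph_nat; last first.
    move: kN; have := ltn_ord a; have := ltn_ord b.
    by rewrite /coord /M => ? ? /andP[? ?]; case: (c); lia.
  congr ((nat_of_bool _)%:R * _); move: (coord c k) => q.
  by apply/eqP/eqP => ?; lia.
rewrite cmodM cmodR ger0_norm; last by rewrite invr_ge0 mulr_ge0.
rewrite -mulrA ler_pdivrMl ?mulr_gt0 ?ltr0n//.
apply: le_trans (cmod_sum _ _ _) _.
apply: (@le_trans _ _ (\sum_(p < M)
   (cmod (DK A (s p)) ^+ 2 + cmod (DK B (s p)) ^+ 2) / 2 * F)).
  apply: ler_sum => p _; rewrite cmodM ler_pM ?cmod_ge0//.
  rewrite !cmodM cmod_conj cmod_cexpi mulr1.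
  rewrite ler_pdivlMr//; set u := cmod _; set v := cmod _.
  by have := sqr_ge0 (u - v); rewrite sqrrB; lra.
rewrite -mulr_suml -mulr_suml big_split /= !grid_DK; try (by rewrite /M; lia).
rewrite le_eqVlt; apply/orP; left; apply/eqP.
by field.
Qed.

Definition indz B (z : int) : R := ((0 <= z) && (z < B%:Z))%R%:R.

Lemma Umult_indz A B q : Umult A B q = (\sum_(a < A) indz B (a%:Z + q)) / A%:R.
Proof.
congr (_ / _); apply: eq_bigr => a _; rewrite /indz.
have [/andP[h1 h2]|h] := boolP ((0 <= a%:Z + q) && (a%:Z + q < B%:Z))%R.
  have hb : (absz (a%:Z + q)%R < B)%N by lia.
  rewrite (bigD1 (Ordinal hb))//= big1 ?addr0.
    by rewrite (_ : (_ == q) = true)//; apply/eqP => /=; lia.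
  move=> b; rewrite -val_eqE /= => hb'; case: eqP => //= e.
  by move/eqP: hb'; case; lia.
rewrite big1// => b _; case: eqP => // e; move/negP: h; case.
by have := ltn_ord b; lia.
Qed.

Lemma Umult1 A B q : (0 < A)%N -> (0 <= q)%R -> (q + A%:Z <= B%:Z)%R ->
  Umult A B q = 1.
Proof.
move=> A0 q0 qB; rewrite Umult_indz; under eq_bigr => a _.
  rewrite /indz (_ : _ && _ = true); first over.
  by have := ltn_ord a; lia.
by rewrite sumr_const card_ord divff// pnatr_eq0; lia.
Qed.

Lemma Umult0 A B q : (q <= - A%:Z)%R || (B%:Z <= q)%R -> Umult A B q = 0.
Proof.
move=> h; rewrite Umult_indz big1 ?mul0r// => a _.
by rewrite /indz (_ : _ && _ = false)//; have := ltn_ord a; lia.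
Qed.

Lemma Umult_diff A B q :
  Umult A B (q + 1) - Umult A B q = (indz B (A%:Z + q) - indz B q) / A%:R.
Proof.
rewrite !Umult_indz -mulrBl -sumrB; congr (_ / _).
pose g (a : nat) := indz B (a%:Z + q).
have -> : indz B (A%:Z + q) - indz B q = g A - g 0%N by rewrite /g add0r.
rewrite -(telescope_sumr g (leq0n A)) big_mkord.
by apply: eq_bigr => a _; rewrite /g; congr (indz _ _ - _); lia.
Qed.

(** The triangle is piecewise affine with kinks at [0], [L] and [- L]; the range of [q] sees only
    the one at [0]. *)
Lemma Umult_sd L q : (0 < L)%N -> (absz q < L)%N ->
  Umult L L (q + 1) - 2 * Umult L L q + Umult L L (q - 1) =
  - (2 / L%:R) * (q == 0)%:R.
Proof.
move=> L0 qL; have := Umult_diff L L (q - 1); rewrite subrK => h2.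
have h1 := Umult_diff L L q.
have -> : Umult L L (q + 1) - 2 * Umult L L q + Umult L L (q - 1) =
  (indz L (L%:Z + q) - indz L q) / L%:R
  - (indz L (L%:Z + (q - 1)) - indz L (q - 1)) / L%:R.
  by rewrite -h1 -h2; ring.
rewrite -mulrBl -mulNr mulrAC; congr (_ / _); rewrite /indz.
have [/eqP ->|qn] := boolP (q == 0); last have [q0|q0] := boolP (q < 0)%R; last first.
- have -> : (0 <= L%:Z + q)%R && (L%:Z + q < L%:Z)%R = false by lia.
  have -> : (0 <= L%:Z + (q - 1))%R && (L%:Z + (q - 1) < L%:Z)%R = false by lia.
  have -> : (0 <= q) && (q < L%:Z) by lia.
  have -> : (0 <= q - 1) && (q - 1 < L%:Z) by lia.
  by rewrite /=; ring.
- have -> : (0 <= L%:Z + q)%R && (L%:Z + q < L%:Z)%R by lia.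
  have -> : (0 <= L%:Z + (q - 1))%R && (L%:Z + (q - 1) < L%:Z)%R by lia.
  have -> : (0 <= q) && (q < L%:Z) = false by lia.
  have -> : (0 <= q - 1) && (q - 1 < L%:Z) = false by lia.
  by rewrite /=; ring.
- have -> : (0 <= L%:Z + 0)%R && (L%:Z + 0 < L%:Z)%R = false by lia.
  have -> : (0 <= L%:Z + (0 - 1))%R && (L%:Z + (0 - 1) < L%:Z)%R by lia.
  have -> : (0 <= 0 :> int) && (0 < L%:Z)%R by lia.
  have -> : (0 <= 0 - 1 :> int)%R && (0 - 1 < L%:Z)%R = false by lia.
  by rewrite /=; ring.
Qed.

(** A de la Vallée Poussin cutoff: the trapezoid with [A = 2 N], [B = 4 N], shifted by [- N], is [1]
    on [[- N, N]] and vanishes beyond [3 N]. Each coordinate costs [(2 N + 4 N) / (4 N) = 3 / 2],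
    hence [9 / 4]. *)
Lemma linf_proj N f F : (0 < N)%N -> linf f F ->
  exists f1, [/\ suppin (3 * N) f1, forall k, k \in zbox N -> f1 k = f k &
    linf f1 (9 / 4 * F)].
Proof.
move=> N0 lf; pose U (q : int) : R[i] := (Umult (2 * N) (4 * N) (q - - N%:Z))%:C.
have N0' : (N%:R : R) != 0 by rewrite pnatr_eq0; lia.
exists (fun k => U k.2 * (U k.1 * f k)); split.
- move=> k h; rewrite mem_zbox leqNgt; apply/negbNE/negP => hk; move/eqP: h; apply.
  have h0 q : (3 * N < absz q)%N -> U q = 0.
    by move=> hq; rewrite /U Umult0//; lia.
  have [h1|h1] := boolP (3 * N < absz k.1)%N.
    by rewrite (h0 _ h1) mul0r mulr0.
  by rewrite (h0 k.2) ?mul0r//; move: hk h1; case: ltnP => //; case: ltnP => //; lia.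
- move=> k; rewrite mem_zbox => /andP[h1 h2].
  by rewrite /U !Umult1 ?mul1r//; lia.
- have A0 : (0 < 2 * N)%N by lia.
  have := linf_Umult false (4 * N) (- N%:Z) A0 (linf_Umult true (4 * N) (- N%:Z) A0 lf).
  apply: linf_le; rewrite le_eqVlt; apply/orP; left; apply/eqP.
  by rewrite !natrM; field.
Qed.

Definition sd (g : int -> R[i]) (i : int) : R[i] := g (i + 1) - 2 * g i + g (i - 1).

Lemma real_complex_sd (a b c : R) :
  (a - 2 * b + c)%:C = a%:C - 2 * b%:C + c%:C.
Proof. by apply: complex_eqP => /=; ring. Qed.

(* The triangle [Umult L L] has a point mass as second difference near the origin,
   so summation by parts against it recovers [g]. *)
Lemma sd_repr N L (g : int -> R[i]) q : (4 * N < L)%N ->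
  (forall i, g i != 0 -> i \in zr N) -> (absz q <= 3 * N)%N ->
  g q = - (L%:R / 2)%:C *
        \sum_(i <- zr N.+1) sd g i * (Umult L L (q - i))%:C.
Proof.
move=> NL hg qN; pose U i : R[i] := (Umult L L (q - i))%:C.
have L0 : (L%:R : R) != 0 by rewrite pnatr_eq0; lia.
have hg' i : g i != 0 -> i \in zr N.+1.
  by move/hg; rewrite !mem_zr; lia.
have mz i (z : R[i]) : g i * z != 0 -> i \in zr N.
  by move=> h; apply: hg; apply: contraNneq h => ->; rewrite mul0r.
have E0 : \sum_(i <- zr N.+1) g i * U i = \sum_(i <- zr N) g i * U i.
  apply: sum_supp; rewrite ?uniq_zr// => i; last exact: mz.
  by move/mz; rewrite !mem_zr; lia.
have E1 : \sum_(i <- zr N.+1) g (i + 1) * U i = \sum_(i <- zr N) g i * U (i - 1).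
  rewrite (@sum_reindex _ (zr N) (zr N.+1) _ (fun i => i + 1) (fun i => i - 1)) ?uniq_zr//.
  - by apply: eq_bigr => i _; rewrite addrK.
  - by move=> i; rewrite addrK.
  - by move=> i; rewrite subrK.
  - by move=> i; apply: mz.
  - by move=> i /mz; rewrite !mem_zr; lia.
have E2 : \sum_(i <- zr N.+1) g (i - 1) * U i = \sum_(i <- zr N) g i * U (i + 1).
  rewrite (@sum_reindex _ (zr N) (zr N.+1) _ (fun i => i - 1) (fun i => i + 1)) ?uniq_zr//.
  - by apply: eq_bigr => i _; rewrite subrK.
  - by move=> i; rewrite subrK.
  - by move=> i; rewrite addrK.
  - by move=> i; apply: mz.
  - by move=> i /mz; rewrite !mem_zr; lia.
have -> : \sum_(i <- zr N.+1) sd g i * (Umult L L (q - i))%:C =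
    \sum_(i <- zr N) g i * (- (2 / L%:R) * (q - i == 0)%:R)%:C.
  under eq_bigr do rewrite /sd mulrDl mulrBl -mulrA -/(U _).
  rewrite !big_split /= sumrN -mulr_sumr E0 E1 E2 mulr_sumr -sumrN -!big_split /=.
  rewrite big_seq [RHS]big_seq; apply: eq_bigr => i; rewrite mem_zr => iN.
  rewrite -(@Umult_sd L (q - i)); [|lia..].
  rewrite /U real_complex_sd.
  rewrite (_ : q - (i - 1) = q - i + 1); last by lia.
  rewrite (_ : q - (i + 1) = q - i - 1); last by lia.
  by ring.
have [qz|qz] := boolP (q \in zr N).
  rewrite (bigD1_seq q) ?uniq_zr//= subrr eqxx big1 ?addr0.
    rewrite mulr1 mulrCA -rmorphN -rmorphM /=.
    rewrite (_ : - (L%:R / 2) * - (2 / L%:R) = 1 :> R) ?mulr1//.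
    by field.
  by move=> i iq; rewrite subr_eq0 eq_sym (negbTE iq) mulr0 mulr0.
have -> : g q = 0 by apply/eqP/negbNE; apply: contra qz => /hg.
rewrite big_seq big1 ?mulr0// => i iN; rewrite subr_eq0.
by case: eqP => [e|_]; rewrite ?mulr0//; move: qz; rewrite e iN.
Qed.

Definition msd (m : distr R) k : R[i] :=
  sd (fun j => sd (fun i => m (i, j)) k.1) k.2.

(* [linf_proj] first truncates [f] to degree [3 N] without changing it on the
   support of [m], which is the range where [sd_repr] holds. *)
Lemma linf_mult N (m : distr R) f F : (0 < N)%N -> suppin N m -> linf f F ->
  linf (fun k => m k * f k)
    (((4 * N + 2)%:R / 2) ^+ 2 *
     (\sum_(j <- zbox N.+1) cmod (msd m j)) * (9 / 4 * F)).
Proof.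
(* [L > 4 N] is what [sd_repr] asks for. Each triangle [Umult L L] has norm at most [1], so the
   losses are [(L / 2) ^ 2] from the representation and [9 / 4] from the truncation. *)
move=> N0 hm lf; pose L := (4 * N + 2)%N.
have L0 : (L%:R : R) != 0 by rewrite pnatr_eq0; lia.
have [f1 [h1 h2 lf1]] := linf_proj N0 lf.
have rep k : (absz k.1 <= 3 * N)%N -> (absz k.2 <= 3 * N)%N ->
  m k = ((L%:R / 2) ^+ 2)%:C * \sum_(j <- zbox N.+1) msd m j *
     ((Umult L L (k.2 - j.2))%:C * (Umult L L (k.1 - j.1))%:C).
  case: k => a b /= aN bN.
  rewrite (@sd_repr N L (fun i => m (i, b)) a); [|lia| |by []]; last first.
    by move=> i /hm; rewrite mem_zbox mem_zr => /andP[].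
  have inner (i : int) : sd (fun i' => m (i', b)) i =
      - (L%:R / 2)%:C * \sum_(j <- zr N.+1) msd m (i, j) * (Umult L L (b - j))%:C.
    apply: (@sd_repr N L (fun j => sd (fun i => m (i, j)) i) b); [lia| |by []].
    move=> j hj; rewrite mem_zr; apply/negbNE/negP => jN; move/eqP: hj; apply.
    have z i' : m (i', j) = 0.
      apply/eqP/negbNE/negP => /hm; rewrite mem_zbox /= => /andP[_ h].
      by move: jN; rewrite h.
    by rewrite /sd !z; ring.
  under [in LHS]eq_bigr do rewrite inner -mulrA mulr_suml.
  rewrite -mulr_sumr mulrA big_allpairs /=.
  congr (_ * _).
    by rewrite mulrNN -rmorphM.
  apply: eq_bigr => i _; apply: eq_bigr => j _.
  by rewrite /msd /=; ring.
rewrite -mulrA.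
suff h : linf (fun k => \sum_(j <- zbox N.+1) msd m j *
     ((Umult L L (k.2 - j.2))%:C * ((Umult L L (k.1 - j.1))%:C * f1 k)))
     (\sum_(j <- zbox N.+1) cmod (msd m j) * (9 / 4 * F)).
  have := linfZ ((L%:R / 2) ^+ 2)%:C h.
  rewrite cmodR ger0_norm ?exprn_ge0 ?divr_ge0//= -mulr_suml.
  apply: linf_eq => k.
  have -> : m k * f k = m k * f1 k.
    by have [->|/hm /h2 ->] := eqVneq (m k) 0; rewrite ?mul0r.
  have [->|fk] := eqVneq (f1 k) 0.
    by rewrite big1 ?mulr0// => j _; rewrite !mulr0.
  have /andP[k1 k2] : (absz k.1 <= 3 * N)%N && (absz k.2 <= 3 * N)%N.
    by rewrite -mem_zbox h1.
  rewrite rep// -mulrA mulr_suml; congr (_ * _).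
  by apply: eq_bigr => j _; rewrite !mulrA.
apply: (@linf_sum _ _ xpredT (fun j k => msd m j *
   ((Umult L L (k.2 - j.2))%:C * ((Umult L L (k.1 - j.1))%:C * f1 k)))
   (fun j => cmod (msd m j) * (9 / 4 * F))) => j _; apply: linfZ.
have Lp : (0 < L)%N by rewrite /L; lia.
have := linf_Umult false L j.2 Lp (linf_Umult true L j.1 Lp lf1).
apply: linf_le; rewrite le_eqVlt; apply/orP; left; apply/eqP.
by field.
Qed.

(* Fourier coefficients are averages of [ev] against characters on a grid. *)
Lemma linf_coef f C k : linf f C -> cmod (f k) <= C.
Proof.
move=> lf; have [N hN hf] := lf.
have [->|fk] := eqVneq (f k) 0; first by rewrite cmod0 (linf_ge0 lf).
have kN := hN _ fk.
(* Two frequencies of the box differ by at most [2 N] in each coordinate, so this grid separates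
   them. *)
pose M := (2 * N).+1; have M0' : (M%:R : R) != 0 by rewrite pnatr_eq0.
have -> : f k = (M%:R^-1 ^+ 2)%:C * \sum_(p < M) \sum_(q < M)
    ev N f (p%:R / M%:R) (q%:R / M%:R) * cexpi (- (k.1%:~R * (p%:R / M%:R)))
      * cexpi (- (k.2%:~R * (q%:R / M%:R))).
  have E : \sum_(p < M) \sum_(q < M)
    ev N f (p%:R / M%:R) (q%:R / M%:R) * cexpi (- (k.1%:~R * (p%:R / M%:R)))
      * cexpi (- (k.2%:~R * (q%:R / M%:R))) =
    \sum_(j <- zbox N) f j * ((\sum_(p < M) cexpi ((j.1 - k.1)%:~R * (p%:R / M%:R))) *
       (\sum_(q < M) cexpi ((j.2 - k.2)%:~R * (q%:R / M%:R)))).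
    under [RHS]eq_bigr do rewrite mulr_suml mulr_sumr.
    rewrite [RHS]exchange_big /=; apply: eq_bigr => p _.
    under [RHS]eq_bigr do rewrite mulr_sumr mulr_sumr.
    rewrite [RHS]exchange_big /=; apply: eq_bigr => q _.
    rewrite /ev !mulr_suml; apply: eq_bigr => j _.
    rewrite -!mulrA; congr (_ * _); rewrite -!cexpiD; congr cexpi.
    by rewrite !rmorphB /=; ring.
  rewrite E (bigD1_seq k) ?uniq_zbox//= [X in _ + X]big_seq_cond.
  rewrite [X in _ + X]big1 ?addr0.
    have e : (M%:R^-1 ^+ 2)%:C * (M%:R * M%:R) = 1 :> R[i].
      rewrite natC -rmorphM -rmorphM (_ : _ * _ = 1 :> R) ?rmorph1//; by field.
    by rewrite !subrr !grid_sum// !eqxx !mul1r mulrCA e mulr1.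
  move=> j /andP[]; move: kN; rewrite !mem_zbox => /andP[? ?] /andP[? ?] jk.
  rewrite !grid_sum /M; [|lia..].
  rewrite !subr_eq0; have [e1|] := eqVneq j.1 k.1; last by rewrite !mul0r mulr0.
  have [e2|] := eqVneq j.2 k.2; last by rewrite !mul0r !mulr0.
  by move/eqP: jk; case; case: (j) (k) e1 e2 => [? ?] [? ?] /= -> ->.
rewrite cmodM cmodR ger0_norm ?exprn_ge0// exprVn ler_pdivrMl ?exprn_gt0 ?ltr0n//.
apply: le_trans (cmod_sum _ _ _) _.
have -> : M%:R ^+ 2 * C = \sum_(p < M) \sum_(q < M) C.
  by rewrite !sumr_const !card_ord -mulrnA -[RHS]mulr_natl natrM expr2.
apply: ler_sum => p _; apply: le_trans (cmod_sum _ _ _) _.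
by apply: ler_sum => q _; rewrite !cmodM !cmod_cexpi !mulr1.
Qed.

Lemma linf_sum_coef N f : suppin N f -> linf f (\sum_(k <- zbox N) cmod (f k)).
Proof.
move=> hN; exists N => // x y; apply: le_trans (cmod_sum _ _ _) _.
by apply: ler_sum => k _; rewrite cmodM cmod_cexpi mulr1.
Qed.

End TrigPoly.

(** * Littlewood-Paley blocks *)

Section LittlewoodPaley.
Variable R : realType.
Implicit Types (f g u v : distr R) (k : int * int) (n N : nat) (s B C : R).
Variables chi rho : R -> R -> R.
Hypothesis H : dyadic_partition chi rho.

Let wt := lp_weight chi rho.

Lemma sqr_pow2 n : (2 ^ n)%:R ^+ 2 = 4 ^+ n :> R.
Proof. by rewrite -natrX -expnM mulnC expnM natrX. Qed.

Lemma wt_bound n k : 0 <= wt n k <= 1.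
Proof.
case: H => _ _ h _ _; case: n => [|n] /=.
  by have [] := h k.1%:~R k.2%:~R.
by have [] := h (k.1%:~R / 2 ^+ n) (k.2%:~R / 2 ^+ n).
Qed.

Lemma wt_opp n k : wt n (- k.1, - k.2) = wt n k.
Proof.
case: H => _ [h1 h2] _ _ _; case: n => [|n] /=; rewrite !mulrNz.
  by apply: h1; rewrite !sqrrN.
by apply: h2; rewrite !mulNr !sqrrN.
Qed.

Definition ksq k : R := k.1%:~R ^+ 2 + k.2%:~R ^+ 2.

(** One formula serves both kinds of block: [chi] has radius [4 / 3], and block [n.+1] has outer
    radius [8 / 3 * 2 ^ n = 4 / 3 * 2 ^ n.+1]. *)
Lemma wt_high n k : wt n k != 0 -> ksq k <= 16 / 9 * 4 ^+ n.
Proof.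
case: H => _ _ _ h1 [h2 _]; case: n => [|n] /=.
  by move=> /h1; rewrite expr0 /ksq; lra.
move=> /h2 /andP[_]; rewrite !expr_div_n -mulrDl -/(ksq k) ler_pdivrMr ?exprn_gt0//.
rewrite [4 ^+ n.+1]exprS -[(2 ^+ n) ^+ 2]exprM mulnC exprM.
by rewrite (_ : 2 ^+ 2 = 4 :> R); lra.
Qed.

Lemma wt_low n k : wt n.+1 k != 0 -> 9 / 16 * 4 ^+ n <= ksq k.
Proof.
case: H => _ _ _ h1 [h2 _] /h2 /andP[+ _].
rewrite !expr_div_n -mulrDl -/(ksq k) ler_pdivlMr ?exprn_gt0//.
by rewrite -[(2 ^+ n) ^+ 2]exprM mulnC exprM (_ : 2 ^+ 2 = 4 :> R); lra.
Qed.

Lemma ksq_zbox N k : k \in zbox N -> ksq k <= 2 * N%:R ^+ 2.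
Proof.
rewrite mem_zbox => /andP[h1 h2]; rewrite /ksq mulr_natl mulr2n.
have e (z : int) : (absz z <= N)%N -> (z%:~R : R) ^+ 2 <= N%:R ^+ 2.
  move=> h; rewrite -real_normK ?num_real// ler_sqr ?nnegrE//.
  by rewrite -intr_norm -[N%:R]/(N%:Z%:~R) ler_int; lia.
by rewrite lerD ?e.
Qed.

Lemma wt_supp n k : wt n k != 0 -> k \in zbox (2 ^ n.+1).
Proof.
move=> /wt_high h; rewrite mem_zbox.
have e (z z' : int) : (z%:~R : R) ^+ 2 + (z'%:~R : R) ^+ 2 <= 16 / 9 * 4 ^+ n ->
    (absz z <= 2 ^ n.+1)%N.
  move=> hz; rewrite leqNgt; apply/negP => hlt.
  have : (2 ^ n.+1)%:R ^+ 2 <= (z%:~R : R) ^+ 2.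
    rewrite -[leRHS]real_normK ?num_real// ler_sqr ?nnegrE//.
    by rewrite -intr_norm -[X in X <= _]/((2 ^ n.+1)%N%:Z%:~R) ler_int; lia.
  rewrite sqr_pow2 [4 ^+ n.+1]exprS.
  have := sqr_ge0 (z'%:~R : R); have : 0 < 4 ^+ n :> R by rewrite exprn_gt0.
  by lra.
by rewrite (e _ k.2)// (e _ k.1)// addrC.
Qed.

(** The inner radius of the annulus against the diagonal of the box: [9 / 64 * 4 ^ n <= 2 * L ^ 2],
    and [128 / 9] is rounded up to [16]. *)
Lemma wt_zbox n L k : wt n k != 0 -> k \in zbox L -> (0 < n)%N -> (2 ^ n <= 4 * L)%N.
Proof.
case: n => // n /wt_low h /ksq_zbox h' _.
rewrite leqNgt; apply/negP => hlt.
have : (4 * L)%:R ^+ 2 <= (2 ^ n.+1)%:R ^+ 2 :> R.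
  by rewrite ler_sqr ?nnegrE// ler_nat ltnW.
rewrite sqr_pow2 [4 ^+ n.+1]exprS natrM exprMn.
have : 0 < 4 ^+ n :> R by rewrite exprn_gt0.
by lra.
Qed.

Lemma wt_zbox_pow n L k : (L.+3 <= n)%N -> k \in zbox (2 ^ L) -> wt n k = 0.
Proof.
move=> Ln kL; apply/eqP/negbNE/negP => /wt_zbox /(_ kL) h.
have := h ltac:(lia); rewrite -[4%N]/(2 ^ 2)%N -expnD leq_exp2l//; lia.
Qed.

(** At a fixed frequency all but finitely many weights vanish, so the partial sums of the partition
    of unity are eventually constant and equal their limit. *)
Lemma wt_sum L N k : k \in zbox (2 ^ L) -> (L.+3 <= N)%N -> \sum_(n < N) wt n k = 1.
Proof.
move=> kL LN; case: H => _ _ _ _ [_ /(_ k.1%:~R k.2%:~R) h].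
have E N' : (L.+3 <= N')%N -> \sum_(n < N') wt n k = \sum_(n < L.+3) wt n k.
  move=> h'; rewrite -(subnKC h') big_split_ord /= [X in _ + X]big1 ?addr0//.
  by move=> i _; apply: (@wt_zbox_pow (L.+2 + i).+1 L) => //; lia.
rewrite E//; symmetry; apply: (cvg_unique _ h) => //; last first.
apply: cvg_near_cst; exists L.+3 => // N' /= hN'.
by rewrite -(E N'.+1)// ?big_ord_recl//; lia.
Qed.

Definition blk n u : distr R := fun k => (wt n k)%:C * u k.

Lemma blk_suppin n u : suppin (2 ^ n.+1) (blk n u).
Proof.
move=> k hk; apply: (@wt_supp n); apply: contraNneq hk; rewrite /blk => ->.
by rewrite mul0r.
Qed.

Lemma lp_blockE n u x y : lp_block chi rho n u x y = ev (2 ^ n.+1) (blk n u) x y.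
Proof.
by rewrite /lp_block (sum_box_pt (2 ^ n.+1)
  (fun k => (wt n k)%:C * u k * cexpi (k.1%:~R * x + k.2%:~R * y))).
Qed.

Lemma sup_norm_blk n u C :
  (sup_norm (lp_block chi rho n u) <= C%:E)%E <-> linf (blk n u) C.
Proof.
split=> [h|h].
  exists (2 ^ n.+1)%N; first exact: blk_suppin.
  move=> x y; rewrite -lee_fin -lp_blockE; apply: le_trans h.
  by apply: ereal_sup_ubound; exists x => //; exists y.
apply: ub_ereal_sup => _ [x _ [y _ <-]]; rewrite lp_blockE lee_fin.
exact: (linf_ev h (@blk_suppin n u)).
Qed.

Definition dy s n : R := 2 `^ (- (s * n%:R)).

Lemma dy_gt0 s n : 0 < dy s n. Proof. exact: powR_gt0. Qed.
Lemma dy_ge0 s n : 0 <= dy s n. Proof. exact: powR_ge0. Qed.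

Lemma dy_exp s n : dy s n = dy s 1 ^+ n.
Proof. by rewrite /dy mulr1 -powR_mulrn ?powR_ge0// -powRrM mulNr. Qed.

(* The factor [2 ^ s] in [besov_normP] comes from block [n] having index [n - 1]
   in [besov_norm]. *)
Definition bb s u B := forall n, linf (blk n u) (B * dy s n).

Lemma besov_normP s u B :
  (besov_norm chi rho s u <= B%:E)%E <-> bb s u (B * 2 `^ s).
Proof.
have e n : 2 `^ ((n%:R - 1) * s) * (2 `^ s * dy s n) = 1 :> R.
  rewrite /dy -!powRD ?pnatr_eq0 ?implybT//.
  by rewrite (_ : (n%:R - 1) * s + _ = 0) ?powRr0//; ring.
have p n : 0 < 2 `^ ((n%:R - 1) * s) :> R by exact: powR_gt0.
split=> [h n|h].
  apply/sup_norm_blk; have : ((2 `^ ((n%:R - 1) * s))%:E *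
     sup_norm (lp_block chi rho n u) <= B%:E)%E.
    by apply: le_trans h; apply: ereal_sup_ubound; exists n.
  rewrite -lee_pdivlMl// => /le_trans; apply.
  by rewrite lee_fin ler_pdivrMl// -mulrA mulrCA e mulr1.
apply: ub_ereal_sup => _ [n _ <-]; rewrite -lee_pdivlMl//.
apply/sup_norm_blk; apply: linf_le (h n).
by rewrite ler_pdivlMl// -mulrA mulrCA e mulr1.
Qed.

Lemma bb_ge0 s u B : bb s u B -> 0 <= B.
Proof. by move=> /(_ 0%N) /linf_ge0; rewrite pmulr_lge0// dy_gt0. Qed.

Lemma besov_norm_ge0 s u : (0 <= besov_norm chi rho s u)%E.
Proof.
have h (F : R -> R -> R[i]) : (0 <= sup_norm F)%E.
  apply: (@le_trans _ _ (cmod (F 0 0))%:E); first by rewrite lee_fin cmod_ge0.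
  by apply: ereal_sup_ubound; exists 0 => //; exists 0.
apply: (@le_trans _ _ ((2 `^ ((0%:R - 1) * s))%:E *
  sup_norm (lp_block chi rho 0 u))%E).
  by rewrite mule_ge0// lee_fin powR_ge0.
by apply: ereal_sup_ubound; exists 0%N.
Qed.

Lemma bb_le s u B C : B <= C -> bb s u B -> bb s u C.
Proof. by move=> BC h n; apply: linf_le (h n); rewrite ler_wpM2r ?dy_ge0. Qed.

Lemma bb_weaken s s' u B : s' <= s -> bb s u B -> bb s' u B.
Proof.
move=> ss h n; apply: linf_le (h n); rewrite ler_wpM2l ?(bb_ge0 h)//.
by rewrite /dy ler_powR ?ler1n// lerN2 ler_wpM2r.
Qed.

Lemma bbD s u v B C : bb s u B -> bb s v C -> bb s (dadd u v) (B + C).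
Proof.
move=> hu hv n; rewrite mulrDl; apply: linf_eq (linfD (hu n) (hv n)) => k.
by rewrite /blk /dadd mulrDr.
Qed.

Lemma bbZ s u B c : bb s u B -> bb s (dscale c u) (cmod c * B).
Proof.
move=> hu n; rewrite -mulrA; apply: linf_eq (linfZ c (hu n)) => k.
by rewrite /blk /dscale mulrCA.
Qed.

Definition dsub u v : distr R := fun k => u k - v k.

Lemma bbB s u v B C : bb s u B -> bb s v C -> bb s (dsub u v) (B + C).
Proof.
move=> hu hv n; rewrite mulrDl; apply: linf_eq (linfB (hu n) (hv n)) => k.
by rewrite /blk /dsub mulrBr.
Qed.

Lemma blk_dconj n u : blk n (dconj u) = dconj (blk n u).
Proof.
apply/funext => k; rewrite /blk /dconj cconjM wt_opp; congr (_ * _).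
by apply: complex_eqP => //=; rewrite oppr0.
Qed.

Lemma bb_dconj s u B : bb s u B -> bb s (dconj u) B.
Proof. by move=> h n; rewrite blk_dconj; apply: linf_dconj. Qed.

Lemma bb0 s : bb s (fun=> 0) 0.
Proof. by move=> n; rewrite mul0r; apply: linf_eq (@linf0 R) => k; rewrite /blk mulr0. Qed.

Lemma blk_sum L N u k : k \in zbox (2 ^ L) -> (L.+3 <= N)%N ->
  \sum_(n < N) blk n u k = u k.
Proof.
by move=> h h'; rewrite /blk -mulr_suml -rmorph_sum (wt_sum h h') mul1r.
Qed.

Definition kexp k := maxn (absz k.1) (absz k.2).

Lemma kexpP k : k \in zbox (2 ^ kexp k).
Proof.
rewrite mem_zbox /kexp; set m := maxn _ _; have := ltn_expl m (isT : (1 < 2)%N).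
by rewrite /m; lia.
Qed.

Definition coefc s k : R := \sum_(n < (kexp k).+3) dy s n.

Lemma coefc_ge0 s k : 0 <= coefc s k.
Proof. by apply: sumr_ge0 => n _; exact: dy_ge0. Qed.

(** Finitely many blocks see the frequency [k], and each controls its own coefficients. This holds
    for every real [s] and turns Besov estimates into coefficientwise convergence. *)
Lemma bb_coef s u B k : bb s u B -> cmod (u k) <= coefc s k * B.
Proof.
move=> h; rewrite -(blk_sum u (kexpP k) (leqnn _)).
apply: le_trans (cmod_sum _ _ _) _; rewrite /coefc mulr_suml.
by apply: ler_sum => n _; rewrite mulrC; exact: linf_coef.
Qed.

End LittlewoodPaley.

(** * The heat semigroup on Littlewood-Paley blocks *)

Section SecondDifferences.
Variable R : realType.

Lemma is_derive_mul (f g : R -> R) (x df dg : R) :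
  is_derive x 1 f df -> is_derive x 1 g dg ->
  is_derive x (1 : R) (fun s => f s * g s) (df * g x + f x * dg).
Proof.
move=> hf hg; apply: (is_derive_eq (is_deriveM hf hg)).
by rewrite /GRing.scale /=; ring.
Qed.

Lemma is_derive_comp1 (f g : R -> R) (x df dg : R) :
  is_derive x 1 g dg -> is_derive (g x) 1 f df ->
  is_derive x (1 : R) (fun s => f (g s)) (df * dg).
Proof. by move=> hg hf; apply: (is_derive_eq (is_derive1_comp hf hg)); rewrite /GRing.scale /=; ring. Qed.

Lemma is_derive_pow n (x : R) : is_derive x 1 (fun s : R => s ^+ n) (n%:R * x ^+ n.-1).
Proof.
have := is_deriveX n (is_derive_id x 1).
rewrite (_ : id ^+ n = fun s : R => s ^+ n); last by apply/funext => s; rewrite exprfctE.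
move=> h; apply: (is_derive_eq h).
by rewrite /GRing.scale /= mulr1 mulr_natl.
Qed.

Lemma is_derive_affsq (p w x : R) :
  is_derive x 1 (fun s : R => p * (s ^+ 2 + w)) (2 * p * x).
Proof.
have h : is_derive x 1 (fun s : R => s ^+ 2 + w) (2 * x).
  apply: (is_derive_eq (is_deriveD (is_derive_pow 2 x) (is_derive_cst w x 1))).
  by rewrite addr0.
apply: (is_derive_eq (is_derive_mul (is_derive_cst p x 1) h)).
by rewrite /cst /=; ring.
Qed.

(** Real and imaginary parts of the oscillating factor, indexed by a boolean so that differentiation
    is negation of the index up to the sign [trigs]. *)
Definition trig (i : bool) : R -> R := if i then @cos R else @sin R.
Definition trigs (i : bool) : R := if i then - 1 else 1.

Lemma is_derive_trig i (x : R) : is_derive x 1 (trig i) (trigs i * trig (~~ i) x).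
Proof.
case: i => /=; first by apply: (is_derive_eq (is_derive_cos x)); rewrite mulN1r.
by apply: (is_derive_eq (is_derive_sin x)); rewrite mul1r.
Qed.

Lemma trig_le1 i (x : R) : `|trig i x| <= 1.
Proof. by case: i; rewrite /trig ler_norml ?cos_geN1 ?cos_le1 ?sin_geN1 ?sin_le1. Qed.

Lemma is_derive_gauss (K p q w : R) b i (phi : R -> R) (x dphi : R) :
  is_derive x 1 phi dphi ->
  is_derive x 1 (fun s : R => K * (s ^+ b * (phi s *
       (expR (- p * (s ^+ 2 + w)) * trig i (q * (s ^+ 2 + w))))))
   (let r := x ^+ 2 + w in let E := expR (- p * r) in
    K * (b%:R * x ^+ b.-1 * phi x * E * trig i (q * r)
      + x ^+ b * dphi * E * trig i (q * r)
      - 2 * p * (x ^+ b.+1 * phi x * E * trig i (q * r))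
      + 2 * q * trigs i * (x ^+ b.+1 * phi x * E * trig (~~ i) (q * r)))).
Proof.
move=> h.
have h1 := is_derive_comp1 (is_derive_affsq (- p) w x) (is_derive_expR _).
have h2 := is_derive_comp1 (is_derive_affsq q w x) (is_derive_trig i _).
have h3 := is_derive_mul h (is_derive_mul h1 h2).
have h4 := is_derive_mul (is_derive_cst K x 1) (is_derive_mul (is_derive_pow b x) h3).
apply: (is_derive_eq h4) => /=.
by rewrite /cst !exprS; ring.
Qed.

(** Two mean value theorems: one for [u (s + e) - u s] on [[x - e, x]], then one for [u1] on the
    resulting [[c, c + e]]. *)
Lemma second_diff (u u1 u2 : R -> R) (x e : R) : 0 < e ->
  (forall s : R, is_derive s 1 u (u1 s)) -> (forall s : R, is_derive s 1 u1 (u2 s)) ->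
  exists z, u (x + e) - 2 * u x + u (x - e) = e ^+ 2 * u2 z.
Proof.
move=> e0 h1 h2.
have cont (v v1 : R -> R) (a b : R) : (forall s : R, is_derive s 1 v (v1 s)) ->
    {within `[a, b], continuous v}.
  move=> hv; apply: continuous_subspaceT => s.
  by apply: differentiable_continuous; apply/derivable1_diffP; have [] := hv s.
pose v s := u (s + e) - u s.
have hv (s : R) : is_derive s 1 v (u1 (s + e) - u1 s).
  have hs : is_derive s 1 (fun s' : R => s' + e) (1 : R).
    apply: (is_derive_eq (is_deriveD (is_derive_id s 1) (is_derive_cst e s 1))).
    by rewrite addr0.
  apply: (is_derive_eq (is_deriveB (is_derive_comp1 hs (h1 (s + e))) (h1 s))).
  by rewrite mulr1.
have [c _ hc] := @MVT R v (fun s => u1 (s + e) - u1 s) (x - e) x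
   ltac:(lra) (fun s _ => hv s) (cont _ _ _ _ hv).
have [z _ hz] := @MVT R u1 u2 c (c + e) ltac:(lra) (fun s _ => h2 s) (cont _ _ _ _ h2).
exists z; transitivity (v x - v (x - e)).
  by rewrite /v subrK; ring.
by rewrite hc hz; ring.
Qed.

End SecondDifferences.

(** * Families of symbols with exponentially decaying derivatives *)

Section GoodFamilies.
Variable R : realType.
Variables (c : R).
Implicit Types G : R -> R -> R -> R.

(** The power of [1 + tau] is left free because differentiating the heat factor in space produces
    factors [tau]; the exponential absorbs them at the end, in [expR_decay]. *)
Definition fbound G := exists (C : R) n, 0 <= C /\ forall tau x y : R, 0 <= tau ->
  `|G tau x y| <= C * (1 + tau) ^+ n * expR (- c * tau).

Definition fderiv (b : bool) G G' := forall tau x y : R,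
  if b then is_derive x 1 (fun s => G tau s y) (G' tau x y)
  else is_derive y 1 (fun s => G tau x s) (G' tau x y).

(** Bounds on all mixed derivatives up to order [n]. The derivatives are existential, so that sums
    and multiples are handled without computing them. *)
Fixpoint good n G := fbound G /\
  if n is n'.+1 then forall b, exists2 G', fderiv b G G' & good n' G' else True.

Lemma fboundD G G' : fbound G -> fbound G' ->
  fbound (fun tau x y => G tau x y + G' tau x y).
Proof.
move=> [C [n [C0 h]]] [C' [n' [C0' h']]]; exists (C + C'), (n + n')%N.
split; first exact: addr_ge0.
move=> tau x y t0; apply: le_trans (ler_normD _ _) _; rewrite !mulrDl.
apply: lerD; [apply: le_trans (h _ _ _ t0) _|apply: le_trans (h' _ _ _ t0) _].
  by rewrite ler_wpM2r ?expR_ge0// ler_wpM2l// ler_weXn2l ?lerDl ?leq_addr.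
by rewrite ler_wpM2r ?expR_ge0// ler_wpM2l// ler_weXn2l ?lerDl ?leq_addl.
Qed.

Lemma fboundZ (a : R) G : fbound G -> fbound (fun tau x y => a * G tau x y).
Proof.
move=> [C [n [C0 h]]]; exists (`|a| * C), n; split; first exact: mulr_ge0.
by move=> tau x y t0; rewrite normrM -!mulrA ler_wpM2l// mulrA h.
Qed.

Lemma goodD n G G' : good n G -> good n G' -> good n (fun tau x y => G tau x y + G' tau x y).
Proof.
elim: n G G' => [|n ih] G G' [hb h] [hb' h']; split=> //; try exact: fboundD.
move=> b; have [G1 d1 g1] := h b; have [G1' d1' g1'] := h' b.
exists (fun tau x y => G1 tau x y + G1' tau x y); last exact: ih.
move=> tau x y; have := d1 tau x y; have := d1' tau x y; case: (b) => A B.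
  exact: (is_deriveD B A).
exact: (is_deriveD B A).
Qed.

Lemma goodZ n a G : good n G -> good n (fun tau x y => a * G tau x y).
Proof.
elim: n G => [|n ih] G [hb h]; split=> //; try exact: fboundZ.
move=> b; have [G1 d1 g1] := h b.
exists (fun tau x y => a * G1 tau x y); last exact: ih.
move=> tau x y; have := d1 tau x y; case: (b) => A.
  apply: (is_derive_eq (is_derive_mul (is_derive_cst a x 1) A)).
  by rewrite mul0r add0r.
apply: (is_derive_eq (is_derive_mul (is_derive_cst a y 1) A)).
by rewrite mul0r add0r.
Qed.

Definition diff22 (G : R -> R -> R) (x y e : R) : R :=
  let v s := G s (y + e) - 2 * G s y + G s (y - e) in
  v (x + e) - 2 * v x + v (x - e).

(** [second_diff] in [x], applied to the second difference in [y], and then in [y]: the result is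
    [e ^ 4] times the derivative twice in [x] and twice in [y] at an unknown point, which the bound
    uniform in space controls. *)
Lemma good_diff22 G : good 4 G -> exists (C : R) n, 0 <= C /\
  forall tau x y e : R, 0 <= tau -> 0 < e ->
  `|diff22 (G tau) x y e| <= C * (1 + tau) ^+ n * expR (- c * tau) * e ^+ 4.
Proof.
move=> [_ /(_ true) [G1 d1 [_ /(_ true) [G2 d2
  [_ /(_ false) [G3 d3 [_ /(_ false) [G4 d4 [[C [n [C0 h]]] _]]]]]]]]].
exists C, n; split=> // tau x y e t0 e0.
pose comb (F : R -> R -> R) s := F s (y + e) - 2 * F s y + F s (y - e).
have hc (F F1 : R -> R -> R) : (forall s t : R, is_derive s 1 (fun s' => F s' t) (F1 s t)) ->
    forall s : R, is_derive s 1 (comb F) (comb F1 s).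
  move=> hF s; have h2 := is_derive_mul (is_derive_cst (2 : R) s 1) (hF s y).
  have := is_deriveD (is_deriveB (hF s (y + e)) h2) (hF s (y - e)).
  by move=> hs; apply: (is_derive_eq hs); rewrite /comb mul0r add0r.
have [z hz] := second_diff x e0 (hc _ _ (d1 tau)) (hc _ _ (d2 tau)).
have [w hw] := second_diff y e0 (d3 tau z) (d4 tau z).
rewrite /diff22 -/(comb (G tau)) hz /comb hw mulrA -exprD normrM.
by rewrite (ger0_norm (exprn_ge0 _ (ltW e0))) mulrC ler_wpM2r ?exprn_ge0 ?(ltW e0)// h.
Qed.

End GoodFamilies.

(** * The heat symbol cut off to a dyadic annulus *)

Section CutoffHeat.
Variable R : realType.
Variables chi rho : R -> R -> R.
Hypothesis H : dyadic_partition chi rho.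

Let D s := iter_pdiff s rho.

(** The complement of the closed annulus is open, so a function vanishing there vanishes near each
    of its points and its derivatives are zero there too. *)
Lemma iter_pdiff_supp s (x y : R) : D s x y != 0 ->
  9 / 16 <= x ^+ 2 + y ^+ 2 <= 64 / 9.
Proof.
have key (z : R) : (z < 9 / 16 \/ 64 / 9 < z) <-> ~ (9 / 16 <= z <= 64 / 9).
  split=> [[h|h] /andP[]|/negP]; [lra|lra|].
  by rewrite negb_and -!ltNge => /orP.
suff h : (x ^+ 2 + y ^+ 2 < 9 / 16 \/ 64 / 9 < x ^+ 2 + y ^+ 2) -> D s x y = 0.
  move=> hD; apply/negbNE/negP => /negP hn; move/eqP: hD; apply; apply: h.
  by apply/key => h; rewrite h in hn.
elim: s x y => [|b s ih] x y hxy.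
  case: H => _ _ _ _ [h _]; apply/eqP/negbNE/negP => /h hr.
  have e1 : (3 / 4) ^+ 2 = 9 / 16 :> R by field.
  have e2 : (8 / 3) ^+ 2 = 64 / 9 :> R by field.
  by move/key: hxy; apply; rewrite -e1 -e2.
have zero (F : R -> R) (u : R) : (\forall v \near u, F v = 0) -> derive1 F u = 0.
  by move=> h; rewrite derive1E (near_eq_derive _ (g := cst 0))// derive_cst.
have nearP (u w : R) : (u ^+ 2 + w ^+ 2 < 9 / 16 \/ 64 / 9 < u ^+ 2 + w ^+ 2) ->
    \forall v \near u, (v ^+ 2 + w ^+ 2 < 9 / 16 \/ 64 / 9 < v ^+ 2 + w ^+ 2).
  have c : (fun v : R => v ^+ 2 + w ^+ 2) @ u --> u ^+ 2 + w ^+ 2.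
    by apply: cvgD; [exact: exprn_continuous|exact: cvg_cst].
  move=> [h|h].
    have : \forall v \near u, v ^+ 2 + w ^+ 2 < 9 / 16 by exact: cvgr_lt c _ h.
    by move=> h'; near=> v; left; near: v.
  have : \forall v \near u, 64 / 9 < v ^+ 2 + w ^+ 2 by exact: cvgr_gt c _ h.
  by move=> h'; near=> v; right; near: v.
rewrite /D /= -/(D s) /pdiff; case: b.
  by apply: zero; apply: filterS (nearP x y hxy) => v; exact: ih.
apply: zero; have := nearP y x; rewrite addrC => /(_ hxy).
by apply: filterS => v; rewrite addrC; exact: ih.
Unshelve. all: by end_near. Qed.

(** Continuity on a compact square; the side [3] exceeds the outer radius [8 / 3]. *)
Lemma iter_pdiff_bounded s : exists2 B : R, 0 <= B & forall x y, `|D s x y| <= B.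
Proof.
case: H => [[_ hr] _ _ _ _]; have [_ hc] := hr s.
pose K : set (R * R) := `[-3, 3] `*` `[-3, 3].
have cK : compact K by apply: compact_setX; exact: segment_compact.
have := compact_bounded (continuous_compact (continuous_subspaceT hc) cK).
move=> [B [_ hB]]; exists (`|B| + 1); first by rewrite addr_ge0.
move=> x y; have [->|h] := eqVneq (D s x y) 0; first by rewrite normr0 addr_ge0.
apply: (hB (`|B| + 1)); first by have := ler_norm B; lra.
exists (x, y) => //; have /andP[_ h2] := iter_pdiff_supp h.
have e (u w : R) : u ^+ 2 + w ^+ 2 <= 64 / 9 -> -3 <= u <= 3.
  move=> huw; rewrite -ler_norml -(@ler_sqr R) ?nnegrE// real_normK ?num_real//.
  by have := sqr_ge0 w; lra.
by split; rewrite /= in_itv /=; [apply: e h2|apply: (@e _ x); rewrite addrC].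
Qed.

Variables p0 q0 : R.
Hypothesis p0_gt0 : 0 < p0.

(* The monomial factors make the family stable under differentiation in [x], [y]. *)
Definition cutheat a b c s i (tau x y : R) : R :=
  tau ^+ a * (x ^+ b * (y ^+ c * (D s x y *
    (expR (- (p0 * tau) * (x ^+ 2 + y ^+ 2)) * trig i (q0 * tau * (x ^+ 2 + y ^+ 2)))))).

(** The annulus stays away from the origin, so [x ^ 2 + y ^ 2 >= 9 / 16] gives the exponential rate,
    while [3] bounds both coordinates in the monomials. *)
Lemma cutheat_bound a b c s i : fbound (p0 * (9 / 16)) (cutheat a b c s i).
Proof.
have [B B0 hB] := iter_pdiff_bounded s.
exists (3 ^+ b * 3 ^+ c * B), a; split; first by rewrite !mulr_ge0 ?exprn_ge0.
move=> tau x y t0; rewrite /cutheat.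
have [->|h] := eqVneq (D s x y) 0.
  by rewrite mul0r !mulr0 normr0 !mulr_ge0 ?exprn_ge0 ?addr_ge0 ?expR_ge0.
have /andP[h1 h2] := iter_pdiff_supp h.
have e (u w : R) : u ^+ 2 + w ^+ 2 <= 64 / 9 -> `|u| <= 3.
  move=> huw; rewrite -(@ler_sqr R) ?nnegrE// real_normK ?num_real//.
  by have := sqr_ge0 w; lra.
have hx : `|x| <= 3 := e _ _ h2.
have hy : `|y| <= 3 by apply: (@e _ x); rewrite addrC.
rewrite !normrM !normrX (ger0_norm t0) (ger0_norm (expR_ge0 _)).
have -> : 3 ^+ b * 3 ^+ c * B * (1 + tau) ^+ a * expR (- (p0 * (9 / 16)) * tau) =
  (1 + tau) ^+ a * (3 ^+ b * (3 ^+ c * (B * (expR (- (p0 * (9 / 16)) * tau) * 1)))) by ring.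
apply: ler_pM; rewrite ?exprn_ge0 ?mulr_ge0 ?expR_ge0 ?exprn_ge0//.
  by rewrite lerXn2r ?nnegrE ?addr_ge0 ?lerDr.
apply: ler_pM; rewrite ?exprn_ge0 ?mulr_ge0 ?expR_ge0 ?exprn_ge0//.
  by rewrite lerXn2r ?nnegrE.
apply: ler_pM; rewrite ?exprn_ge0 ?mulr_ge0 ?expR_ge0 ?exprn_ge0//.
  by rewrite lerXn2r ?nnegrE.
apply: ler_pM; rewrite ?mulr_ge0 ?expR_ge0//.
apply: ler_pM; rewrite ?expR_ge0 ?trig_le1//.
by rewrite ler_expR !mulNr lerN2 -mulrA -[leRHS]mulrA ler_pM2l// mulrC ler_wpM2l.
Qed.

Lemma cutheat_good n a b c s i : good (p0 * (9 / 16)) n (cutheat a b c s i).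
Proof.
elim: n a b c s i => [|n ih] a b c s i; split=> //; try exact: cutheat_bound.
have hs (x y : R) : is_derive x 1 (fun v => D s v y) (D (true :: s) x y) /\
    is_derive y 1 (fun v => D s x v) (D (false :: s) x y).
  case: H => [[_ hr] _ _ _ _]; have [+ _] := hr s => /(_ x y) [h1 h2].
  by split; rewrite /D /= derive1E; apply: derivableP.
have P K1 K2 K3 K4 G1 G2 G3 G4 : good (p0 * (9 / 16)) n G1 ->
   good (p0 * (9 / 16)) n G2 -> good (p0 * (9 / 16)) n G3 ->
   good (p0 * (9 / 16)) n G4 -> good (p0 * (9 / 16)) n (fun tau x y =>
     K1 * G1 tau x y + K2 * G2 tau x y + K3 * G3 tau x y + K4 * G4 tau x y).
  by move=> g1 g2 g3 g4; do 3 ?[apply: goodD]; exact: goodZ.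
case.
  exists (fun tau x y => b%:R * cutheat a b.-1 c s i tau x y
     + 1 * cutheat a b c (true :: s) i tau x y
     + (- 2 * p0) * cutheat a.+1 b.+1 c s i tau x y
     + (2 * q0 * trigs R i) * cutheat a.+1 b.+1 c s (~~ i) tau x y).
    move=> tau x y; have h := is_derive_gauss (tau ^+ a * y ^+ c) (p0 * tau)
      (q0 * tau) (y ^+ 2) b i (proj1 (hs x y)).
    have -> : (fun s0 : R => cutheat a b c s i tau s0 y) = (fun v : R =>
       tau ^+ a * y ^+ c * (v ^+ b * (D s v y * (expR (- (p0 * tau) * (v ^+ 2 + y ^+ 2)) *
           trig i (q0 * tau * (v ^+ 2 + y ^+ 2)))))).
      by apply/funext => v; rewrite /cutheat; ring.
    by apply: (is_derive_eq h); rewrite /cutheat /= !exprS; ring.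
  by apply: P; exact: ih.
exists (fun tau x y => c%:R * cutheat a b c.-1 s i tau x y
     + 1 * cutheat a b c (false :: s) i tau x y
     + (- 2 * p0) * cutheat a.+1 b c.+1 s i tau x y
     + (2 * q0 * trigs R i) * cutheat a.+1 b c.+1 s (~~ i) tau x y).
  move=> tau x y; have h := is_derive_gauss (tau ^+ a * x ^+ b) (p0 * tau)
      (q0 * tau) (x ^+ 2) c i (proj2 (hs x y)).
  have -> : (fun s0 : R => cutheat a b c s i tau x s0) = (fun v : R =>
       tau ^+ a * x ^+ b * (v ^+ c * (D s x v * (expR (- (p0 * tau) * (v ^+ 2 + x ^+ 2)) *
           trig i (q0 * tau * (v ^+ 2 + x ^+ 2)))))).
    by apply/funext => v; rewrite /cutheat [v ^+ 2 + _]addrC; ring.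
  by apply: (is_derive_eq h); rewrite /cutheat /= ![y ^+ 2 + _]addrC !exprS; ring.
by apply: P; exact: ih.
Qed.

(** With [v = c * tau / n.+1] one has [1 + tau <= A * (1 + v) <= A * expR v]; the power [n.+1] of
    this is the claim. *)
Lemma expR_decay n (c : R) : 0 < c -> exists2 C : R, 0 <= C &
  forall tau, 0 <= tau -> (1 + tau) ^+ n * expR (- c * tau) <= C / (1 + tau).
Proof.
move=> c0; pose A := 1 + n.+1%:R / c.
have A0 : 0 <= A by rewrite addr_ge0 ?divr_ge0 ?ltW.
exists (A ^+ n.+1) => [|tau t0]; first exact: exprn_ge0.
have t1 : 0 < 1 + tau by lra.
rewrite ler_pdivlMr// mulrAC -exprSr mulNr expRN ler_pdivrMr ?expR_gt0//.
have -> : c * tau = n.+1%:R * (c * tau / n.+1%:R) by field.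
rewrite expRM_natl -exprMn ler_pXn2r ?nnegrE ?mulr_ge0 ?expR_ge0//; last by lra.
apply: (@le_trans _ _ (A * (1 + c * tau / n.+1%:R))); last first.
  by rewrite ler_wpM2l// expR_ge1Dx.
have ab : n.+1%:R / c * (c * tau / n.+1%:R) = tau.
  by field; rewrite (gt_eqF c0) andbT addrC natr1 pnatr_eq0.
have : 0 <= n.+1%:R / c by rewrite divr_ge0 ?ltW.
have : 0 <= c * tau / n.+1%:R by rewrite divr_ge0 ?mulr_ge0 ?(ltW c0).
rewrite /A; move: ab; set u := _ / c; set v := _ / n.+1%:R => ab u0 v0.
by rewrite (_ : (1 + u) * (1 + v) = 1 + u + v + u * v); [rewrite ab; lra|ring].
Qed.

Lemma cutheat_diff22 : exists2 C : R, 0 <= C & forall i (tau x y e : R),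
  0 <= tau -> 0 < e -> `|diff22 (cutheat 0 0 0 [::] i tau) x y e| <= C / (1 + tau) * e ^+ 4.
Proof.
have c0 : 0 < p0 * (9 / 16) by rewrite mulr_gt0.
have one i : exists2 C : R, 0 <= C & forall (tau x y e : R),
  0 <= tau -> 0 < e -> `|diff22 (cutheat 0 0 0 [::] i tau) x y e| <= C / (1 + tau) * e ^+ 4.
  have [C [n [C0 h]]] := good_diff22 (cutheat_good 4 0 0 0 [::] i).
  have [C' C'0 h'] := expR_decay n c0.
  exists (C * C'); first exact: mulr_ge0.
  move=> tau x y e t0 e0; apply: le_trans (h _ _ _ _ t0 e0) _.
  by rewrite ler_wpM2r ?exprn_ge0 ?(ltW e0)// -!mulrA ler_wpM2l// h'.
have [C1 C10 h1] := one true; have [C2 C20 h2] := one false.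
exists (C1 + C2); first exact: addr_ge0.
move=> i tau x y e t0 e0; case: i; [apply: le_trans (h1 _ _ _ _ t0 e0) _|
  apply: le_trans (h2 _ _ _ _ t0 e0) _];
  by rewrite ler_wpM2r ?exprn_ge0 ?(ltW e0)// ler_wpM2r ?invr_ge0 ?lerDl ?lerDr//; lra.
Qed.

(** The cut off symbol in rescaled frequency [k / 2 ^ m]; it will be used with [tau = t * 4 ^ m],
    for which the rescaling cancels in the heat factor. *)
Definition cutheat_mult m tau : distr R := fun k =>
  let x := k.1%:~R / 2 ^+ m in let y := k.2%:~R / 2 ^+ m in
  cutheat 0 0 0 [::] true tau x y +i* cutheat 0 0 0 [::] false tau x y.

Lemma msd_cutheat m tau k :
  msd (cutheat_mult m tau) k =
  diff22 (cutheat 0 0 0 [::] true tau) (k.1%:~R / 2 ^+ m) (k.2%:~R / 2 ^+ m) (2 ^+ m)^-1 +i*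
  diff22 (cutheat 0 0 0 [::] false tau) (k.1%:~R / 2 ^+ m) (k.2%:~R / 2 ^+ m) (2 ^+ m)^-1.
Proof.
have e1 (z : int) : (z + 1)%:~R / 2 ^+ m = z%:~R / 2 ^+ m + (2 ^+ m)^-1 :> R.
  by rewrite rmorphD /= mulrDl mul1r.
have e2 (z : int) : (z - 1)%:~R / 2 ^+ m = z%:~R / 2 ^+ m - (2 ^+ m)^-1 :> R.
  by rewrite rmorphB /= mulrBl mul1r.
rewrite /msd /sd /cutheat_mult /diff22 /= !e1 !e2.
by apply: complex_eqP => /=; ring.
Qed.

(** Uniformity in [m] is a scaling count. With mesh [e = 2^-m] and box size [N = 2 ^ m.+2], the
    second differences are [O(e ^ 4)] at no more than [(5 N) ^ 2] points, and [linf_mult]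
    contributes at most [(3 N) ^ 2]; the product involves only [(e * N) ^ 4 = 256]. *)
Lemma linf_cutheat : exists2 C : R, 0 <= C & forall m tau f F, 0 <= tau ->
  linf f F -> linf (fun k => cutheat_mult m tau k * f k) (C / (1 + tau) * F).
Proof.
have [C C0 hC] := cutheat_diff22.
exists (2 * C * (15 ^+ 2 * (9 / 4) * 256)) => [|m tau f F t0 lf]; first by rewrite !mulr_ge0.
pose N := (2 ^ m.+2)%N; have N0 : (0 < N)%N by rewrite expn_gt0.
have hN : suppin N (cutheat_mult m tau).
  move=> k hk; apply: (wt_supp H (n := m.+1)).
  apply: contraNneq hk => h.
  have {}h : rho (k.1%:~R / 2 ^+ m) (k.2%:~R / 2 ^+ m) = 0 by [].
  by rewrite /cutheat_mult /cutheat /D /= h !mul0r !mulr0.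
apply: linf_le (linf_mult N0 hN lf).
have F0 := linf_ge0 lf.
have t1 : 0 < 1 + tau by lra.
pose e : R := (2 ^+ m)^-1; have e0 : 0 < e by rewrite invr_gt0 exprn_gt0.
have hS : \sum_(j <- zbox N.+1) cmod (msd (cutheat_mult m tau) j) <=
   (5 * N%:R) ^+ 2 * (2 * (C / (1 + tau) * e ^+ 4)).
  apply: (@le_trans _ _ (\sum_(j <- zbox N.+1) 2 * (C / (1 + tau) * e ^+ 4))).
    apply: ler_sum => j _; rewrite msd_cutheat; apply: le_trans (cmod_ReIm _) _ => /=.
    by rewrite mulr_natl mulr2n lerD// hC.
  rewrite big_const_seq count_predT iter_addr_0 -[leLHS]mulr_natl ler_wpM2r//.
    by rewrite !mulr_ge0 ?invr_ge0 ?exprn_ge0 ?(ltW e0) ?(ltW t1).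
  rewrite size_allpairs /zr size_map size_iota natrM -expr2 ler_sqr ?nnegrE ?mulr_ge0//.
  by rewrite -natrM ler_nat; lia.
have eN : e * N%:R = 4.
  by rewrite /e /N natrX 2!exprS; field; rewrite expf_neq0.
have e4 : e ^+ 4 * N%:R ^+ 4 = 256 by rewrite -exprMn eN; ring.
apply: (@le_trans _ _ ((3 * N%:R) ^+ 2 * ((5 * N%:R) ^+ 2 * (2 * (C / (1 + tau) * e ^+ 4))) * (9 / 4 * F))).
  rewrite ler_wpM2r ?mulr_ge0//; apply: ler_pM; [by rewrite exprn_ge0 ?divr_ge0|
    by apply: sumr_ge0 => j _; exact: cmod_ge0| |exact: hS].
  rewrite ler_sqr ?nnegrE ?divr_ge0 ?mulr_ge0//.
  rewrite ler_pdivrMr// -!natrM ler_nat; lia.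
rewrite le_eqVlt; apply/orP; left; apply/eqP.
transitivity (9 * 25 * 2 * 9 / 4 * (C / (1 + tau) * F) * (e ^+ 4 * N%:R ^+ 4)).
  by ring.
by rewrite e4; field; rewrite gt_eqF.
Qed.

End CutoffHeat.

(** * Decay of the heat semigroup on single blocks *)

Section Heat.
Variable R : realType.
Variables chi rho : R -> R -> R.
Hypothesis H : dyadic_partition chi rho.
Variables mu : R.
Hypothesis mu_gt0 : 0 < mu.

Lemma cmod_heat t k : 0 <= t -> cmod (heat_mult mu t k) <= 1.
Proof.
move=> t0; rewrite /heat_mult cmodM cmodR ger0_norm ?expR_ge0//.
rewrite [X in _ * X]/cmod /= cos2Dsin2 sqrtr1 mulr1 -expR0 ler_expR mulNr oppr_le0.
apply: mulr_ge0 => //; apply: addr_ge0 => //; apply: mulr_ge0.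
  by rewrite !mulr_ge0 ?exprn_ge0 ?pi_ge0 ?(ltW mu_gt0).
by rewrite addr_ge0 ?sqr_ge0.
Qed.

(** Block [m.+1] is [cutheat_mult] at [tau = t * 4 ^ m] times [expR (- t)]. The lowest block meets
    the origin, where nothing decays, so it is bounded by summing coefficients. *)
Lemma linf_heat : exists2 C : R, 0 <= C & forall n t f F, 0 <= t <= 1 ->
  linf f F -> linf (blk chi rho n (semigroup mu t f)) (C / (1 + t * 4 ^+ n) * F).
Proof.
have p0 : 0 < 4 * pi ^+ 2 * mu :> R by rewrite !mulr_gt0 ?exprn_gt0 ?pi_gt0.
have [C C0 hC] := linf_cutheat H (- 4 * pi ^+ 2) p0.
(* [4] accounts for [1 + t * 4 ^ m.+1 <= 4 * (1 + t * 4 ^ m)]. The lowest block has [25] frequencies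
   in its box, doubled because [1 + t <= 2]. *)
exists (4 * C + 50) => [|n t f F /andP[t0 t1] lf]; first by rewrite addr_ge0 ?mulr_ge0.
have F0 := linf_ge0 lf.
case: n => [|m].
  rewrite expr0 mulr1.
  have := linf_sum_coef (@blk_suppin _ _ _ H 0 (semigroup mu t f)).
  apply: linf_le; apply: (@le_trans _ _ (\sum_(k <- zbox (2 ^ 1)) F)).
    apply: ler_sum => k _; rewrite /blk /semigroup cmodM cmodR (cmodM (heat_mult mu t k)).
    have /andP[w0 w1] := wt_bound H 0 k.
    rewrite ger0_norm// -[leRHS]mul1r; apply: ler_pM => //.
      by rewrite mulr_ge0 ?cmod_ge0.
    rewrite -[leRHS]mul1r; apply: ler_pM; [exact: cmod_ge0..|exact: cmod_heat|].
    exact: linf_coef.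
  rewrite big_const_seq count_predT iter_addr_0 -[leLHS]mulr_natl ler_wpM2r//.
  rewrite size_allpairs /zr size_map size_iota /= ler_pdivlMr; lra.
have t4 : 0 <= t * 4 ^+ m by rewrite mulr_ge0 ?exprn_ge0.
have l1 := linfZ (expR (- t))%:C (hC m (t * 4 ^+ m) f F t4 lf).
have : linf (blk chi rho m.+1 (semigroup mu t f))
    (cmod (expR (- t))%:C * (C / (1 + t * 4 ^+ m) * F)).
  apply: linf_eq l1 => k; rewrite mulrA /blk /semigroup mulrA; congr (_ * _).
  rewrite /cutheat_mult /cutheat /heat_mult !expr0 !mul1r /=.
  set x := k.1%:~R; set y := k.2%:~R.
  have e : t * 4 ^+ m * ((x / 2 ^+ m) ^+ 2 + (y / 2 ^+ m) ^+ 2) = t * (x ^+ 2 + y ^+ 2).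
    rewrite (_ : 4 = 2 ^+ 2 :> R); last by ring.
    by rewrite -exprM mulnC exprM; field; rewrite expf_neq0.
  have e1 p : - (p * (t * 4 ^+ m)) * ((x / 2 ^+ m) ^+ 2 + (y / 2 ^+ m) ^+ 2) =
    - (p * (t * (x ^+ 2 + y ^+ 2))) by rewrite mulNr -mulrA e.
  have e2 p : p * (t * 4 ^+ m) * ((x / 2 ^+ m) ^+ 2 + (y / 2 ^+ m) ^+ 2) =
    p * (t * (x ^+ 2 + y ^+ 2)) by rewrite -mulrA e.
  rewrite e1 e2.
  have -> : expR (- t * (4 * pi ^+ 2 * mu * (x ^+ 2 + y ^+ 2) + 1)) =
     expR (- t) * expR (- (4 * pi ^+ 2 * mu * (t * (x ^+ 2 + y ^+ 2)))).
    by rewrite -expRD; congr expR; ring.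
  by apply: complex_eqP => /=; rewrite -!mulrA; ring.
apply: linf_le; rewrite cmodR ger0_norm ?expR_ge0//.
rewrite mulrA ler_wpM2r//.
apply: (@le_trans _ _ (C / (1 + t * 4 ^+ m))).
  rewrite -[leRHS]mul1r ler_wpM2r ?divr_ge0//; first by lra.
  by rewrite -expR0 ler_expR oppr_le0.
rewrite ler_pdivrMr; last by lra.
rewrite mulrAC ler_pdivlMr; last by rewrite exprS; lra.
rewrite exprS; have : 0 <= C * (t * 4 ^+ m) by rewrite mulr_ge0.
have : 0 <= t * 4 ^+ m by [].
by lra.
Qed.

End Heat.

(** * Products of distributions *)

Section ComplexSequences.
Variable R : realType.
Implicit Types (u v : nat -> R[i]) (l m z : R[i]).

Definition ccvg u l :=
  (complex.Re (u n) @[n --> \oo] --> complex.Re l) /\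
  (complex.Im (u n) @[n --> \oo] --> complex.Im l).

Lemma ccvg_clim u l : ccvg u l -> clim u = l.
Proof. by case=> h1 h2; apply: complex_eqP; rewrite /clim /=; exact: cvg_lim. Qed.

Lemma ccvg_cst l : ccvg (fun=> l) l.
Proof. by split; exact: cvg_cst. Qed.

Lemma ccvgD u v l m : ccvg u l -> ccvg v m -> ccvg (fun n => u n + v n) (l + m).
Proof.
move=> [h1 h2] [h3 h4]; split; rewrite ?complexReD ?complexImD.
  by under eq_fun do rewrite complexReD; exact: cvgD.
by under eq_fun do rewrite complexImD; exact: cvgD.
Qed.

Lemma ccvgZ c u l : ccvg u l -> ccvg (fun n => c * u n) (c * l).
Proof.
move=> [h1 h2]; split.
  rewrite complexReM (_ : (fun n => _) = fun n =>
    complex.Re c * complex.Re (u n) - complex.Im c * complex.Im (u n)).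
    by apply: cvgB; apply: cvgM => //; exact: cvg_cst.
  by apply/funext => n; rewrite complexReM.
rewrite complexImM (_ : (fun n => _) = fun n =>
  complex.Re c * complex.Im (u n) + complex.Im c * complex.Re (u n)).
  by apply: cvgD; apply: cvgM => //; exact: cvg_cst.
by apply/funext => n; rewrite complexImM.
Qed.

Lemma ccvg_sum (I : Type) (r : seq I) (u : I -> nat -> R[i]) (l : I -> R[i]) :
  (forall i, ccvg (u i) (l i)) ->
  ccvg (fun n => \sum_(i <- r) u i n) (\sum_(i <- r) l i).
Proof.
move=> h; elim: r => [|i r ih].
  rewrite big_nil; under eq_fun do rewrite big_nil; exact: ccvg_cst.
rewrite big_cons; under eq_fun do rewrite big_cons; exact: ccvgD.
Qed.

Lemma ccvg_eps u l : ccvg u l -> forall e : R, 0 < e ->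
  exists N, forall n, (N <= n)%N -> cmod (l - u n) <= e.
Proof.
move=> [h1 h2] e e0; have e20 : 0 < e / 2 by lra.
have [N1 _ H1] := cvgr_dist_le _ _ h1 _ e20.
have [N2 _ H2] := cvgr_dist_le _ _ h2 _ e20.
exists (maxn N1 N2) => n hn.
have {}H1 := H1 n (leq_trans (leq_maxl _ _) hn).
have {}H2 := H2 n (leq_trans (leq_maxr _ _) hn).
apply: le_trans (cmod_ReIm _) _.
rewrite complexReD complexImD; move: H1 H2; case: (l) => ? ?; case: (u n) => ? ? /=.
by lra.
Qed.

Lemma ccvg_le u l (C : R) : ccvg u l -> (forall n, cmod (u n) <= C) -> cmod l <= C.
Proof.
move=> h hC; apply/ler_addgt0Pr => e e0.
have [N hN] := ccvg_eps h e0; have := hN N (leqnn N).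
have := cmodD (l - u N) (u N); rewrite subrK.
by have := hC N; lra.
Qed.

Lemma cvg_geometric_increments (u : R^nat) (C r : R) N0 : 0 <= r < 1 ->
  (forall n, (N0 <= n)%N -> `|u n.+1 - u n| <= C * r ^+ n) -> cvgn u.
Proof.
move=> /andP[r0 r1] h.
pose w : R^nat := fun n => u (n + N0)%N.
suff /cvg_ex[l hl] : cvgn w by apply/cvg_ex; exists l; rewrite -(cvg_shiftn N0).
have -> : w = (fun n => w 0%N + series (telescope w) n).
  apply/funext => n; rewrite /series /= telescope_sumr//; ring.
apply: is_cvgD; first exact: is_cvg_cst.
apply: normed_cvg.
apply: (@series_le_cvg _ _ (geometric (C * r ^+ N0) r)).
- by move=> n; exact: normr_ge0.
- move=> n; rewrite /geometric /= -mulrA -exprD.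
  by apply: le_trans (normr_ge0 _) (h _ (leq_addr n N0)).
- move=> n; rewrite /telescope /w /geometric /= -mulrA -exprD [(N0 + n)%N]addnC.
  exact: (h (n + N0)%N (leq_addl _ _)).
- by apply: is_cvg_geometric_series; rewrite ger0_norm.
Qed.

Lemma ccvg_geometric_increments u (C r : R) N0 : 0 <= r < 1 ->
  (forall n, (N0 <= n)%N -> cmod (u n.+1 - u n) <= C * r ^+ n) ->
  ccvg u (clim u).
Proof.
move=> hr h; split; rewrite /clim /=.
  apply: (@cvg_geometric_increments _ C r N0 hr) => n hn; apply: le_trans (h n hn).
  by apply: le_trans (Re_le_cmod _); rewrite complexReD; case: (u n).
apply: (@cvg_geometric_increments _ C r N0 hr) => n hn; apply: le_trans (h n hn).
by apply: le_trans (Im_le_cmod _); rewrite complexImD; case: (u n).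
Qed.

(** With a common box, evaluation at a point is a fixed finite combination of coefficients, so
    coefficientwise limits keep the sup bound. *)
Lemma linf_ccvg N (u : nat -> distr R) (v : distr R) C :
  (forall n, suppin N (u n)) -> suppin N v -> (forall n, linf (u n) C) ->
  (forall k, ccvg (u ^~ k) (v k)) -> linf v C.
Proof.
move=> hu hv lu h; exists N => // x y.
apply: (@ccvg_le (fun n => ev N (u n) x y)); last by move=> n; exact: linf_ev.
rewrite /ev; apply: ccvg_sum => k.
by under eq_fun do rewrite mulrC; rewrite mulrC; exact: ccvgZ.
Qed.

End ComplexSequences.

Section GeometricSums.
Variable R : realType.

Lemma geo_below (x : R) m N : 1 < x ->
  \sum_(i < N) (if (i < m)%N then x ^+ i else 0) <= x ^+ m / (x - 1).
Proof.
move=> x1; have x10 : 0 < x - 1 by lra.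
(* The sharper bound with [minn N m] is the one that induction on [N] preserves. *)
apply: (@le_trans _ _ (x ^+ (minn N m) / (x - 1))); last first.
  by rewrite ler_wpM2r ?invr_ge0 ?(ltW x10)// ler_weXn2l ?(ltW x1)// geq_minr.
elim: N => [|N ih]; first by rewrite big_ord0 divr_ge0 ?exprn_ge0//; lra.
rewrite big_ord_recr /=; case: ltnP => Nm.
  rewrite (minn_idPl Nm); move: ih; rewrite (minn_idPl (ltnW Nm)) => ih.
  apply: (le_trans (lerD ih (lexx _))).
  rewrite le_eqVlt; apply/orP; left; apply/eqP.
  by rewrite exprS; field; rewrite gt_eqF.
by rewrite addr0 (minn_idPr (leqW Nm)); move: ih; rewrite (minn_idPr Nm).
Qed.

Lemma geo_above (q : R) m N : 0 < q < 1 ->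
  \sum_(i < N) (if (m <= i)%N then q ^+ i else 0) <= q ^+ m / (1 - q).
Proof.
move=> /andP[q0 q1]; have q10 : 0 < 1 - q by lra.
(* Keeping the subtracted end term makes each induction step an identity. *)
apply: (@le_trans _ _ ((q ^+ m - q ^+ (maxn N m)) / (1 - q))); last first.
  by rewrite ler_wpM2r ?invr_ge0 ?(ltW q10)// gerBl exprn_ge0// ltW.
elim: N => [|N ih].
  by rewrite big_ord0 max0n subrr mul0r.
rewrite big_ord_recr /=; case: leqP => Nm.
  rewrite (maxn_idPl (leqW Nm)); move: ih; rewrite (maxn_idPl Nm) => ih.
  apply: (le_trans (lerD ih (lexx _))).
  rewrite le_eqVlt; apply/orP; left; apply/eqP.
  by rewrite exprS; field; rewrite gt_eqF.
by rewrite addr0 (maxn_idPr Nm); move: ih; rewrite (maxn_idPr (ltnW Nm)).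
Qed.

Lemma geo_all (q : R) N : 0 < q < 1 -> \sum_(i < N) q ^+ i <= (1 - q)^-1.
Proof. by move=> hq; have := geo_above 0 N hq; rewrite expr0 mul1r. Qed.

End GeometricSums.

Lemma eqr_le (R : realType) (x y : R) : x = y -> x <= y.
Proof. by move=> ->. Qed.

Section Products.
Variable R : realType.
Implicit Types (f g u v : distr R) (k : int * int) (n N : nat) (s B C : R).
Variables chi rho : R -> R -> R.
Hypothesis H : dyadic_partition chi rho.

Local Notation wt := (lp_weight chi rho).
Local Notation blk := (blk chi rho).
Local Notation bb := (bb chi rho).

(** The block projection is the heat estimate at time [0]; the viscosity [1] is an arbitrary
    positive value. *)
Lemma linf_blk : exists2 C : R, 0 <= C & forall n f F,
  linf f F -> linf (blk n f) (C * F).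
Proof.
have [C C0 h] := linf_heat H (@ltr01 R).
exists C => // n f F lf; have := h n 0 f F _ lf.
rewrite lexx ler01 mul0r addr0 divr1 => /(_ isT); apply: linf_eq => k.
rewrite /blk /semigroup /heat_mult /=; congr (_ * _).
rewrite oppr0 mul0r expR0 mulr0 mul0r cos0 sin0.
by case: (f k) => ? ?; apply: complex_eqP => /=; ring.
Qed.

Definition pblk f g i j := fconv (2 ^ i.+1) (blk i f) (blk j g).

Definition dmul_trunc f g N k := \sum_(i < N) \sum_(j < N) pblk f g i j k.

Lemma lp_partialE N f k : lp_partial chi rho N f k = \sum_(i < N) blk i f k.
Proof. by rewrite /lp_partial rmorph_sum mulr_suml. Qed.

(** The box of radius [2 ^ N.+1] contains all blocks below [N], so the finite sum in [dmul] is the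
    full convolution of the regularisations and splits into pairs of blocks. *)
Lemma dmulE f g k : dmul chi rho f g k = clim (fun N => dmul_trunc f g N k).
Proof.
congr clim; apply/funext => N; etransitivity.
  exact: (sum_box_pt (2 ^ N.+1) (fun a => lp_partial chi rho N f a *
    lp_partial chi rho N g (k.1 - a.1, k.2 - a.2))).
under eq_bigr do rewrite !lp_partialE mulr_suml.
rewrite exchange_big /= /dmul_trunc; apply: eq_bigr => i _.
under eq_bigr do rewrite mulr_sumr.
rewrite exchange_big /=; apply: eq_bigr => j _.
rewrite /pblk /fconv; apply: sum_supp; rewrite ?uniq_zbox// => a h.
  have : a \in zbox (2 ^ i.+1).
    by apply: (blk_suppin H (u := f)); apply: contraNneq h => ->; rewrite mul0r.
  have : (2 ^ i.+1 <= 2 ^ N.+1)%N by rewrite leq_exp2l//; have := ltn_ord i; lia.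
  by rewrite !mem_zbox => ? /andP[? ?]; apply/andP; split; lia.
by apply: (blk_suppin H (u := f)); apply: contraNneq h => ->; rewrite mul0r.
Qed.

Lemma pblk_supp f g i j k : pblk f g i j k != 0 ->
  exists a, [/\ wt i a != 0 & wt j (k.1 - a.1, k.2 - a.2) != 0].
Proof.
move=> h; apply/not_existsP => hn; move/eqP: h; apply.
rewrite /pblk /fconv big1// => a _; rewrite /blk.
have [->|ha] := eqVneq (wt i a) 0; first by rewrite !mul0r.
have [->|hb] := eqVneq (wt j (k.1 - a.1, k.2 - a.2)) 0; first by rewrite mul0r mulr0.
by have := hn a; rewrite ha hb; case.
Qed.

Lemma pow2_absurd n i j : (i.+4 < n)%N -> (j.+4 < n)%N ->
  (4 * (2 ^ i.+1 + 2 ^ j.+1) < 2 ^ n)%N.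
Proof.
move=> hi hj.
have h m : (m.+4 < n)%N -> (16 * 2 ^ m.+1 <= 2 ^ n)%N.
  by move=> hm; rewrite -[16%N]/(2 ^ 4)%N -expnD leq_exp2l//; lia.
by have := h _ hi; have := h _ hj; have : (0 < 2 ^ n)%N; rewrite ?expn_gt0//; lia.
Qed.

(** A contributing frequency of block [i] is the difference of the output [k] and a frequency of
    block [j]; two small frequencies cannot differ by a large one. *)
Lemma pblk_rough0 f g i j n k : k \in zbox (2 ^ n.+1) ->
  (n.+4 < i)%N -> (j.+4 < i)%N -> pblk f g i j k = 0.
Proof.
move=> kn ni ji; apply/eqP/negbNE/negP => /pblk_supp [a [ha /(wt_supp H) hb]].
have : a \in zbox (2 ^ n.+1 + 2 ^ j.+1).
  by move: kn hb; rewrite !mem_zbox /= => /andP[? ?] /andP[? ?]; apply/andP; split; lia.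
move/(wt_zbox H ha) => /(_ ltac:(lia)).
by rewrite leqNgt pow2_absurd.
Qed.

(** Frequencies add, so two low blocks cannot reach an output block five or more levels higher. *)
Lemma pblk_smooth0 f g i j n k : wt n k != 0 ->
  (i.+4 < n)%N -> (j.+4 < n)%N -> pblk f g i j k = 0.
Proof.
move=> hk ni nj; apply/eqP/negbNE/negP => /pblk_supp [a [/(wt_supp H) ha /(wt_supp H) hb]].
have : k \in zbox (2 ^ i.+1 + 2 ^ j.+1).
  by move: ha hb; rewrite !mem_zbox /= => /andP[? ?] /andP[? ?]; apply/andP; split; lia.
move/(wt_zbox H hk) => /(_ ltac:(lia)).
by rewrite leqNgt pow2_absurd.
Qed.

Lemma linf_pblk s r f g F G i j : bb s f F -> bb r g G ->
  linf (pblk f g i j) (F * G * (dy s i * dy r j)).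
Proof.
move=> hf hg; have := linf_fconv (@blk_suppin _ _ _ H i f) (hf i) (hg j).
by apply: linf_le; rewrite mulrACA.
Qed.

(* The one-sided frequency localisation [pblk_rough0] suffices: low output
   frequencies cannot come from a high rough block times a low smooth block. *)
Lemma rough_sum (x q : R) : 1 < x -> 0 < q -> x * q < 1 ->
  exists2 C : R, 0 <= C & forall n N,
   \sum_(i < N) \sum_(j < N)
     (if ((n.+4 < i) && (j.+4 < i))%N then 0 else x ^+ i * q ^+ j) <= C * x ^+ n.
Proof.
move=> x1 q0 xq; have x0 : 0 < x by lra.
have q1 : q < 1 by rewrite -(ltr_pM2l x0) mulr1; lra.
have xq0 : 0 < x * q by rewrite mulr_gt0.
have hq : 0 < q < 1 by apply/andP.
have hxq : 0 < x * q < 1 by apply/andP.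
have [x1' q1' xq1'] : [/\ 0 <= (x - 1)^-1, 0 <= (1 - q)^-1 & 0 <= (1 - x * q)^-1].
  by split; rewrite invr_ge0; lra.
exists (x ^+ 5 / (x - 1) * (1 - q)^-1 + x ^+ 5 / (x - 1) * (1 - x * q)^-1).
  by rewrite addr_ge0 ?mulr_ge0 ?exprn_ge0 ?(ltW x0).
move=> n N.
(* A surviving pair has [i < n + 5] or [i < j + 5]. The first family sums to a multiple of [x ^ n];
   in the second, summing over [i] leaves [(x * q) ^ j], which is where [x * q < 1] is needed. *)
apply: (@le_trans _ _ (\sum_(i < N) \sum_(j < N)
   ((if (i < n + 5)%N then x ^+ i else 0) * q ^+ j +
    q ^+ j * (if (i < j + 5)%N then x ^+ i else 0)))).
  apply: ler_sum => i _; apply: ler_sum => j _.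
  have X : 0 <= x ^+ i by rewrite exprn_ge0// ltW.
  have Q : 0 <= q ^+ j by rewrite exprn_ge0// ltW.
  have XQ := mulr_ge0 X Q.
  have [h1|h1] := ltnP i (n + 5); have [h2|h2] := ltnP i (j + 5); rewrite ?mul0r ?mulr0 ?add0r ?addr0.
  - by case: ifP => _; rewrite 1?[q ^+ j * _]mulrC; lra.
  - by case: ifP => _ //; lra.
  - by case: ifP => _; rewrite 1?[q ^+ j * _]mulrC//; lra.
  - have -> : (n.+4 < i)%N by move: h1; rewrite addnC.
    by have -> : (j.+4 < i)%N by move: h2; rewrite addnC.
under eq_bigr do rewrite big_split /=.
rewrite big_split /= mulrDl; apply: lerD.
  under eq_bigr do rewrite -mulr_sumr.
  rewrite -mulr_suml [leRHS]mulrAC; apply: ler_pM.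
  - by apply: sumr_ge0 => i _; case: ifP; rewrite ?exprn_ge0 ?(ltW x0).
  - by apply: sumr_ge0 => i _; rewrite exprn_ge0 ?(ltW q0).
  - by apply: le_trans (geo_below _ _ x1) (eqr_le _); rewrite exprD; ring.
  - exact: geo_all.
rewrite exchange_big /=; under eq_bigr do rewrite -mulr_sumr.
apply: (@le_trans _ _ (\sum_(j < N) (x ^+ 5 / (x - 1)) * (x * q) ^+ j)).
  apply: ler_sum => j _; rewrite exprMn mulrA [leRHS]mulrC ler_wpM2l ?exprn_ge0 ?(ltW q0)//.
  by apply: le_trans (geo_below _ _ x1) (eqr_le _); rewrite exprD; ring.
rewrite -mulr_sumr; apply: (@le_trans _ _ (x ^+ 5 / (x - 1) * (1 - x * q)^-1)).
  by rewrite ler_wpM2l ?mulr_ge0 ?exprn_ge0 ?(ltW x0)// geo_all.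
by rewrite ler_peMr ?exprn_ege1 ?(ltW x1)// !mulr_ge0 ?exprn_ge0 ?(ltW x0).
Qed.

(** A surviving pair has an index at least [n - 4]; its geometric tail gives [q ^ n], and the other
    index is summed freely. *)
Lemma smooth_sum (q : R) : 0 < q < 1 ->
  exists2 C : R, 0 <= C & forall n N,
   \sum_(i < N) \sum_(j < N)
     (if ((i.+4 < n) && (j.+4 < n))%N then 0 else q ^+ i * q ^+ j) <= C * q ^+ n.
Proof.
move=> hq; have /andP[q0 q1] := hq.
have q1' : 0 <= (1 - q)^-1 by rewrite invr_ge0; lra.
have Q m : 0 <= q ^+ m by rewrite exprn_ge0// ltW.
exists (2 * (q^-1 ^+ 4 / (1 - q) / (1 - q))).
  by rewrite mulr_ge0// mulr_ge0// mulr_ge0// exprn_ge0// invr_ge0 ltW.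
move=> n N.
have tail : \sum_(i < N) (if (n - 4 <= i)%N then q ^+ i else 0) <= q^-1 ^+ 4 / (1 - q) * q ^+ n.
  apply: le_trans (geo_above _ _ hq) _; rewrite mulrAC ler_wpM2r//.
  have [h|h] := leqP 4 n.
    by rewrite -{2}(subnK h) exprD mulrCA -exprMn mulVf ?gt_eqF// expr1n mulr1.
  rewrite (_ : (n - 4)%N = 0%N) ?expr0; last by lia.
  rewrite exprVn mulrC ler_pdivlMr ?exprn_gt0// mul1r.
  by rewrite ler_wiXn2l ?(ltW q0) ?(ltW q1)//; lia.
apply: (@le_trans _ _ (\sum_(i < N) \sum_(j < N)
   ((if (n - 4 <= i)%N then q ^+ i else 0) * q ^+ j +
    q ^+ i * (if (n - 4 <= j)%N then q ^+ j else 0)))).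
  apply: ler_sum => i _; apply: ler_sum => j _.
  have QQ := mulr_ge0 (Q i) (Q j).
  have [h1|h1] := leqP (n - 4)%N i; have [h2|h2] := leqP (n - 4)%N j; rewrite ?mul0r ?mulr0 ?add0r ?addr0.
  - by case: ifP => _; lra.
  - by case: ifP.
  - by case: ifP.
  - have -> : (i.+4 < n)%N by move: h1; rewrite ltn_subRL.
    by have -> : (j.+4 < n)%N by move: h2; rewrite ltn_subRL.
under eq_bigr do rewrite big_split /= -!mulr_sumr.
rewrite big_split /= -!mulr_suml.
have all := geo_all N hq.
have S0 : 0 <= \sum_(i < N) q ^+ i by apply: sumr_ge0.
have T0 : 0 <= \sum_(i < N) (if (n - 4 <= i)%N then q ^+ i else 0).
  by apply: sumr_ge0 => i _; case: ifP.
set T := \sum_(i < N) (if _ then _ else _) in tail T0 *.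
have := ler_pM T0 S0 tail all; rewrite [(\sum_(i < N) q ^+ i) * T]mulrC.
rewrite (_ : 2 * _ * _ = 2 * (q^-1 ^+ 4 / (1 - q) * q ^+ n / (1 - q))); last by ring.
by lra.
Qed.

Lemma dy_neg_gt1 (a : R) : 0 < a -> 1 < dy (- a) 1.
Proof.
move=> a0; rewrite /dy mulr1 opprK.
have e : 1 `^ a = 1 :> R by rewrite powR1.
by rewrite -[ltLHS]e; apply: gt0_ltr_powR => //; rewrite ?nnegrE//; lra.
Qed.

Lemma dy_lt1 (b : R) : 0 < b -> 0 < dy b 1 < 1.
Proof.
move=> b0; rewrite dy_gt0 /=; have := dy_neg_gt1 b0.
by rewrite /dy !mulr1 opprK powRN => h; rewrite invf_lt1// (lt_trans _ h).
Qed.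

Lemma dyD (s r : R) n : dy s n * dy r n = dy (s + r) n.
Proof. by rewrite /dy -powRD ?pnatr_eq0 ?implybT// mulrDl opprD. Qed.

(** Passing from [N] to [N.+1] adds a row and a column of block pairs. In the row the rough block is
    [N], and for [N] large compared with [k] only smooth blocks [j >= N - 4] contribute; in the
    column the smooth block is [N] and the rough ones sum to [O(x ^ N)]. Both increments are
    [O((x * q) ^ N)] with [x * q = 2^-(b - a) < 1]. *)
Lemma dmul_trunc_cvg (a b : R) f g F G k : 0 < a < b ->
  bb (- a) f F -> bb b g G -> ccvg (fun N => dmul_trunc f g N k) (dmul chi rho f g k).
Proof.
move=> /andP[a0 ab] hf hg; rewrite dmulE.
have F0 := bb_ge0 hf; have G0 := bb_ge0 hg.
set x := dy (- a) 1; set q := dy b 1.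
have x1 : 1 < x := dy_neg_gt1 a0; have x0 : 0 < x by lra.
have hq : 0 < q < 1 by apply: dy_lt1; lra.
have /andP[q0 q1] := hq.
have xqE : x * q = dy (b - a) 1 by rewrite /x /q dyD addrC.
have /andP[xq0 xq1] : 0 < x * q < 1 by rewrite xqE; apply: dy_lt1; lra.
have P i j : cmod (pblk f g i j k) <= F * G * (x ^+ i * q ^+ j).
  by rewrite -!dy_exp; apply: linf_coef; exact: linf_pblk.
have FG := mulr_ge0 F0 G0.
(* The starting index is the first [N] with [(kexp k).+4 < N], as [pblk_rough0] requires at level
   [kexp k]. *)
apply: (@ccvg_geometric_increments _ _
  (F * G * (q^-1 ^+ 4 / (1 - q) + x / (x - 1))) (x * q) (kexp k).+4.+1).
  by rewrite xq1 ltW.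
have hk : k \in zbox (2 ^ (kexp k).+1).
  have := kexpP k; rewrite !mem_zbox expnS mul2n -addnn => /andP[h1 h2].
  by rewrite !(leq_trans _ (leq_addr _ _)).
move=> N hN.
have -> : dmul_trunc f g N.+1 k - dmul_trunc f g N k =
   \sum_(j < N.+1) pblk f g N j k + \sum_(i < N) pblk f g i N k.
  rewrite /dmul_trunc big_ord_recr /=.
  under eq_bigr do rewrite big_ord_recr /=.
  by rewrite big_split /=; ring.
apply: le_trans (cmodD _ _) _; rewrite mulrDr mulrDl; apply: lerD.
  apply: le_trans (cmod_sum _ _ _) _.
  apply: (@le_trans _ _ (\sum_(j < N.+1) F * G * x ^+ N *
      (if (N - 4 <= j)%N then q ^+ j else 0))).
    apply: ler_sum => j _; case: leqP => h; first by rewrite -mulrA.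
    have h' : (j.+4 < N)%N by move: h; rewrite ltn_subRL.
    by rewrite (pblk_rough0 f g hk hN h') cmod0 mulr0.
  rewrite -mulr_sumr; apply: (@le_trans _ _ (F * G * x ^+ N * (q ^+ (N - 4) / (1 - q)))).
    rewrite ler_wpM2l ?mulr_ge0 ?exprn_ge0 ?(ltW x0)//; exact: geo_above.
  have h4 : (4 <= N)%N by apply: leq_trans hN.
  have e : q ^+ N = q ^+ (N - 4) * q ^+ 4 by rewrite -exprD subnK.
  apply: eqr_le; rewrite exprMn e exprVn.
  by field; rewrite !gt_eqF//; lra.
apply: le_trans (cmod_sum _ _ _) _.
apply: (@le_trans _ _ (\sum_(i < N) F * G * q ^+ N *
      (if (i < N.+1)%N then x ^+ i else 0))).
  apply: ler_sum => i _; rewrite ifT; last by rewrite ltnS ltnW.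
  by apply: le_trans (P _ _) (eqr_le _); ring.
rewrite -mulr_sumr; apply: (@le_trans _ _ (F * G * q ^+ N * (x ^+ N.+1 / (x - 1)))).
  rewrite ler_wpM2l ?mulr_ge0 ?exprn_ge0 ?(ltW q0)//; exact: geo_below.
by apply: eqr_le; rewrite exprMn exprS; ring.
Qed.

Lemma bb_dmul_limit (a b s : R) f g F G (B : R) : 0 < a < b ->
  bb (- a) f F -> bb b g G ->
  (forall n N, linf (blk n (dmul_trunc f g N)) (B * dy s n)) ->
  bb s (dmul chi rho f g) B.
Proof.
move=> hab hf hg h n.
apply: (@linf_ccvg _ (2 ^ n.+1) (fun N => blk n (dmul_trunc f g N))).
- by move=> N; exact: blk_suppin.
- exact: blk_suppin.
- by move=> N; exact: h.
- by move=> k; apply: ccvgZ; exact: dmul_trunc_cvg hf hg.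
Qed.

Lemma blk_dmul_trunc n f g N k :
  blk n (dmul_trunc f g N) k = \sum_(i < N) \sum_(j < N) blk n (pblk f g i j) k.
Proof.
rewrite /blk /dmul_trunc mulr_sumr; apply: eq_bigr => i _.
by rewrite mulr_sumr.
Qed.

Lemma bb_dmul_rough (a b : R) : 0 < a < b -> exists2 C : R, 0 <= C &
  forall f g F G, bb (- a) f F -> bb b g G ->
    bb (- a) (dmul chi rho f g) (C * F * G).
Proof.
move=> hab; have /andP[a0 ab] := hab.
have [Cw Cw0 hw] := linf_blk.
have /andP[q0 q1] : 0 < dy b 1 < (1 : R) by apply: dy_lt1; lra.
have xq : dy (- a) 1 * dy b 1 < (1 : R).
  by rewrite dyD addrC; have /andP[] : 0 < dy (b - a) 1 < (1 : R) by apply: dy_lt1; lra.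
have [C C0 hC] := rough_sum (dy_neg_gt1 a0) q0 xq.
exists (Cw * C); first exact: mulr_ge0.
move=> f g F G hf hg; apply: (bb_dmul_limit hab hf hg) => n N.
have F0 := bb_ge0 hf; have G0 := bb_ge0 hg.
have : linf (blk n (dmul_trunc f g N)) (\sum_(i < N) \sum_(j < N) (Cw * (F * G) *
    (if ((n.+4 < i) && (j.+4 < i))%N then 0 else dy (- a) 1 ^+ i * dy b 1 ^+ j))).
  apply: (@linf_eq _ (fun k => \sum_(i < N) \sum_(j < N) blk n (pblk f g i j) k)).
    by move=> k; rewrite blk_dmul_trunc.
  apply: (@linf_sum _ _ _ xpredT (fun i : 'I_N => fun k => \sum_(j < N) blk n (pblk f g i j) k)) => i _.
  apply: (@linf_sum _ _ _ xpredT (fun j : 'I_N => blk n (pblk f g i j))) => j _.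
  case: ifP => [/andP[h1 h2]|_].
    rewrite mulr0; apply: linf_eq (@linf0 R) => k; rewrite /blk.
    have [->|/(wt_supp H) hk] := eqVneq (wt n k) 0; first by rewrite mul0r.
    by rewrite (pblk_rough0 _ _ hk)// mulr0.
  by rewrite -!dy_exp -[Cw * _ * _]mulrA; apply: hw; exact: linf_pblk.
apply: linf_le; under eq_bigr do rewrite -mulr_sumr; rewrite -mulr_sumr.
apply: (@le_trans _ _ (Cw * (F * G) * (C * dy (- a) 1 ^+ n))).
  by rewrite ler_wpM2l ?mulr_ge0.
by apply: eqr_le; rewrite -dy_exp; ring.
Qed.

Lemma bb_dmul_smooth (b : R) : 0 < b -> exists2 C : R, 0 <= C &
  forall f g F G, bb b f F -> bb b g G -> bb b (dmul chi rho f g) (C * F * G).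
Proof.
(* Viewing one factor as an element of [C^(- b / 2)] supplies convergence of the truncations; the
   bound itself does not use this exponent. *)
move=> b0; have hab : 0 < b / 2 < b by lra.
have [Cw Cw0 hw] := linf_blk.
have hq : 0 < dy b 1 < (1 : R) by exact: dy_lt1.
have [C C0 hC] := smooth_sum hq.
exists (Cw * C); first exact: mulr_ge0.
move=> f g F G hf hg.
have hf' : bb (- (b / 2)) f F by apply: bb_weaken hf => //; lra.
apply: (bb_dmul_limit hab hf' hg) => n N.
have F0 := bb_ge0 hf; have G0 := bb_ge0 hg.
have : linf (blk n (dmul_trunc f g N)) (\sum_(i < N) \sum_(j < N) (Cw * (F * G) *
    (if ((i.+4 < n) && (j.+4 < n))%N then 0 else dy b 1 ^+ i * dy b 1 ^+ j))).
  apply: (@linf_eq _ (fun k => \sum_(i < N) \sum_(j < N) blk n (pblk f g i j) k)).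
    by move=> k; rewrite blk_dmul_trunc.
  apply: (@linf_sum _ _ _ xpredT (fun i : 'I_N => fun k => \sum_(j < N) blk n (pblk f g i j) k)) => i _.
  apply: (@linf_sum _ _ _ xpredT (fun j : 'I_N => blk n (pblk f g i j))) => j _.
  case: ifP => [/andP[h1 h2]|_].
    rewrite mulr0; apply: linf_eq (@linf0 R) => k; rewrite /blk.
    have [->|hk] := eqVneq (wt n k) 0; first by rewrite mul0r.
    by rewrite (pblk_smooth0 _ _ hk)// mulr0.
  by rewrite -!dy_exp -[Cw * _ * _]mulrA; apply: hw; exact: linf_pblk.
apply: linf_le; under eq_bigr do rewrite -mulr_sumr; rewrite -mulr_sumr.
apply: (@le_trans _ _ (Cw * (F * G) * (C * dy b 1 ^+ n))).
  by rewrite ler_wpM2l ?mulr_ge0.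
by apply: eqr_le; rewrite -dy_exp; ring.
Qed.

End Products.

(** * Heat smoothing and the nonlinearity *)

Section HeatSmoothing.
Variable R : realType.
Implicit Types (f g u v : distr R) (k : int * int) (n N : nat) (s B C : R).
Variables chi rho : R -> R -> R.
Hypothesis H : dyadic_partition chi rho.

Local Notation wt := (lp_weight chi rho).
Local Notation blk := (blk chi rho).
Local Notation bb := (bb chi rho).
Local Notation dmul := (dmul chi rho).

Lemma wt_near n m k : wt n k != 0 -> wt m k != 0 -> (m <= n + 3)%N.
Proof.
move=> /(wt_supp H) hn hm; case: m hm => [|m] hm; first by [].
have := wt_zbox H hm hn isT.
by rewrite -[4%N]/(2 ^ 2)%N -expnD leq_exp2l// !addSn !add0n addnC.
Qed.

(** A fattened block: it coincides with [u] on the support of block [n], and being a bounded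
    trigonometric polynomial it can be fed to [linf_heat], which [u] cannot. *)
Definition nblk n u : distr R := fun k => \sum_(n - 3 <= m < n.+4) blk m u k.

Lemma blk_nblk n u k : wt n k != 0 -> nblk n u k = u k.
Proof.
move=> hk; rewrite -[RHS](blk_sum H u (wt_supp H hk) (leqnn _)).
rewrite -(big_mkord xpredT (fun m => blk m u k)) /nblk.
rewrite [RHS](@big_cat_nat _ _ _ (n - 3)%N)//=; last by lia.
rewrite [X in _ = X + _]big_nat [X in _ = X + _]big1 ?add0r// => m /andP[_ hm].
rewrite /blk; have [->|/wt_near /(_ hk) h] := eqVneq (wt m k) 0; first by rewrite mul0r.
by exfalso; lia.
Qed.

Lemma dy_near s m n : (m <= n + 3)%N -> (n <= m + 3)%N ->
  dy s m <= 2 `^ (3 * `|s|) * dy s n.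
Proof.
move=> h1 h2; rewrite /dy -powRD ?pnatr_eq0 ?implybT//.
rewrite ler_powR ?ler1n//.
have : `|m%:R - n%:R| <= 3 :> R.
  move: h1 h2; rewrite -!(ler_nat R) !natrD ler_norml => ? ?; apply/andP; split; lra.
move=> /(ler_wpM2l (normr_ge0 s)); rewrite -normrM => h.
have := ler_norm (- (s * (m%:R - n%:R))); rewrite normrN.
by lra.
Qed.

(** Interpolation: [x ^ th] is at most [1] or at most [x]. *)
Lemma invD1_powR (x th : R) : 0 < x -> 0 <= th <= 1 -> (1 + x)^-1 <= x `^ (- th).
Proof.
move=> x0 /andP[t0 t1]; rewrite powRN lef_pV2 ?posrE ?powR_gt0//; last by lra.
have [x1|x1] := leP x 1.
  have : x `^ th <= 1 by rewrite -(powRr0 x) ger_powR ?x0 ?x1.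
  by lra.
have : x `^ th <= x by rewrite ler1_powR// ltW.
by lra.
Qed.

(** The decay [1 / (1 + t * 4 ^ n)] is at most [t^-th * 4^-(n th)], and
    [4^-(n th) = 2^-(n (s' - s))] is the gain of derivatives. The factor [7] counts the blocks of
    [nblk]. *)
Lemma bb_heat (mu s s' : R) : 0 < mu -> 0 <= (s' - s) / 2 <= 1 ->
  exists2 C : R, 0 <= C & forall t u B, 0 < t <= 1 -> bb s u B ->
    bb s' (semigroup mu t u) (C * t `^ (- ((s' - s) / 2)) * B).
Proof.
move=> mu0 hth; set th := _ / 2 in hth *.
have [C C0 hC] := linf_heat H mu0.
exists (C * (7 * 2 `^ (3 * `|s|))) => [|t u B /andP[t0 t1] hu n].
  by rewrite !mulr_ge0 ?powR_ge0.
have B0 := bb_ge0 hu.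
have lf : linf (nblk n u) (7 * (B * (2 `^ (3 * `|s|) * dy s n))).
  have : linf (nblk n u) (\sum_(n - 3 <= m < n.+4) B * (2 `^ (3 * `|s|) * dy s n)).
    rewrite big_nat; apply: (@linf_eq _ (fun k =>
        \sum_(n - 3 <= m < n.+4 | (n - 3 <= m < n.+4)%N) blk m u k)).
      by move=> k; rewrite /nblk [RHS]big_nat.
    apply: (@linf_sum _ _ _ (fun m => (n - 3 <= m < n.+4)%N) (fun m => blk m u)
      (fun=> B * (2 `^ (3 * `|s|) * dy s n))) => m /andP[h1 h2].
    by apply: linf_le (hu m); rewrite ler_wpM2l// dy_near//; lia.
  apply: linf_le; rewrite sumr_const_nat -[leLHS]mulr_natl ler_wpM2r//.
    by rewrite !mulr_ge0 ?powR_ge0 ?dy_ge0.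
  by rewrite -[7]/(7%:R) ler_nat; lia.
have tt : 0 <= t <= 1 by rewrite (ltW t0).
have l1 := hC n t _ _ tt lf.
apply: (@linf_eq _ (blk n (semigroup mu t (nblk n u)))).
  move=> k; rewrite /blk /semigroup.
  by have [->|hk] := eqVneq (wt n k) 0; rewrite ?mul0r// blk_nblk.
apply: linf_le l1.
have x0 : 0 < t * 4 ^+ n by rewrite mulr_gt0 ?exprn_gt0.
have h := invD1_powR x0 hth.
apply: (@le_trans _ _ (C * (t * 4 ^+ n) `^ (- th) * (7 * (B * (2 `^ (3 * `|s|) * dy s n))))).
  by rewrite ler_wpM2r ?mulr_ge0 ?powR_ge0 ?dy_ge0// ler_wpM2l.
rewrite powRM ?(ltW t0) ?exprn_ge0//.
have -> : dy s' n = dy s n * (4 ^+ n) `^ (- th).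
  have -> : 4 ^+ n = 2 `^ (2 * n%:R) :> R.
    rewrite -[2 * n%:R]/(2%:R * n%:R) powRrM powR_mulrn// powR_mulrn ?exprn_ge0//.
    by congr (_ ^+ n); ring.
  rewrite -powRrM /dy -powRD ?pnatr_eq0 ?implybT//; congr (_ `^ _).
  by rewrite /th; field.
by apply: eqr_le; ring.
Qed.

Lemma dmul_trunc_subl f f' g N k :
  dmul_trunc chi rho (dsub f f') g N k = dmul_trunc chi rho f g N k - dmul_trunc chi rho f' g N k.
Proof.
rewrite /dmul_trunc -sumrB; apply: eq_bigr => i _; rewrite -sumrB.
apply: eq_bigr => j _; rewrite /pblk /fconv -sumrB; apply: eq_bigr => a _.
by rewrite /blk /dsub; ring.
Qed.

Lemma dmul_trunc_subr f g g' N k :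
  dmul_trunc chi rho f (dsub g g') N k = dmul_trunc chi rho f g N k - dmul_trunc chi rho f g' N k.
Proof.
rewrite /dmul_trunc -sumrB; apply: eq_bigr => i _; rewrite -sumrB.
apply: eq_bigr => j _; rewrite /pblk /fconv -sumrB; apply: eq_bigr => a _.
by rewrite /blk /dsub; ring.
Qed.

Lemma ccvgB (p q : nat -> R[i]) l m : ccvg p l -> ccvg q m -> ccvg (fun n => p n - q n) (l - m).
Proof.
move=> h1 h2; have := ccvgD h1 (ccvgZ (-1) h2).
by rewrite mulN1r; under [X in ccvg X _]eq_fun do rewrite mulN1r.
Qed.

(** [dmul] is a limit, so additivity comes from that of the truncations together with their
    convergence, which the Besov bounds guarantee. *)
Lemma dmul_subl (a b : R) f f' g F F' G : 0 < a < b ->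
  bb (- a) f F -> bb (- a) f' F' -> bb b g G ->
  dmul (dsub f f') g = dsub (dmul f g) (dmul f' g).
Proof.
move=> hab h h' hg; apply/funext => k; rewrite [LHS](dmulE H); apply: ccvg_clim.
have := ccvgB (dmul_trunc_cvg H k hab h hg) (dmul_trunc_cvg H k hab h' hg).
by under [X in ccvg X _]eq_fun do rewrite -dmul_trunc_subl.
Qed.

Lemma dmul_subr (a b : R) f g g' F G G' : 0 < a < b ->
  bb (- a) f F -> bb b g G -> bb b g' G' ->
  dmul f (dsub g g') = dsub (dmul f g) (dmul f g').
Proof.
move=> hab h hg hg'; apply/funext => k; rewrite [LHS](dmulE H); apply: ccvg_clim.
have := ccvgB (dmul_trunc_cvg H k hab h hg) (dmul_trunc_cvg H k hab h hg').
by under [X in ccvg X _]eq_fun do rewrite -dmul_trunc_subr.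
Qed.

Lemma dmul_dsub (a b : R) f f' g g' F F' G G' : 0 < a < b ->
  bb (- a) f F -> bb (- a) f' F' -> bb b g G -> bb b g' G' ->
  dsub (dmul f g) (dmul f' g') = dadd (dmul (dsub f f') g) (dmul f' (dsub g g')).
Proof.
move=> hab h h' hg hg'; rewrite (dmul_subl hab h h' hg) (dmul_subr hab h' hg hg').
by apply/funext => k; rewrite /dsub /dadd; ring.
Qed.

Lemma dconj_dsub f g : dconj (dsub f g) = dsub (dconj f) (dconj g).
Proof. by apply/funext => k; rewrite /dconj /dsub cconjB. Qed.

End HeatSmoothing.

(** * Local Lipschitz bound for the nonlinearity *)

Section Nonlinearity.
Variable R : realType.
Variables chi rho : R -> R -> R.
Hypothesis H : dyadic_partition chi rho.
Variables (lam : R) (nu : R[i]).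
Implicit Types (Y Z : distr R).

Local Notation bb := (bb chi rho).
Local Notation dmul := (dmul chi rho).
Local Notation Psi := (Psi chi rho lam nu).

(** Each product difference is telescoped. Powers of [Y] are estimated in [C^b] and only then
    multiplied by a rough component; [Zabs2Z] cancels. The normalisation [1 <= y] absorbs the lower
    order terms into [y ^ 2 + W * y]. *)
Lemma Psi_lipschitz (a b : R) : 0 < a < b -> exists2 C : R, 0 <= C &
  forall Y Y' Z Z2 Zabs2 Zabs2Z y d W, 1 <= y ->
  bb b Y y -> bb b Y' y -> bb b (dsub Y Y') d ->
  bb (- a) Z W -> bb (- a) Z2 W -> bb (- a) Zabs2 W ->
  bb (- a) (dsub (Psi Y Z Z2 Zabs2 Zabs2Z) (Psi Y' Z Z2 Zabs2 Zabs2Z))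
    (C * (y ^+ 2 + W * y) * d).
Proof.
move=> hab; have /andP[a0 ab] := hab.
have b0 : 0 < b by lra.
have [Cr Cr0 hr] := bb_dmul_rough H hab.
have [Cs Cs0 hs] := bb_dmul_smooth H b0.
pose L := cmod ((1 + lam)%:C : R[i]); pose V := cmod (- nu).
have L0 : 0 <= L by exact: cmod_ge0.
have V0 : 0 <= V by exact: cmod_ge0.
have c2 : cmod (2%:C : R[i]) = 2 by rewrite cmodR ger0_norm.
(* [3 * Cs ^ 2] comes from the cubic term, [6 = 4 + 2] from [2 Z |Y|^2] and [cconj Z * Y^2], and
   [3 = 2 + 1] from the terms linear in [Y] with coefficients [2 Zabs2] and [Z2]. *)
exists (L + V * (3 * Cs ^+ 2 + 6 * Cr * Cs + 3 * Cr)).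
  by rewrite addr_ge0// mulr_ge0// !addr_ge0// !mulr_ge0 ?exprn_ge0.
move=> Y Y' Z Z2 Zabs2 Zabs2Z y d W y1 hY hY' hD hZ hZ2 hZa.
have W0 := bb_ge0 hZ; have d0 := bb_ge0 hD; have y0 : 0 <= y by lra.
have bblow f B : bb b f B -> bb (- a) f B by apply: bb_weaken; lra.
have cY := bb_dconj H hY; have cY' := bb_dconj H hY'.
have hD' : bb b (dsub (dconj Y) (dconj Y')) d by rewrite -dconj_dsub; exact: bb_dconj.
have N1 := hs _ _ _ _ hY cY; have N1' := hs _ _ _ _ hY' cY'.
have S1 := hs _ _ _ _ hY hY; have S1' := hs _ _ _ _ hY' hY'.
have dN : bb b (dsub (dmul Y (dconj Y)) (dmul Y' (dconj Y'))) (2 * Cs * y * d).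
  rewrite (dmul_dsub H hab (bblow _ _ hY) (bblow _ _ hY') cY cY').
  apply: bb_le (bbD (hs _ _ _ _ hD cY) (hs _ _ _ _ hY' hD')); apply: eqr_le; ring.
have dS : bb b (dsub (dmul Y Y) (dmul Y' Y')) (2 * Cs * y * d).
  rewrite (dmul_dsub H hab (bblow _ _ hY) (bblow _ _ hY') hY hY').
  apply: bb_le (bbD (hs _ _ _ _ hD hY) (hs _ _ _ _ hY' hD)); apply: eqr_le; ring.
have dC : bb (- a) (dsub (dmul (dmul Y (dconj Y)) Y) (dmul (dmul Y' (dconj Y')) Y'))
    (3 * Cs ^+ 2 * y ^+ 2 * d).
  apply: (bblow); rewrite (dmul_dsub H hab (bblow _ _ N1) (bblow _ _ N1') hY hY').
  apply: bb_le (bbD (hs _ _ _ _ dN hY) (hs _ _ _ _ N1' hD)); apply: eqr_le; ring.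
have E : dsub (Psi Y Z Z2 Zabs2 Zabs2Z) (Psi Y' Z Z2 Zabs2 Zabs2Z) =
  dadd (dscale (1 + lam)%:C (dsub Y Y')) (dscale (- nu)
   (dadd (dsub (dmul (dmul Y (dconj Y)) Y) (dmul (dmul Y' (dconj Y')) Y'))
   (dadd (dscale 2%:C (dmul Z (dsub (dmul Y (dconj Y)) (dmul Y' (dconj Y')))))
   (dadd (dmul (dconj Z) (dsub (dmul Y Y) (dmul Y' Y')))
   (dadd (dscale 2%:C (dmul Zabs2 (dsub Y Y')))
         (dmul Z2 (dsub (dconj Y) (dconj Y')))))))).
  rewrite (dmul_subr H hab hZ N1 N1') (dmul_subr H hab (bb_dconj H hZ) S1 S1').
  rewrite (dmul_subr H hab hZa hY hY') (dmul_subr H hab hZ2 cY cY').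
  apply/funext => k; rewrite /Defs.Psi /dsub /dadd /dscale.
  move: (dmul (dmul Y (dconj Y)) Y k) (dmul (dmul Y' (dconj Y')) Y' k)
    (dmul Z (dmul Y (dconj Y)) k) (dmul Z (dmul Y' (dconj Y')) k)
    (dmul (dconj Z) (dmul Y Y) k) (dmul (dconj Z) (dmul Y' Y') k)
    (dmul Zabs2 Y k) (dmul Zabs2 Y' k) (dmul Z2 (dconj Y) k)
    (dmul Z2 (dconj Y') k) (Y k) (Y' k) (Z k) (Zabs2Z k) (1 + lam)%:C 2%:C nu.
  by move=> *; ring.
rewrite E.
have := bbD (bbZ (1 + lam)%:C (bblow _ _ hD)) (bbZ (- nu) (bbD dC (bbD
  (bbZ 2%:C (hr _ _ _ _ hZ dN)) (bbD (hr _ _ _ _ (bb_dconj H hZ) dS)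
  (bbD (bbZ 2%:C (hr _ _ _ _ hZa hD)) (hr _ _ _ _ hZ2 hD')))))).
apply: bb_le; rewrite c2 -/L -/V.
have y2 : y <= y ^+ 2 by rewrite expr2 ler_peMr.
have e1 : L * d <= L * ((y ^+ 2 + W * y) * d).
  rewrite ler_wpM2l// -[leLHS]mul1r ler_wpM2r//.
  by have := mulr_ge0 W0 y0; lra.
have e2 : W * d <= W * y * d by rewrite ler_wpM2r// ler_peMr.
have e3 : 0 <= W * y * d by rewrite !mulr_ge0.
have e4 : 0 <= y ^+ 2 * d by rewrite mulr_ge0 ?exprn_ge0.
have CS : 0 <= 3 * Cs ^+ 2 by rewrite mulr_ge0 ?exprn_ge0.
have CRS : 0 <= 6 * Cr * Cs by rewrite mulr_ge0 ?mulr_ge0.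
have CR : 0 <= 3 * Cr by rewrite mulr_ge0.
set X := (y ^+ 2 + W * y) * d in e1 *.
have XE : X = y ^+ 2 * d + W * y * d by rewrite /X mulrDl.
have f1 : 3 * Cs ^+ 2 * (y ^+ 2 * d) <= 3 * Cs ^+ 2 * X by rewrite ler_wpM2l//; lra.
have f2 : 6 * Cr * Cs * (W * y * d) <= 6 * Cr * Cs * X by rewrite ler_wpM2l//; lra.
have f3 : 3 * Cr * (W * d) <= 3 * Cr * X by rewrite ler_wpM2l//; lra.
have f4 := ler_wpM2l V0 (lerD (lerD f1 f2) f3).
apply: le_trans (_ : _ <= L * X + V * (3 * Cs ^+ 2 * X + 6 * Cr * Cs * X + 3 * Cr * X)) _.
  by apply: le_trans (lerD e1 f4); apply: eqr_le; ring.
by apply: eqr_le; rewrite /X; ring.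
Qed.

End Nonlinearity.

(** * Singular kernels and the Duhamel integral *)

Section SingularIntegrals.
Variable R : realType.
Local Notation mu := (@lebesgue_measure R).
Implicit Types (t s th ka : R).

(** The integrand may be singular at both ends: the ordinary fundamental theorem is used on compact
    subintervals, followed by monotone convergence. *)
Lemma improper_FTC_le (G g : R -> R) (t G0 G1 : R) : 0 < t ->
  (forall s, 0 < s < t -> is_derive s 1 G (g s)) ->
  (forall s, 0 < s < t -> 0 <= g s) ->
  (forall s, 0 < s < t -> {for s, continuous g}) ->
  (forall s, 0 < s < t -> G0 <= G s <= G1) ->
  (\int[mu]_(s in `]0%R, t[) (g s)%:E <= (G1 - G0)%:E)%E.
Proof.
move=> t0 dG g0 cg hG.
(* Starting at [t / 3] keeps every interval [[e n, t - e n]] nondegenerate. *)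
pose e n : R := t / n.+3%:R.
have e0 n : 0 < e n by rewrite divr_gt0.
have e3 n : e n <= t / 3.
  by rewrite ler_pM2l// lef_pV2 ?posrE// ler_nat.
have emono m n : (m <= n)%N -> e n <= e m.
  by move=> mn; rewrite ler_pM2l// lef_pV2 ?posrE// ler_nat.
pose F n : set R := `[e n, t - e n]%classic.
have inF n s : s \in `[e n, t - e n] -> 0 < s < t.
  by rewrite in_itv /= => /andP[h1 h2]; have := e0 n; lra.
have UF : `]0, t[%classic = \bigcup_n F n.
  apply/seteqP; split => s /=; rewrite in_itv /=.
    move=> /andP[s0 st].
    have m0 : 0 < Num.min s (t - s) by rewrite lt_min s0 subr_gt0.
    pose N := Num.truncn (t / Num.min s (t - s)).
    exists N => //; rewrite /F /= in_itv /=.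
    have : e N <= Num.min s (t - s).
      rewrite /e ler_pdivrMr// mulrC -ler_pdivrMr//.
      apply: ltW; apply: lt_le_trans (truncnS_gt _) _.
      by rewrite ler_nat -/N; lia.
    by rewrite le_min => /andP[h1 h2]; apply/andP; split; lra.
  by move=> [n _]; rewrite /F /= => /inF.
have cgF n : {within `[e n, t - e n]%classic, continuous g}.
  apply: continuous_in_subspaceT => s; rewrite inE /= => /inF; exact: cg.
have mF n : measurable_fun (F n) (fun s : R => (g s)%:E).
  apply/measurable_EFinP; by apply: subspace_continuous_measurable_fun; [exact: measurable_itv|exact: cgF].
have nd : nondecreasing_seq F.
  move=> m n mn; rewrite subsetEset => s.
  rewrite /F /mkset !in_itv /= => /andP[h1 h2].
  by have h3 := emono _ _ mn; apply/andP; split; lra.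
rewrite UF.
have := @ge0_nondecreasing_set_cvg_integral _ (measurableTypeR R) R F (fun s : R => (g s)%:E) mu nd
   (fun n => measurable_itv _) mF _.
have pos i x : F i x -> (0 <= (g x)%:E)%E.
  by move=> /inF h; rewrite /= lee_fin g0.
move=> /(_ pos) hc; rewrite -(cvg_lim _ hc)//.
apply: lime_le; first by apply/cvg_ex; eexists; exact: hc.
apply: nearW => n.
have lt_e : e n < t - e n by have := e3 n; lra.
rewrite (@continuous_FTC2 _ g G (e n) (t - e n))//.
- rewrite -EFinB lee_fin.
  have /andP[h1 _] := hG (e n) ltac:(have := e3 n; have := e0 n; lra).
  have /andP[_ h2] := hG (t - e n) ltac:(have := e3 n; have := e0 n; lra).
  by lra.
- have dc s : 0 < s < t -> {for s, continuous G}.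
    move=> /dG [ds _]; apply: differentiable_continuous; exact/derivable1_diffP.
  split.
  + by move=> s; rewrite in_itv /= => hs; have [] := dG s ltac:(have := e0 n; lra).
  + apply: cvg_at_right_filter; apply: dc; have := e3 n; have := e0 n; lra.
  + apply: cvg_at_left_filter; apply: dc; have := e3 n; have := e0 n; lra.
- move=> s; rewrite in_itv /= => hs; rewrite derive1E.
  by have [_ ->] := dG s ltac:(have := e0 n; lra).
Qed.

Lemma continuous_powR_pos (p x : R) : 0 < x -> {for x, continuous (fun y : R => y `^ p)}.
Proof.
move=> x0; apply: differentiable_continuous; apply/derivable1_diffP.
by have [] := is_derive1_powR p x0.
Qed.

Lemma integral_powRN t ka : 0 < t -> 0 <= ka < 1 ->
  (\int[mu]_(s in `]0%R, t[) (s `^ (- ka))%:E <= (t `^ (1 - ka) / (1 - ka))%:E)%E.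
Proof.
move=> t0 /andP[k0 k1]; have k10 : 0 < 1 - ka by lra.
rewrite -[X in (_ <= X%:E)%E]subr0.
apply: (@improper_FTC_le (fun s => s `^ (1 - ka) / (1 - ka))) => //.
- move=> s /andP[s0 _].
  have h := is_derive_mul (is_derive1_powR (1 - ka) s0) (is_derive_cst (1 - ka)^-1 s 1).
  apply: (is_derive_eq h); rewrite /cst mulr0 addr0 mulrAC divff ?gt_eqF// mul1r.
  by congr (_ `^ _); lra.
- by move=> s _; exact: powR_ge0.
- by move=> s /andP[s0 _]; exact: continuous_powR_pos.
- move=> s /andP[s0 st]; rewrite divr_ge0 ?powR_ge0 ?(ltW k10)//= ler_pM2r ?invr_gt0//.
  by apply: ge0_ler_powR; rewrite ?nnegrE ?ltW.
Qed.

Lemma integral_powRN_refl t th : 0 < t -> 0 <= th < 1 ->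
  (\int[mu]_(s in `]0%R, t[) ((t - s) `^ (- th))%:E <= (t `^ (1 - th) / (1 - th))%:E)%E.
Proof.
move=> t0 /andP[k0 k1]; have k10 : 0 < 1 - th by lra.
rewrite -[X in (_ <= X%:E)%E]opprK -[X in (_ <= X%:E)%E]sub0r.
apply: (@improper_FTC_le (fun s => - ((t - s) `^ (1 - th) / (1 - th)))) => //.
- move=> s /andP[s0 st]; have ts0 : 0 < t - s by rewrite subr_gt0.
  have hl : is_derive s (1 : R) (fun s' : R => t - s') (- 1).
    apply: (is_derive_eq (is_deriveB (is_derive_cst t s 1) (is_derive_id s 1))).
    by rewrite sub0r.
  have h := is_derive_mul (is_derive_comp1 hl (is_derive1_powR (1 - th) ts0))
    (is_derive_cst (1 - th)^-1 s 1).
  apply: (is_derive_eq (is_deriveN h)); rewrite /cst mulr0 addr0.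
  rewrite (_ : 1 - th - 1 = - th); last by lra.
  by field; rewrite gt_eqF.
- by move=> s _; exact: powR_ge0.
- move=> s /andP[s0 st]; apply: (@continuous_comp _ _ _ (fun s' : R => t - s') (fun y : R => y `^ (- th))).
    by apply: cvgB; [exact: cvg_cst|exact: cvg_id].
  by apply: continuous_powR_pos; rewrite subr_gt0.
- move=> s /andP[s0 st]; rewrite oppr_le0 divr_ge0 ?powR_ge0 ?(ltW k10)//= andbT.
  rewrite lerN2 ler_pM2r ?invr_gt0//.
  by apply: ge0_ler_powR; rewrite ?nnegrE; lra.
Qed.

(** Only one factor is singular on each half of [[0, t]]; the other is at most its value at [t / 2],
    and [(1 / 2)^-p <= 2] for [p <= 1]. *)
Lemma kernel_split t s th ka : 0 < s < t -> 0 <= th <= 1 -> 0 <= ka <= 1 ->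
  (t - s) `^ (- th) * s `^ (- ka) <=
  2 * t `^ (- ka) * (t - s) `^ (- th) + 2 * t `^ (- th) * s `^ (- ka).
Proof.
move=> /andP[s0 st] hth hka; have ts0 : 0 < t - s by rewrite subr_gt0.
have t0 : 0 < t by lra.
have half (u p : R) : t / 2 <= u -> 0 <= p <= 1 -> u `^ (- p) <= 2 * t `^ (- p).
  move=> hu /andP[p0 p1].
  have : u `^ (- p) <= (t / 2) `^ (- p).
    rewrite !powRN lef_pV2 ?posrE ?powR_gt0//; try lra.
    by apply: ge0_ler_powR; rewrite ?nnegrE; lra.
  move/le_trans; apply; rewrite powRM ?(ltW t0)// mulrC ler_wpM2r ?powR_ge0//.
  rewrite -powR_inv1// -powRrM mulrNN mul1r.
  by apply: ler1_powR => //; lra.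
have P (u p : R) : 0 <= u `^ p := powR_ge0 u p.
have [h|h] := leP (t / 2) s.
  apply: (@le_trans _ _ (2 * t `^ (- ka) * (t - s) `^ (- th))).
    by rewrite mulrC ler_wpM2r// half.
  by rewrite lerDl !mulr_ge0.
apply: (@le_trans _ _ (2 * t `^ (- th) * s `^ (- ka))).
  by rewrite ler_wpM2r// half//; lra.
by rewrite lerDr !mulr_ge0.
Qed.

Lemma measurable_powR_refl t p (D : set R) : measurable_fun D (fun s => (t - s) `^ p).
Proof.
apply: measurable_funTS; apply: (@measurableT_comp _ _ _ _ _ _ (fun y : R => y `^ p) _ (fun s : R => t - s)).
  exact: measurable_powR.
by apply: measurable_funB => //; exact: measurable_cst.
Qed.

Lemma measurable_powRN p (D : set R) : measurable_fun D (fun s : R => s `^ p).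
Proof. by apply: measurable_funTS; exact: measurable_powR. Qed.

(** The scaling of the Beta integral, with a constant from [kernel_split] in place of the Beta
    function. *)
Lemma integral_kernel th ka : 0 <= th < 1 -> 0 <= ka < 1 ->
  exists2 C : R, 0 <= C & forall t, 0 < t ->
  (\int[mu]_(s in `]0%R, t[) ((t - s) `^ (- th) * s `^ (- ka))%:E
     <= (C * t `^ (1 - th - ka))%:E)%E.
Proof.
move=> hth hka; have /andP[th0 th1] := hth; have /andP[ka0 ka1] := hka.
exists (2 / (1 - th) + 2 / (1 - ka)).
  by rewrite addr_ge0 ?divr_ge0//; lra.
move=> t t0.
apply: (@le_trans _ _ (\int[mu]_(s in `]0%R, t[)
   ((2 * t `^ (- ka))%:E * ((t - s) `^ (- th))%:E +
    (2 * t `^ (- th))%:E * (s `^ (- ka))%:E))%E).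
  apply: ge0_le_integral => //=.
  - by move=> s _; rewrite lee_fin mulr_ge0 ?powR_ge0.
  - apply/measurable_EFinP; apply: measurable_funM; first exact: measurable_powR_refl.
    exact: measurable_powRN.
  - apply/measurable_EFinP; apply: measurable_funD; apply: measurable_funM => //.
      exact: measurable_powR_refl.
    exact: measurable_powRN.
  - move=> s; rewrite in_itv /= => hs; rewrite -!EFinM -EFinD lee_fin.
    by apply: kernel_split => //; lra.
have mR : measurable_fun `]0%R, t[ (fun s : R => ((t - s) `^ (- th))%:E).
  by apply/measurable_EFinP; exact: measurable_powR_refl.
have mN : measurable_fun `]0%R, t[ (fun s : R => (s `^ (- ka))%:E).
  by apply/measurable_EFinP; exact: measurable_powRN.
have c1 : 0 <= 2 * t `^ (- ka) by rewrite mulr_ge0 ?powR_ge0.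
have c2 : 0 <= 2 * t `^ (- th) by rewrite mulr_ge0 ?powR_ge0.
rewrite ge0_integralD//=; last 4 first.
- by move=> s _; rewrite -EFinM lee_fin mulr_ge0 ?powR_ge0.
- by apply: measurable_funeM.
- by move=> s _; rewrite -EFinM lee_fin mulr_ge0 ?powR_ge0.
- by apply: measurable_funeM.
rewrite ge0_integralZl//; last by move=> s _; rewrite lee_fin powR_ge0.
rewrite ge0_integralZl//; last by move=> s _; rewrite lee_fin powR_ge0.
apply: (@le_trans _ _ ((2 * t `^ (- ka))%:E * (t `^ (1 - th) / (1 - th))%:E +
   (2 * t `^ (- th))%:E * (t `^ (1 - ka) / (1 - ka))%:E)%E).
  by apply: leeD; apply: lee_wpmul2l; rewrite ?lee_fin//;
    [exact: integral_powRN_refl|exact: integral_powRN].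
rewrite -!EFinM -EFinD lee_fin.
have e1 : t `^ (- ka) * t `^ (1 - th) = t `^ (1 - th - ka).
  by rewrite -powRD ?(gt_eqF t0) ?implybT//; congr (_ `^ _); ring.
have e2 : t `^ (- th) * t `^ (1 - ka) = t `^ (1 - th - ka).
  by rewrite -powRD ?(gt_eqF t0) ?implybT//; congr (_ `^ _); ring.
apply: eqr_le; transitivity (2 / (1 - th) * (t `^ (- ka) * t `^ (1 - th)) +
  2 / (1 - ka) * (t `^ (- th) * t `^ (1 - ka))); first by ring.
by rewrite e1 e2; ring.
Qed.

End SingularIntegrals.

(** * Complex integrals, measurability and continuity by components *)

Section ComplexIntegrals.
Variable R : realType.
Local Notation mu := (@lebesgue_measure R).
Implicit Types (f g : R -> R[i]) (D : set R) (a b t : R).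

Lemma cintegralZ a b c f : cintegrable a b f ->
  cintegrable a b (fun s => c * f s) /\
  cintegral a b (fun s => c * f s) = c * cintegral a b f.
Proof.
move=> [h1 h2].
have z (r : R) (p : R -> R) : mu.-integrable `[a, b] (fun s => (p s)%:E) ->
   mu.-integrable `[a, b] (fun s => (r * p s)%:E) /\
   Rintegral mu `[a, b] (fun s => r * p s) = r * Rintegral mu `[a, b] p.
  move=> hp; split; last exact: RintegralZl.
  by have := @integrableZl _ (measurableTypeR R) R mu `[a, b]%classic (measurable_itv _) r _ hp;
    apply: eq_integrable => // s _; rewrite EFinM.
have [a1 b1] := z (complex.Re c) _ h1; have [a2 b2] := z (complex.Im c) _ h2.
have [a3 b3] := z (complex.Im c) _ h1; have [a4 b4] := z (complex.Re c) _ h2.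
have eR : (fun s => complex.Re (c * f s)) =
   (fun s => complex.Re c * complex.Re (f s) - complex.Im c * complex.Im (f s)).
  by apply/funext => s; rewrite complexReM.
have eI : (fun s => complex.Im (c * f s)) =
   (fun s => complex.Re c * complex.Im (f s) + complex.Im c * complex.Re (f s)).
  by apply/funext => s; rewrite complexImM.
split; last first.
  rewrite /cintegral eR eI; apply: complex_eqP => /=.
    by rewrite complexReM /= RintegralB// b1 b2.
  by rewrite complexImM /= RintegralD// b3 b4.
split.
  rewrite (_ : (fun s => _) = (fun s => (complex.Re c * complex.Re (f s))%:E
     - (complex.Im c * complex.Im (f s))%:E)%E); first exact: integrableB.
  by apply/funext => s; rewrite complexReM.
rewrite (_ : (fun s => _) = (fun s => (complex.Re c * complex.Im (f s))%:E
     + (complex.Im c * complex.Re (f s))%:E)%E); first exact: integrableD.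
by apply/funext => s; rewrite complexImM.
Qed.

Lemma cintegralD a b f g : cintegrable a b f -> cintegrable a b g ->
  cintegrable a b (fun s => f s + g s) /\
  cintegral a b (fun s => f s + g s) = cintegral a b f + cintegral a b g.
Proof.
move=> [h1 h2] [h3 h4].
have eR : (fun s => complex.Re (f s + g s)) =
   (fun s => complex.Re (f s) + complex.Re (g s)).
  by apply/funext => s; rewrite complexReD.
have eI : (fun s => complex.Im (f s + g s)) =
   (fun s => complex.Im (f s) + complex.Im (g s)).
  by apply/funext => s; rewrite complexImD.
split; last first.
  rewrite /cintegral eR eI; apply: complex_eqP => /=; first by rewrite RintegralD.
  by rewrite RintegralD.
split.
  rewrite (_ : (fun s => _) = (fun s => (complex.Re (f s))%:E + (complex.Re (g s))%:E)%E).
    exact: integrableD.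
  by apply/funext => s; rewrite complexReD.
rewrite (_ : (fun s => _) = (fun s => (complex.Im (f s))%:E + (complex.Im (g s))%:E)%E).
  exact: integrableD.
by apply/funext => s; rewrite complexImD.
Qed.

Lemma cintegral0 a b : cintegrable a b (fun=> 0) /\ cintegral a b (fun=> 0 : R[i]) = 0.
Proof.
split; first by split; exact: integrable0.
by apply: complex_eqP => /=; rewrite /Rintegral integral0.
Qed.

Lemma cintegral_sum (I : Type) (r : seq I) a b (f : I -> R -> R[i]) :
  (forall i, cintegrable a b (f i)) ->
  cintegrable a b (fun s => \sum_(i <- r) f i s) /\
  cintegral a b (fun s => \sum_(i <- r) f i s) = \sum_(i <- r) cintegral a b (f i).
Proof.
move=> h; elim: r => [|i r [ih1 ih2]].
  rewrite big_nil (_ : (fun s : R => \sum_(i <- [::]) f i s) = fun=> 0).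
    exact: cintegral0.
  by apply/funext => s; rewrite big_nil.
rewrite big_cons (_ : (fun s : R => \sum_(j <- i :: r) f j s) =
    (fun s => f i s + \sum_(j <- r) f j s)).
  by rewrite -ih2; exact: cintegralD.
by apply/funext => s; rewrite big_cons.
Qed.

(** The majorants are kernels singular at the endpoints, so domination is asked in the interior and
    the endpoints are discarded as a null set. *)
Lemma le_Rintegral_open t (r g : R -> R) (I : R) :
  mu.-integrable `[0, t] (fun s => (r s)%:E) ->
  measurable_fun `]0, t[ g -> (forall s, 0 < s < t -> `|r s| <= g s) ->
  (\int[mu]_(s in `]0%R, t[) (g s)%:E <= I%:E)%E ->
  `|Rintegral mu `[0, t] r| <= I.
Proof.
move=> hr mg hg hI.
apply: le_trans (@le_normr_Rintegral _ (measurableTypeR R) R mu `[0, t]%classic r (measurable_itv _) hr) _.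
have hn : mu.-integrable `[0, t] (EFin \o (fun s => `|r s|)).
  exact: (integrable_norm hr).
rewrite -lee_fin /Rintegral fineK; last exact: integrable_fin_num.
apply: le_trans hI.
have mr : measurable_fun `]0, t[ (fun s => `|r s|).
  apply: measurableT_comp => //.
  have /measurable_EFinP := measurable_int _ hr.
  by apply: measurable_funS => //; exact: subset_itv_oo_cc.
rewrite (@integral_itv_bndoo R 0 t _ true false); last exact/measurable_EFinP.
apply: ge0_le_integral => //=; try exact/measurable_EFinP.
Qed.

(** The factor [2] is the price of bounding real and imaginary parts separately. *)
Lemma cmod_cintegral_le t f (g : R -> R) (I : R) : cintegrable 0 t f ->
  measurable_fun `]0, t[ g -> (forall s, 0 < s < t -> cmod (f s) <= g s) ->
  (\int[mu]_(s in `]0%R, t[) (g s)%:E <= I%:E)%E ->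
  cmod (cintegral 0 t f) <= 2 * I.
Proof.
move=> [h1 h2] mg hg hI; apply: le_trans (cmod_ReIm _) _ => /=.
rewrite mulr_natl mulr2n; apply: lerD.
  apply: (le_Rintegral_open h1 mg _ hI) => s hs.
  exact: le_trans (Re_le_cmod _) (hg _ hs).
apply: (le_Rintegral_open h2 mg _ hI) => s hs.
exact: le_trans (Im_le_cmod _) (hg _ hs).
Qed.

Definition cmeas D f := measurable_fun D (fun s => complex.Re (f s)) /\
  measurable_fun D (fun s => complex.Im (f s)).

Lemma cintegrable_dominated t f (g : R -> R) (I : R) : cmeas `]0, t[ f ->
  measurable_fun `]0, t[ g -> (forall s, 0 < s < t -> cmod (f s) <= g s) ->
  (\int[mu]_(s in `]0%R, t[) (g s)%:E <= I%:E)%E ->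
  cintegrable 0 t f.
Proof.
move=> [m1 m2] mg hg hI.
have key (r : R -> R) : measurable_fun `]0, t[ r ->
    (forall s, 0 < s < t -> `|r s| <= g s) -> mu.-integrable `[0, t] (fun s => (r s)%:E).
  move=> mr hr; apply/integrableP; split.
    by apply/measurable_EFinP; exact: (@measurable_fun_itv_cc _ _ _ false true).
  apply: le_lt_trans (_ : _ <= I%:E)%E _; last by rewrite ltry.
  apply: le_trans hI.
  have mr' : measurable_fun `]0, t[ (fun s => `|r s|) by apply: measurableT_comp.
  rewrite (@integral_itv_bndoo R 0 t _ true false); last exact/measurable_EFinP.
  apply: ge0_le_integral => //=; try exact/measurable_EFinP.
split; apply: key => // s hs.
  exact: le_trans (Re_le_cmod _) (hg _ hs).
exact: le_trans (Im_le_cmod _) (hg _ hs).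
Qed.

Lemma cmeas_cst D c : cmeas D (fun=> c).
Proof. by split; exact: measurable_cst. Qed.

Lemma cmeasD D f g : cmeas D f -> cmeas D g -> cmeas D (fun s => f s + g s).
Proof.
move=> [h1 h2] [h3 h4]; split.
  under eq_fun do rewrite complexReD; exact: measurable_funD.
under eq_fun do rewrite complexImD; exact: measurable_funD.
Qed.

Lemma cmeasM D f g : cmeas D f -> cmeas D g -> cmeas D (fun s => f s * g s).
Proof.
move=> [h1 h2] [h3 h4]; split.
  under eq_fun do rewrite complexReM.
  by apply: measurable_funB; exact: measurable_funM.
under eq_fun do rewrite complexImM.
by apply: measurable_funD; exact: measurable_funM.
Qed.

Lemma cmeas_conj D f : cmeas D f -> cmeas D (fun s => cconj (f s)).
Proof. by move=> [h1 h2]; split => //=; exact: measurableT_comp. Qed.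

Lemma cmeas_sum D (I : Type) (r : seq I) (f : I -> R -> R[i]) :
  (forall i, cmeas D (f i)) -> cmeas D (fun s => \sum_(i <- r) f i s).
Proof.
move=> h; elim: r => [|i r ih].
  by under eq_fun do rewrite big_nil; exact: cmeas_cst.
by under eq_fun do rewrite big_cons; exact: cmeasD.
Qed.

Lemma cmeas_lim D (f : nat -> R -> R[i]) g : (forall n, cmeas D (f n)) ->
  (forall s, D s -> ccvg (f ^~ s) (g s)) -> cmeas D g.
Proof.
move=> h hc; split.
  apply: (@measurable_fun_cvg _ _ _ D (fun n s => complex.Re (f n s))).
    by move=> n; have [] := h n.
  by move=> s /hc [].
apply: (@measurable_fun_cvg _ _ _ D (fun n s => complex.Im (f n s))).
  by move=> n; have [] := h n.
by move=> s /hc [].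
Qed.

Lemma cmeasS D D' f : measurable D' -> D `<=` D' -> cmeas D' f -> cmeas D f.
Proof. by move=> m s [h1 h2]; split; [exact: measurable_funS h1|exact: measurable_funS h2]. Qed.

Definition ccont D f := {within D, continuous (fun s => complex.Re (f s))} /\
  {within D, continuous (fun s => complex.Im (f s))}.

Lemma ccont_cmeas D f : measurable D -> ccont D f -> cmeas D f.
Proof. by move=> m [h1 h2]; split; exact: subspace_continuous_measurable_fun. Qed.

Lemma ccontM D f g : ccont D f -> ccont D g -> ccont D (fun s => f s * g s).
Proof.
move=> [h1 h2] [h3 h4]; split => s.
  under eq_fun do rewrite complexReM.
  by apply: cvgB; apply: cvgM; [exact: h1|exact: h3|exact: h2|exact: h4].
under eq_fun do rewrite complexImM.
by apply: cvgD; apply: cvgM; [exact: h1|exact: h4|exact: h2|exact: h3].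
Qed.

Lemma ccontD D f g : ccont D f -> ccont D g -> ccont D (fun s => f s + g s).
Proof.
move=> [h1 h2] [h3 h4]; split => s.
  by under eq_fun do rewrite complexReD; apply: cvgD; [exact: h1|exact: h3].
by under eq_fun do rewrite complexImD; apply: cvgD; [exact: h2|exact: h4].
Qed.

Lemma ccont_cst D c : ccont D (fun=> c).
Proof. by split=> s; exact: cvg_cst. Qed.

Lemma ccont_cintegral T f : 0 <= T -> cintegrable 0 T f ->
  ccont `[0, T] (fun t => cintegral 0 t f).
Proof.
move=> T0 [h1 h2]; split.
  exact: (parameterized_integral_continuous T0 h1).
exact: (parameterized_integral_continuous T0 h2).
Qed.

Lemma ccont_eps D f t : D t -> ccont D f -> forall e : R, 0 < e ->
  exists2 del : R, 0 < del & forall r, D r -> `|r - t| < del -> cmod (f r - f t) <= e.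
Proof.
move=> Dt [/subspace_continuousP h1 /subspace_continuousP h2] e e0.
have e20 : 0 < e / 2 by lra.
have [d1 /= d10 H1] := cvgr_dist_le _ _ (h1 t Dt) _ e20.
have [d2 /= d20 H2] := cvgr_dist_le _ _ (h2 t Dt) _ e20.
exists (Num.min d1 d2); first by rewrite lt_min d10.
move=> r Dr; rewrite lt_min => /andP[r1 r2].
have {}H1 := H1 r; have {}H2 := H2 r.
have {}H1 : `|complex.Re (f t) - complex.Re (f r)| <= e / 2.
  by apply: H1 => //; rewrite /ball /= distrC.
have {}H2 : `|complex.Im (f t) - complex.Im (f r)| <= e / 2.
  by apply: H2 => //; rewrite /ball /= distrC.
apply: le_trans (cmod_ReIm _) _; rewrite complexReD complexImD.
move: H1 H2; rewrite distrC [X in _ -> X <= _ -> _]distrC.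
by case: (f r) => ? ?; case: (f t) => ? ? /=; lra.
Qed.

End ComplexIntegrals.

(** * The Duhamel integral in Besov norms and coefficient by coefficient *)

Section Duhamel.
Variable R : realType.
Variables chi rho : R -> R -> R.
Hypothesis H : dyadic_partition chi rho.
Variable mu : R.
Hypothesis mu_gt0 : 0 < mu.
Implicit Types (u v : distr R) (F : R -> distr R) (k : int * int).

Local Notation wt := (lp_weight chi rho).
Local Notation blk := (blk chi rho).
Local Notation bb := (bb chi rho).
Local Notation dmul := (dmul chi rho).
Definition duhamel F t : distr R :=
  fun k => cintegral 0 t (fun s => heat_mult mu (t - s) k * F s k).

(** A block at a point is a finite combination of coefficients, so it commutes with the integral and
    [bb_heat] applies under it. The exponent [th] is kept apart from [(b + a) / 2] so that
    uniqueness can trade its exponential weight for a slightly stronger singularity. *)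
Lemma bb_duhamel (a b th ka : R) : 0 <= (b + a) / 2 <= 1 ->
  0 <= th < 1 -> 0 <= ka < 1 -> exists2 C : R, 0 <= C &
  forall F t D (g : R -> R), 0 < t <= 1 -> 0 <= D ->
    (forall k, cintegrable 0 t (fun s => heat_mult mu (t - s) k * F s k)) ->
    (forall s, 0 < s < t -> bb (- a) (F s) (g s) /\
       (t - s) `^ (- ((b + a) / 2)) * g s <= D * ((t - s) `^ (- th) * s `^ (- ka))) ->
    bb b (duhamel F t) (C * D * t `^ (1 - th - ka)).
Proof.
move=> hab hth hka.
have hab' : 0 <= (b - - a) / 2 <= 1 by rewrite opprK.
have [C1 C10 h1] := bb_heat H mu_gt0 hab'.
have [C2 C20 h2] := integral_kernel hth hka.
exists (2 * C1 * C2) => [|F t D g /andP[t0 t1] D0 hF hg n]; first by rewrite !mulr_ge0.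
exists (2 ^ n.+1)%N; first exact: blk_suppin.
move=> x y; set N := (2 ^ n.+1)%N.
have cF k := cintegralZ ((wt n k)%:C * ee k x y) (hF k).
have [_ E] := cintegral_sum (zbox N) (fun k => (cF k).1).
have -> : ev N (blk n (duhamel F t)) x y =
    cintegral 0 t (fun s => ev N (blk n (semigroup mu (t - s) (F s))) x y).
  transitivity (\sum_(k <- zbox N) cintegral 0 t (fun s =>
      (wt n k)%:C * ee k x y * (heat_mult mu (t - s) k * F s k))).
    rewrite /ev; apply: eq_bigr => k _; rewrite (cF k).2 /blk /duhamel.
    by rewrite mulrAC.
  rewrite -E; congr (cintegral 0 t _); apply/funext => s.
  rewrite /ev; apply: eq_bigr => k _; rewrite /blk /semigroup.
  by rewrite mulrAC.
have [cI _] := cintegral_sum (zbox N) (fun k => (cF k).1).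
have {cI} cI : cintegrable 0 t (fun s => ev N (blk n (semigroup mu (t - s) (F s))) x y).
  move: cI; congr (cintegrable 0 t _); apply/funext => s.
  rewrite /ev; apply: eq_bigr => k _; rewrite /blk /semigroup.
  by rewrite [RHS]mulrAC.
have A0 : 0 <= C1 * D * dy b n by rewrite !mulr_ge0 ?dy_ge0.
have mK : measurable_fun `]0, t[ (fun s => (t - s) `^ (- th) * s `^ (- ka)).
  by apply: measurable_funM; [exact: measurable_powR_refl|exact: measurable_powRN].
have -> : 2 * C1 * C2 * D * t `^ (1 - th - ka) * dy b n =
   2 * (C1 * D * dy b n * (C2 * t `^ (1 - th - ka))) by ring.
apply: (cmod_cintegral_le (g := fun s => C1 * D * dy b n * ((t - s) `^ (- th) * s `^ (- ka)))) => //.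
- by apply: measurable_funM => //; exact: measurable_cst.
- move=> s /andP[s0 st]; have ts : 0 < t - s <= 1 by lra.
  have [hs hs'] := hg s ltac:(lra).
  have := linf_ev (h1 _ _ _ ts hs n) (blk_suppin H (u := _)) x y.
  move/le_trans; apply; rewrite opprK.
  have -> : C1 * D * dy b n * ((t - s) `^ (- th) * s `^ (- ka)) =
    C1 * (D * ((t - s) `^ (- th) * s `^ (- ka))) * dy b n by ring.
  by rewrite ler_wpM2r ?dy_ge0// -mulrA ler_wpM2l.
- rewrite (_ : (fun s => _) = (fun s : R => (C1 * D * dy b n)%:E *
    ((t - s) `^ (- th) * s `^ (- ka))%:E)%E); last by apply/funext => s; rewrite EFinM.
  rewrite ge0_integralZl//.
  + by rewrite [leRHS]EFinM; apply: lee_wpmul2l; rewrite ?lee_fin//; exact: h2.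
  + exact/measurable_EFinP.
  + by move=> s _; rewrite lee_fin mulr_ge0 ?powR_ge0.
Qed.

Lemma heat_multD s t k : heat_mult mu (s + t) k = heat_mult mu s k * heat_mult mu t k.
Proof.
rewrite /heat_mult; set r := k.1%:~R ^+ 2 + _; set p := 4 * pi ^+ 2 * mu * r + 1.
have -> : -4 * pi ^+ 2 * (s + t) * r = -4 * pi ^+ 2 * s * r + -4 * pi ^+ 2 * t * r by ring.
have -> : - (s + t) * p = - s * p + - t * p by ring.
by rewrite cosD sinD expRD; apply: complex_eqP => /=; ring.
Qed.

Lemma heat_continuous D k : ccont D (fun s => heat_mult mu s k).
Proof.
rewrite /heat_mult; set r := k.1%:~R ^+ 2 + _; set p := 4 * pi ^+ 2 * mu * r + 1.
have c1 (c : R) : continuous (fun s : R => - s * c).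
  move=> s; apply: cvgM; last exact: cvg_cst.
  by apply: cvgN; exact: cvg_id.
have e : (fun s : R => -4 * pi ^+ 2 * s * r) = (fun s => - s * (4 * pi ^+ 2 * r)).
  by apply/funext => s; ring.
have cE : continuous (fun s : R => expR (- s * p)).
  move=> s; apply: (@continuous_comp _ _ _ (fun s : R => - s * p) (@expR R)).
    exact: c1.
  exact: continuous_expR.
have cC : continuous (fun s : R => cos (-4 * pi ^+ 2 * s * r)).
  move=> s; apply: (@continuous_comp _ _ _ (fun s : R => -4 * pi ^+ 2 * s * r) (@cos R)).
    by rewrite e; exact: c1.
  exact: continuous_cos.
have cS : continuous (fun s : R => sin (-4 * pi ^+ 2 * s * r)).
  move=> s; apply: (@continuous_comp _ _ _ (fun s : R => -4 * pi ^+ 2 * s * r) (@sin R)).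
    by rewrite e; exact: c1.
  exact: continuous_sin.
split; apply: continuous_subspaceT => s.
  under eq_fun do rewrite complexReM /= mul0r subr0.
  by apply: cvgM; [exact: cE|exact: cC].
under eq_fun do rewrite complexImM /= mul0r addr0.
by apply: cvgM; [exact: cE|exact: cS].
Qed.

Lemma heat_neg_bound k : exists2 C : R, 0 <= C &
  forall s, 0 <= s <= 1 -> cmod (heat_mult mu (- s) k) <= C.
Proof.
pose p : R := 4 * pi ^+ 2 * mu * (k.1%:~R ^+ 2 + k.2%:~R ^+ 2) + 1.
exists (expR `|p|) => [|s /andP[s0 s1]]; first exact: expR_ge0.
rewrite /heat_mult cmodM cmodR ger0_norm ?expR_ge0// -/p.
rewrite [X in _ * X]/cmod /= cos2Dsin2 sqrtr1 mulr1 ler_expR opprK.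
apply: le_trans (ler_norm _) _; rewrite normrM (ger0_norm s0).
by rewrite -[leRHS]mul1r ler_wpM2r.
Qed.

Lemma cmeas_heat_neg D k : measurable D -> cmeas D (fun s => heat_mult mu (- s) k).
Proof.
move=> mD; have [h1 h2] := ccont_cmeas (@measurableT _ R) (heat_continuous setT k).
have mN : measurable_fun setT (fun s : R => - s) by apply: oppr_measurable.
split; apply: measurable_funTS.
  exact: (measurableT_comp h1 mN).
exact: (measurableT_comp h2 mN).
Qed.

(** At a fixed frequency the backward heat factor is bounded on [[0, 1]], so the integrand is
    dominated by a multiple of [s^-ka]. *)
Lemma cintegrable_heat_neg (a T ka D t : R) F k : 0 < t <= T -> T <= 1 ->
  0 <= ka < 1 -> 0 <= D -> cmeas `]0, T] (fun s => F s k) ->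
  (forall s, 0 < s <= T -> bb (- a) (F s) (D * s `^ (- ka))) ->
  cintegrable 0 t (fun s => heat_mult mu (- s) k * F s k).
Proof.
move=> /andP[t0 tT] T1 hka D0 mF hF.
have [C C0 hC] := heat_neg_bound k.
pose c := C * coefc (- a) k * D.
have c0 : 0 <= c by rewrite !mulr_ge0 ?coefc_ge0.
have mK : measurable_fun `]0, t[ (fun s : R => s `^ (- ka)) by exact: measurable_powRN.
apply: (@cintegrable_dominated _ t _ (fun s => c * s `^ (- ka)) (c * (t `^ (1 - ka) / (1 - ka)))).
- apply: cmeasM; first exact: cmeas_heat_neg.
  apply: cmeasS mF => //; move=> s /=; rewrite !in_itv /= => /andP[h1 h2].
  by apply/andP; split => //; lra.
- by apply: measurable_funM => //; exact: measurable_cst.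
- move=> s /andP[s0 st]; rewrite cmodM.
  have -> : c * s `^ (- ka) = C * (coefc (- a) k * (D * s `^ (- ka))) by rewrite /c; ring.
  apply: ler_pM; rewrite ?cmod_ge0//; first by apply: hC; lra.
  by apply: (bb_coef H); apply: hF; lra.
- rewrite (_ : (fun s => _) = (fun s : R => c%:E * (s `^ (- ka))%:E)%E); last first.
    by apply/funext => s; rewrite EFinM.
  rewrite ge0_integralZl//.
  + by rewrite [leRHS]EFinM; apply: lee_wpmul2l; rewrite ?lee_fin//; exact: integral_powRN.
  + exact/measurable_EFinP.
  + by move=> s _; rewrite lee_fin powR_ge0.
Qed.

(** The group law on single coefficients moves [t] out of the integrand. What remains is a
    primitive, whence continuity in [t]. *)
Lemma duhamelE F t k : cintegrable 0 t (fun s => heat_mult mu (- s) k * F s k) ->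
  cintegrable 0 t (fun s => heat_mult mu (t - s) k * F s k) /\
  duhamel F t k = heat_mult mu t k * cintegral 0 t (fun s => heat_mult mu (- s) k * F s k).
Proof.
move=> /(cintegralZ (heat_mult mu t k)); rewrite /duhamel.
rewrite (_ : (fun s => heat_mult mu t k * _) = (fun s => heat_mult mu (t - s) k * F s k))//.
by apply/funext => s; rewrite heat_multD mulrA.
Qed.

(** The product is a pointwise limit of truncations that are polynomial in finitely many
    coefficients. *)
Lemma cmeas_dmul D (f g : R -> distr R) (a b : R) : measurable D -> 0 < a < b ->
  (forall k, cmeas D (f ^~ k)) -> (forall k, cmeas D (g ^~ k)) ->
  (forall s, D s -> exists B, bb (- a) (f s) B) ->
  (forall s, D s -> exists B, bb b (g s) B) ->
  forall k, cmeas D (fun s => dmul (f s) (g s) k).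
Proof.
move=> mD hab mf mg hf hg k.
apply: (@cmeas_lim _ D (fun n s => dmul_trunc chi rho (f s) (g s) n k)).
  move=> n; apply: cmeas_sum => i; apply: cmeas_sum => j; apply: cmeas_sum => c.
  by apply: cmeasM; apply: cmeasM => //; exact: cmeas_cst.
move=> s Ds; have [B hB] := hf s Ds; have [B' hB'] := hg s Ds.
exact: dmul_trunc_cvg hab hB hB'.
Qed.

Lemma cmeas_Psi D lam nu (Y Z Z2 Za Zz : R -> distr R) (a b : R) : measurable D ->
  0 < a < b ->
  (forall k, cmeas D (Y ^~ k)) -> (forall k, cmeas D (Z ^~ k)) ->
  (forall k, cmeas D (Z2 ^~ k)) -> (forall k, cmeas D (Za ^~ k)) ->
  (forall k, cmeas D (Zz ^~ k)) ->
  (forall s, D s -> exists B, bb b (Y s) B) ->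
  (forall s, D s -> exists B, bb (- a) (Z s) B) ->
  (forall s, D s -> exists B, bb (- a) (Z2 s) B) ->
  (forall s, D s -> exists B, bb (- a) (Za s) B) ->
  forall k, cmeas D (fun s => Psi chi rho lam nu (Y s) (Z s) (Z2 s) (Za s) (Zz s) k).
Proof.
move=> mD hab mY mZ mZ2 mZa mZz hY hZ hZ2 hZa k; have /andP[a0 ab] := hab.
have b0 : 0 < b by lra.
have [Cs _ hs] := bb_dmul_smooth H b0.
have mc (f : R -> distr R) : (forall k, cmeas D (f ^~ k)) -> forall k, cmeas D (fun s => dconj (f s) k).
  by move=> mf k'; exact: cmeas_conj.
have hc (f : R -> distr R) r : (forall s, D s -> exists B, bb r (f s) B) ->
    forall s, D s -> exists B, bb r (dconj (f s)) B.
  by move=> hf s /hf [B hB]; exists B; exact: bb_dconj.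
have low (f : R -> distr R) : (forall s, D s -> exists B, bb b (f s) B) ->
    forall s, D s -> exists B, bb (- a) (f s) B.
  by move=> hf s /hf [B hB]; exists B; apply: bb_weaken hB; lra.
have hp (f g : R -> distr R) : (forall s, D s -> exists B, bb b (f s) B) ->
    (forall s, D s -> exists B, bb b (g s) B) ->
    forall s, D s -> exists B, bb b (dmul (f s) (g s)) B.
  move=> hf hg s Ds; have [B hB] := hf s Ds; have [B' hB'] := hg s Ds.
  by exists (Cs * B * B'); exact: hs.
have mYc := mc _ mY; have hYc := hc _ _ hY.
have mN := cmeas_dmul mD hab mY mYc (low _ hY) hYc.
have hN := hp _ _ hY hYc.
have mS := cmeas_dmul mD hab mY mY (low _ hY) hY.
have hS := hp _ _ hY hY.
have z c (f : R -> R[i]) : cmeas D f -> cmeas D (fun s => c * f s).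
  by apply: cmeasM; exact: cmeas_cst.
apply: cmeasD; first by apply: (z); exact: cmeasD.
apply: (z); apply: cmeasD; first exact: cmeas_dmul mD hab mN mY (low _ hN) hY k.
apply: cmeasD; first by apply: (z); exact: cmeas_dmul mD hab mZ mN hZ hN k.
apply: cmeasD; first exact: cmeas_dmul mD hab (mc _ mZ) mS (hc _ _ hZ) hS k.
apply: cmeasD; first by apply: (z); exact: cmeas_dmul mD hab mZa mY hZa hY k.
apply: cmeasD; first exact: cmeas_dmul mD hab mZ2 mYc hZ2 hYc k.
exact: mZz.
Qed.

Lemma cont_path_cmeas s (D : set R) (p : R -> distr R) k : open D ->
  cont_path chi rho s D p -> cmeas D (p ^~ k).
Proof.
move=> oD [_ hp].
have key : forall t, D t -> forall e : R, 0 < e -> \forall r \near t, cmod (p r k - p t k) < e.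
  move=> t Dt e e0.
  (* The constant passing from the Besov norm to the coefficient, increased by [1] to be positive
     and make the final inequality strict. *)
  pose c := coefc s k * 2 `^ s + 1.
  have c0 : 0 < c by rewrite ltr_wpDl// mulr_ge0 ?coefc_ge0 ?powR_ge0.
  have [del del0 hdel] := hp t Dt (e / c) ltac:(by rewrite divr_gt0).
  have := oD t Dt; rewrite -nbhs_nearE => hD.
  near=> r.
  have Dr : D r by near: r.
  have rt : `|r - t| < del.
    by rewrite distrC; near: r; exact: (@nbhsx_ballx _ _ t del del0).
  have := ltW (hdel r Dr rt) => /(besov_normP H) /(bb_coef H k).
  rewrite /dadd /dscale mulN1r => /le_lt_trans; apply.
  have -> : coefc s k * (e / c * 2 `^ s) = e * ((coefc s k * 2 `^ s) / c) by ring.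
  by rewrite gtr_pMr// ltr_pdivrMr// mul1r /c ltrDl.
split; apply: open_continuous_measurable_fun => // t /set_mem Dt;
  apply/cvgrPdist_lt => e e0; have := key t Dt e e0; apply: filterS => r;
  apply: le_lt_trans; rewrite distrC.
  by apply: le_trans (Re_le_cmod _); rewrite complexReD; case: (p t k).
by apply: le_trans (Im_le_cmod _); rewrite complexImD; case: (p t k).
Unshelve. all: by end_near. Qed.

End Duhamel.

(** * Path norms *)

Section PathNorms.
Variable R : realType.
Variables chi rho : R -> R -> R.
Hypothesis H : dyadic_partition chi rho.
Implicit Types (u v : distr R) (k : int * int).

Local Notation blk := (blk chi rho).
Local Notation bb := (bb chi rho).

Lemma geometric_small (q C e : R) : 0 <= q < 1 -> 0 < e ->
  exists N, forall n, (N <= n)%N -> C * q ^+ n <= e.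
Proof.
move=> /andP[q0 q1] e0.
have h : (fun n => C * q ^+ n) @ \oo --> C * 0.
  by apply: cvgM; [exact: cvg_cst|apply: cvg_expr; rewrite ger0_norm].
rewrite mulr0 in h; have [N _ hN] := cvgr_le _ h _ e0.
by exists N.
Qed.

Lemma bb_eq0 s u : (forall e, 0 < e -> bb s u e) -> forall k, u k = 0.
Proof.
move=> h k; apply: cmod_eq0; apply/eqP; rewrite eq_le cmod_ge0 andbT.
apply/ler_addgt0Pr => e e0; rewrite add0r.
have c0 : 0 < coefc s k + 1 by rewrite ltr_wpDl ?coefc_ge0.
apply: le_trans (bb_coef H k (h (e / (coefc s k + 1)) _)) _; first by rewrite divr_gt0.
by rewrite mulrCA ger_pMr// ler_pdivrMr// mul1r lerDl.
Qed.

Lemma besov_weight_bb s u (p t M : R) : 0 < t ->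
  ((t `^ p)%:E * besov_norm chi rho s u <= M%:E)%E ->
  bb s u (M * t `^ (- p) * 2 `^ s).
Proof.
move=> t0 h; apply/(besov_normP H).
by rewrite mulrC powRN EFinM lee_pdivlMl// powR_gt0.
Qed.

Lemma powRN_mono (t p q : R) : 0 < t <= 1 -> p <= q -> t `^ (- p) <= t `^ (- q).
Proof. by move=> ht pq; apply: ger_powR => //; rewrite lerN2. Qed.

Lemma powRN_ge1 (t p : R) : 0 < t <= 1 -> 0 <= p -> 1 <= t `^ (- p).
Proof. by move=> ht p0; rewrite -[leLHS](powRr0 t) ger_powR// oppr_le0. Qed.

(** The first component carries no weight in [Znorm]; giving it the factor [t^-a >= 1] as well
    yields a common bound for all four. *)
Lemma Znorm_bb (a t K : R) (Zq : quad R) : 0 < t <= 1 -> 0 <= a ->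
  (Znorm chi rho a Zq t <= K%:E)%E ->
  [/\ bb (- a) (qZ Zq t) (K * t `^ (- a)), bb (- a) (qZ2 Zq t) (K * t `^ (- a)),
      bb (- a) (qZabs2 Zq t) (K * t `^ (- a)) & bb (- a) (qZabs2Z Zq t) (K * t `^ (- a))].
Proof.
move=> ht a0; have /andP[t0 t1] := ht; rewrite /Znorm !ge_max.
move=> /andP[h1 /andP[h2 /andP[h3 h4]]].
have t2 : 2 `^ (- a) <= 1 :> R by rewrite -[leRHS](powRr0 2) ler_powR ?ler1n// oppr_le0.
have shrink u B : 0 <= B -> bb (- a) u (B * 2 `^ (- a)) -> bb (- a) u B.
  by move=> B0; apply: bb_le; rewrite ler_piMr.
have K0 : 0 <= K.
  by rewrite -lee_fin; apply: le_trans h1; exact: besov_norm_ge0.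
have KT : 0 <= K * t `^ (- a) by rewrite mulr_ge0 ?powR_ge0.
split; last 3 first.
- exact: (shrink _ _ KT (besov_weight_bb t0 h2)).
- exact: (shrink _ _ KT (besov_weight_bb t0 h3)).
- exact: (shrink _ _ KT (besov_weight_bb t0 h4)).
apply: (shrink _ _ KT); apply: bb_le (_ : K * 2 `^ (- a) <= _) _; last exact/(besov_normP H).
by rewrite ler_wpM2r ?powR_ge0// ler_peMr// powRN_ge1.
Qed.

Lemma uniform_near (s : seq (int * int)) (p : R -> distr R) (D : set R) (t e : R) :
  (forall k, exists2 del : R, 0 < del &
     forall r, D r -> `|r - t| < del -> cmod (p r k - p t k) <= e) ->
  exists2 del : R, 0 < del &
     forall r, D r -> `|r - t| < del -> forall k, k \in s -> cmod (p r k - p t k) <= e.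
Proof.
move=> h; elim: s => [|k s [d1 d10 h1]]; first by exists 1.
have [d2 d20 h2] := h k; exists (Num.min d1 d2); first by rewrite lt_min d10.
move=> r Dr; rewrite lt_min => /andP[r1 r2] j; rewrite inE => /predU1P[->|].
  exact: h2.
exact: h1.
Qed.

(* High blocks are small by the bound in the better space, low blocks depend on
   finitely many coefficients. *)
Lemma cont_path_of_coef (a b gam M T : R) (p : R -> distr R) : a < b -> 0 <= gam ->
  (forall t, 0 < t <= T -> forall k (e : R), 0 < e -> exists2 del : R, 0 < del &
     forall r, 0 < r <= T -> `|r - t| < del -> cmod (p r k - p t k) <= e) ->
  (forall t, 0 < t <= T -> bb b (p t) (M * t `^ (- gam))) ->
  cont_path chi rho a `]0, T] p.
Proof.
move=> ab gam0 hc hb; split=> t /=; rewrite in_itv /= => ht.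
  rewrite /holder /=; apply: le_lt_trans (ltry ((M * t `^ (- gam)) / 2 `^ a)).
  apply/(besov_normP H); rewrite divfK ?gt_eqF ?powR_gt0//.
  by apply: bb_weaken (hb t ht); exact: ltW.
move=> eps eps0; have /andP[t0 tT] := ht.
have M0 : 0 <= M by have := bb_ge0 (hb t ht); rewrite pmulr_lge0 ?powR_gt0.
(* Restricting to [r >= t / 2] makes the blow-up weight uniform near [t]. *)
pose M' := M * (t / 2) `^ (- gam).
have M'0 : 0 <= M' by rewrite mulr_ge0 ?powR_ge0.
pose e : R := eps / 2 * 2 `^ a.
have e0 : 0 < e by rewrite mulr_gt0 ?powR_gt0// divr_gt0.
have hq : 0 <= dy (b - a) 1 < 1.
  have /andP[q0 q1] : 0 < dy (b - a) 1 < 1 by apply: dy_lt1; lra.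
  by rewrite q1 ltW.
have [N0 hN0] := geometric_small (M' + M') hq e0.
pose S := size (zbox (2 ^ N0.+1)).
(* A lower bound for [dy a n] over all low blocks [n < N0], whatever the sign of [a]: [dy a]
   decreases for [a >= 0] and is at least [1] otherwise. *)
pose m := Num.min 1 (dy a N0).
have m0 : 0 < m by rewrite lt_min dy_gt0 ltr01.
pose eta := e * m / S.+1%:R.
have eta0 : 0 < eta by rewrite divr_gt0 ?mulr_gt0.
have [del del0 hdel] := uniform_near (zbox (2 ^ N0.+1)) (fun k => hc t ht k eta eta0).
exists (Num.min del (t / 2)); first by rewrite lt_min del0 divr_gt0.
move=> r /=; rewrite in_itv /= lt_min => hr /andP[r1 r2].
apply: (@le_lt_trans _ _ (eps / 2)%:E); last by rewrite lte_fin; lra.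
apply/(besov_normP H); rewrite -/e.
have E : dadd (p r) (dscale (-1) (p t)) = dsub (p r) (p t).
  by apply/funext => k; rewrite /dadd /dscale /dsub mulN1r.
rewrite E => n.
have hM s : t / 2 <= s -> 0 < s <= T -> bb b (p s) M'.
  move=> hs1 hs2; apply: bb_le (hb s hs2); rewrite ler_wpM2l// !powRN.
  rewrite lef_pV2 ?posrE ?powR_gt0//; try lra.
  by apply: ge0_ler_powR; rewrite ?nnegrE; lra.
have hr2 : t / 2 <= r by move: r2; rewrite ltr_norml; lra.
have hd := bbB (hM r hr2 hr) (hM t ltac:(lra) ht).
have [nN|nN] := leqP N0 n.
  apply: linf_le (hd n).
  have -> : dy b n = dy (b - a) 1 ^+ n * dy a n.
    by rewrite -dy_exp dyD subrK.
  by rewrite mulrA ler_wpM2r ?dy_ge0// hN0.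
have := linf_sum_coef (@blk_suppin _ _ _ H n (dsub (p r) (p t))).
apply: linf_le; apply: (@le_trans _ _ (\sum_(k <- zbox (2 ^ n.+1)) eta)).
  rewrite big_seq [leRHS]big_seq; apply: ler_sum => k hk.
  have kN : k \in zbox (2 ^ N0.+1).
    have : (2 ^ n.+1 <= 2 ^ N0.+1)%N by rewrite leq_exp2l// ltnW.
    move: hk; rewrite !mem_zbox => /andP[k1 k2] h.
    by rewrite (leq_trans k1 h) (leq_trans k2 h).
  apply: le_trans (hdel r hr r1 k kN); rewrite cmodM cmodR.
  have /andP[w0 w1] := wt_bound H n k.
  by rewrite ger0_norm// ler_piMl ?cmod_ge0.
rewrite big_const_seq count_predT iter_addr_0 -[leLHS]mulr_natl.
have sz : (size (zbox (2 ^ n.+1)) <= S)%N.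
  rewrite /S !size_allpairs /zr !size_map !size_iota.
  by apply: leq_mul; rewrite ltnS leq_mul2l leq_exp2l// ltnW.
apply: (@le_trans _ _ (S.+1%:R * eta)).
  by rewrite ler_wpM2r ?(ltW eta0)// ler_nat ltnW.
rewrite /eta mulrC divfK ?pnatr_eq0// ler_wpM2l ?(ltW e0)// /m.
have [a0|a0] := leP 0 a.
  apply: le_trans (_ : dy a N0 <= _); first by rewrite ge_min lexx orbT.
  by rewrite /dy ler_powR ?ler1n// lerN2 ler_wpM2l// ler_nat ltnW.
apply: le_trans (_ : 1 <= _); first by rewrite ge_min lexx.
rewrite -[leLHS](powRr0 2) /dy ler_powR ?ler1n// oppr_ge0 mulr_le0_ge0// ltW//.
Qed.

Lemma expRN_le_powRN (x p : R) : 0 < x -> 0 <= p <= 1 -> expR (- x) <= x `^ (- p).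
Proof.
move=> x0 hp; apply: le_trans (invD1_powR x0 hp).
by rewrite expRN lef_pV2 ?posrE ?expR_gt0 ?expR_ge1Dx//; lra.
Qed.

(** The mixed terms carry [s^-(a + 2 gam)], which for [s <= 1] and [a <= gam] is dominated by the
    weight [s^-(3 gam)] of the cubic term. *)
Lemma cubic_weight (s a gam M K : R) : 0 < s <= 1 -> a <= gam -> 0 <= M -> 0 <= K ->
  ((M * s `^ (- gam)) ^+ 2 + K * s `^ (- a) * (M * s `^ (- gam))) * s `^ (- gam) <=
  (M ^+ 2 + K * M) * s `^ (- (3 * gam)).
Proof.
move=> hs ag M0 K0; set P := s `^ (- gam).
have P0 : 0 <= P by exact: powR_ge0.
have -> : s `^ (- (3 * gam)) = P ^+ 2 * P.
  by rewrite -exprSr /P -powR_mulrn ?powR_ge0// -powRrM; congr (_ `^ _); ring.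
rewrite [leRHS]mulrA ler_wpM2r// [leRHS]mulrDl exprMn lerD2l.
have -> : K * M * P ^+ 2 = K * P * (M * P) by ring.
by rewrite ler_wpM2r ?mulr_ge0// ler_wpM2l// powRN_mono.
Qed.

(** [expRN_le_powRN] at [be * (t - s)]: the gap between the weights at [s] and [t] buys the small
    factor [be^-p] for an extra singularity [(t - s)^-p]. *)
Lemma exp_weight (be s t p : R) : 0 < be -> s < t -> 0 <= p <= 1 ->
  expR (be * s) <= expR (be * t) * (be `^ (- p) * (t - s) `^ (- p)).
Proof.
move=> be0 st hp; have ts0 : 0 < t - s by rewrite subr_gt0.
have -> : be * s = be * t + - (be * (t - s)) by ring.
rewrite expRD ler_wpM2l ?expR_ge0// -powRM ?(ltW be0) ?(ltW ts0)//.
by apply: expRN_le_powRN => //; exact: mulr_gt0.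
Qed.

End PathNorms.

(** * Uniqueness *)

Section Uniqueness.
Variable R : realType.
Variables chi rho : R -> R -> R.
Hypothesis H : dyadic_partition chi rho.
Variable mu : R.
Hypothesis mu_gt0 : 0 < mu.
Variables (lam : R) (nu : R[i]).
Implicit Types (k : int * int).

Local Notation bb := (bb chi rho).
Local Notation sol := (is_solution chi rho mu lam nu).

Lemma cintegralB a b (f g : R -> R[i]) : cintegrable a b f -> cintegrable a b g ->
  cintegrable a b (fun s => f s - g s) /\
  cintegral a b (fun s => f s - g s) = cintegral a b f - cintegral a b g.
Proof.
move=> hf hg; have [h1 h2] := cintegralZ (-1) hg.
have := cintegralD hf h1; rewrite h2 mulN1r.
rewrite (_ : (fun s => f s + -1 * g s) = fun s => f s - g s)//.
by apply/funext => s; rewrite mulN1r.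
Qed.

(** Lowering the regularity and, since [T <= 1], raising the power of [t] both weaken the norm; this
    brings two solutions to common exponents. *)
Lemma solution_bb (b gam a1 g1 M T t : R) (Y : R -> distr R) : T <= 1 -> b <= a1 -> g1 <= gam ->
  (forall t, t \in `]0, T] -> ((t `^ g1)%:E * besov_norm chi rho a1 (Y t) <= M%:E)%E) ->
  0 < t <= T -> bb b (Y t) (`|M| * 2 `^ a1 * t `^ (- gam)).
Proof.
move=> T1 ba gg h /andP[t0 tT].
have := besov_weight_bb H t0 (h t ltac:(by rewrite in_itv /= t0)).
move=> hY; apply: bb_le (bb_weaken ba hY).
rewrite [leRHS]mulrAC ler_wpM2r ?powR_ge0//.
apply: le_trans (_ : `|M| * t `^ (- g1) <= _).
  by rewrite ler_wpM2r ?powR_ge0// ler_norm.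
by rewrite ler_wpM2l// powRN_mono//; lra.
Qed.

Lemma duhamel_sub (F G : R -> distr R) t :
  (forall k, cintegrable 0 t (fun s => heat_mult mu (t - s) k * F s k)) ->
  (forall k, cintegrable 0 t (fun s => heat_mult mu (t - s) k * G s k)) ->
  (forall k, cintegrable 0 t (fun s => heat_mult mu (t - s) k * dsub (F s) (G s) k)) /\
  duhamel mu (fun s => dsub (F s) (G s)) t = dsub (duhamel mu F t) (duhamel mu G t).
Proof.
move=> hF hG.
have E k : (fun s => heat_mult mu (t - s) k * dsub (F s) (G s) k) =
   (fun s => heat_mult mu (t - s) k * F s k - heat_mult mu (t - s) k * G s k).
  by apply/funext => s; rewrite /dsub mulrBr.
split=> [k|]; first by rewrite E; exact: (cintegralB (hF k) (hG k)).1.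
by apply/funext => k; rewrite /duhamel E; exact: (cintegralB (hF k) (hG k)).2.
Qed.

(* The exponential weight makes the singular Gronwall step a contraction on the
   whole interval at once: [exp (- be u) <= (be u)^-(1/12)]. *)
Lemma solution_unique (T : R) (Y0 : distr R) (Zq : quad R) (Y1 Y2 : R -> distr R) :
  0 < T <= 1 -> in_calZ chi rho Zq -> sol T Y0 Zq Y1 -> sol T Y0 Zq Y2 ->
  forall t, t \in `]0, T] -> Y1 t = Y2 t.
Proof.
move=> /andP[T0 T1] hZ [[a1 [g1 [a10 /andP[g10 g11] _ [M1 hM1]]]] e1].
move=> [[a2 [g2 [a20 /andP[g20 g21] _ [M2 hM2]]]] e2].
(* With [a = b / 2], [b <= 1 / 4] gives [th <= 3 / 16], so [th + 1 / 12 + 2 * gam <= 1] and room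
   remains for the extra singularity. *)
have [b [b0 b4 ba1 ba2]] : exists b, [/\ 0 < b, b <= 1 / 4, b <= a1 & b <= a2].
  exists (Num.min (Num.min a1 a2) (1 / 4)).
  by split; rewrite ?lt_min ?ge_min ?a10 ?a20 ?lexx ?orbT//=; lra.
(* Raising [gam] to at least [1 / 4] secures [a <= gam], needed by [cubic_weight], and keeps it
   below [1 / 3]. *)
have [gam [gam3 gg1 gg2 gam4]] :
    exists gam, [/\ gam < 1 / 3, g1 <= gam, g2 <= gam & 1 / 4 <= gam].
  exists (Num.max (Num.max g1 g2) (1 / 4)).
  split; rewrite ?gt_max ?le_max ?lexx ?orbT//.
  by apply/andP; split; [apply/andP; split|]; lra.
have [a aE] : exists a, a = b / 2 by exists (b / 2).
have hab : 0 < a < b by lra.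
have a0 : 0 < a by case/andP: hab.
have [_ _ _ _ /(_ T T0) [KZ hKZ]] := hZ a a0.
have [C1 C10 lip] := Psi_lipschitz H lam nu hab.
pose th := (b + a) / 2.
have hth : 0 <= th <= 1 by rewrite /th; lra.
have hth' : 0 <= th + 1 / 12 < 1 by rewrite /th; lra.
have hka : 0 <= 3 * gam < 1 by lra.
have [C2 C20] := bb_duhamel H mu_gt0 hth hth' hka; rewrite -/th => duh.
have agam : a <= gam by lra.
have gam0 : 0 <= gam by lra.
have p12 : 0 <= (1 / 12 : R) <= 1 by lra.
have ts0 (s t : R) : s < t -> 0 < t - s by rewrite subr_gt0.
have expo : - gam <= 1 - (th + 1 / 12) - 3 * gam by rewrite /th; lra.
clearbody th.
pose M := `|M1| * 2 `^ a1 + `|M2| * 2 `^ a2 + 1.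
have P1 : 0 <= `|M1| * 2 `^ a1 by rewrite mulr_ge0 ?powR_ge0.
have P2 : 0 <= `|M2| * 2 `^ a2 by rewrite mulr_ge0 ?powR_ge0.
have M1' : 1 <= M by rewrite /M; lra.
have M0 : 0 <= M := le_trans ler01 M1'.
have hY1 t : 0 < t <= T -> bb b (Y1 t) (M * t `^ (- gam)).
  move=> ht; apply: bb_le (solution_bb T1 ba1 gg1 hM1 ht).
  by rewrite ler_wpM2r ?powR_ge0// /M; lra.
have hY2 t : 0 < t <= T -> bb b (Y2 t) (M * t `^ (- gam)).
  move=> ht; apply: bb_le (solution_bb T1 ba2 gg2 hM2 ht).
  by rewrite ler_wpM2r ?powR_ge0// /M; lra.
have KZ0 : 0 <= KZ.
  have := hKZ T ltac:(by rewrite in_itv /= T0 lexx).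
  by rewrite /Znorm !ge_max => /andP[+ _]; rewrite -lee_fin; apply: le_trans; exact: besov_norm_ge0.
pose Q := C2 * (C1 * (M ^+ 2 + KZ * M)).
have L0 : 0 <= C1 * (M ^+ 2 + KZ * M).
  by rewrite mulr_ge0 ?addr_ge0 ?exprn_ge0 ?mulr_ge0.
have Q0 : 0 <= Q by rewrite mulr_ge0.
have QE : Q = C2 * (C1 * (M ^+ 2 + KZ * M)) by [].
clearbody Q M.
have q1 : 0 < 2 * Q + 1 by lra.
(* Chosen so that [be^-(1 / 12) = 1 / (2 Q + 1)], which makes the factor [Q / (2 Q + 1)] at most
   [1 / 2]. *)
pose be := (2 * Q + 1) ^+ 12.
have be0 : 0 < be by rewrite exprn_gt0.
have beE : be `^ (- (1 / 12)) = (2 * Q + 1)^-1.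
  rewrite /be -powR_mulrn ?(ltW q1)// -powRrM (_ : 12 * - (1 / 12) = -1 :> R); last by field.
  by rewrite powR_inv1// ltW.
clearbody be.
pose w t := expR (be * t) * t `^ (- gam).
have w0 t : 0 <= w t by rewrite mulr_ge0 ?expR_ge0 ?powR_ge0.
pose F s := dsub (PsiQ chi rho lam nu (Y1 s) Zq s) (PsiQ chi rho lam nu (Y2 s) Zq s).
(* The a priori bounds on both solutions give one finite [A]; halving it indefinitely forces the
   difference to vanish, without forming the weighted supremum. *)
have step A : 0 <= A -> (forall t, 0 < t <= T -> bb b (dsub (Y1 t) (Y2 t)) (A * w t)) ->
    forall t, 0 < t <= T -> bb b (dsub (Y1 t) (Y2 t)) (A / 2 * w t).
  move=> A0 hA t ht; have /andP[t0 tT] := ht.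
  have tI : t \in `]0, T] by rewrite in_itv /= t0.
  have c1 k := (e1 t tI k).1; have c2 k := (e2 t tI k).1.
  have [cF dF] := duhamel_sub c1 c2.
  have -> : dsub (Y1 t) (Y2 t) = duhamel mu F t.
    rewrite dF; apply/funext => k; rewrite /dsub (e1 t tI k).2 (e2 t tI k).2 /duhamel.
    by rewrite opprD addrACA subrr add0r.
  pose D := C1 * (M ^+ 2 + KZ * M) * A * expR (be * t) * (2 * Q + 1)^-1.
  have D0 : 0 <= D by rewrite !mulr_ge0 ?expR_ge0 ?invr_ge0 ?(ltW q1)// addr_ge0 ?mulr_ge0 ?exprn_ge0.
  pose g s := C1 * ((M * s `^ (- gam)) ^+ 2 + KZ * s `^ (- a) * (M * s `^ (- gam))) * (A * w s).
  have t1 : 0 < t <= 1 by rewrite t0 (le_trans tT T1).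
  have := duh F t D g t1 D0 cF.
  have hg s : 0 < s < t -> bb (- a) (F s) (g s) /\
       (t - s) `^ (- th) * g s <= D * ((t - s) `^ (- (th + 1 / 12)) * s `^ (- (3 * gam))).
    move=> /andP[s0 st].
    have s1 : 0 < s <= 1 by rewrite s0 (ltW (lt_le_trans st (le_trans tT T1))).
    have sT : 0 < s <= T by rewrite s0 (ltW (lt_le_trans st tT)).
    have [z1 z2 z3 z4] := Znorm_bb H s1 (ltW a0) (hKZ s sT).
    have y1 : 1 <= M * s `^ (- gam).
      rewrite -[leLHS]mulr1; apply: ler_pM => //.
      exact: powRN_ge1.
    split; first exact: (lip _ _ _ _ _ _ _ _ _ y1 (hY1 s sT) (hY2 s sT) (hA s sT) z1 z2 z3).
    have hc := cubic_weight s1 agam M0 KZ0.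
    have he := exp_weight be0 st p12; rewrite beE in he.
    rewrite (_ : - (th + 1 / 12) = - th + - (1 / 12)); last by rewrite opprD.
    rewrite powRD ?(gt_eqF (ts0 _ _ st)) ?implybT//.
    have -> : (t - s) `^ (- th) * g s = (t - s) `^ (- th) * (C1 * A * (expR (be * s) *
       (((M * s `^ (- gam)) ^+ 2 + KZ * s `^ (- a) * (M * s `^ (- gam))) * s `^ (- gam)))).
      by rewrite /g /w; ring.
    apply: (@le_trans _ _ ((t - s) `^ (- th) * (C1 * A *
       ((expR (be * t) * ((2 * Q + 1)^-1 * (t - s) `^ (- (1 / 12)))) *
       ((M ^+ 2 + KZ * M) * s `^ (- (3 * gam))))))).
      rewrite ler_wpM2l ?powR_ge0// ler_wpM2l ?mulr_ge0//.
      apply: ler_pM => //.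
      by rewrite mulr_ge0 ?powR_ge0// addr_ge0 ?exprn_ge0 ?mulr_ge0 ?powR_ge0.
    by apply: eqr_le; rewrite /D; ring.
  move=> /(_ hg); apply: bb_le.
  have tt : t `^ (1 - (th + 1 / 12) - 3 * gam) <= t `^ (- gam).
    exact: ger_powR.
  have E : C2 * D = Q / (2 * Q + 1) * (A * expR (be * t)) by rewrite /D QE; ring.
  rewrite E /w; apply: (@le_trans _ _ (Q / (2 * Q + 1) * (A * expR (be * t)) * t `^ (- gam))).
    by rewrite ler_wpM2l// !mulr_ge0 ?expR_ge0 ?invr_ge0// ltW.
  have -> : A / 2 * (expR (be * t) * t `^ (- gam)) = 2^-1 * (A * expR (be * t)) * t `^ (- gam) by ring.
  rewrite ler_wpM2r ?powR_ge0// ler_wpM2r ?mulr_ge0 ?expR_ge0//.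
  by rewrite ler_pdivrMr// mulrDr mulr1 mulKf ?pnatr_eq0// lerDl invr_ge0.
have base t : 0 < t <= T -> bb b (dsub (Y1 t) (Y2 t)) (2 * M * w t).
  move=> ht; apply: bb_le (bbB (hY1 t ht) (hY2 t ht)).
  rewrite -mulrDl -mulr2n -[M *+ 2]mulr_natl -mulrA -mulrA ler_wpM2l// ler_wpM2l//.
  rewrite /w ler_peMl ?powR_ge0// -[leLHS]expR0 ler_expR mulr_ge0 ?(ltW be0)//.
  by case/andP: ht => /ltW.
have iter n t : 0 < t <= T -> bb b (dsub (Y1 t) (Y2 t)) (2 * M * 2^-1 ^+ n * w t).
  elim: n t => [|n ih] t ht; first by rewrite expr0 mulr1; exact: base.
  have -> : 2 * M * 2^-1 ^+ n.+1 = 2 * M * 2^-1 ^+ n / 2 by rewrite exprSr mulrA.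
  apply: (step _ _ ih) => //.
  by rewrite !mulr_ge0 ?exprn_ge0 ?invr_ge0.
move=> t; rewrite in_itv /= => ht; apply/funext => k; apply/eqP; rewrite -subr_eq0; apply/eqP.
apply: (@bb_eq0 _ _ _ H b (dsub (Y1 t) (Y2 t))) => e e0.
have half : 0 <= (2^-1 : R) < 1 by rewrite invr_ge0 ler0n invf_lt1// ltr1n.
have [n hn] := geometric_small (2 * M * w t) half e0.
by apply: bb_le (iter n t ht); rewrite mulrAC; exact: hn.
Qed.

End Uniqueness.

(** * Existence *)

Section Existence.
Variable R : realType.
Variables chi rho : R -> R -> R.
Hypothesis H : dyadic_partition chi rho.
Variable mu : R.
Variables (lam : R) (nu : R[i]).
Implicit Types (k : int * int).

Local Notation bb := (bb chi rho).
Local Notation PsiQ := (PsiQ chi rho lam nu).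

(** At [Y = 0] all products are bounded by [0], leaving the linear term and [|Z|^2 Z]. Together with
    [Psi_lipschitz] this bounds [Psi] itself. *)
Lemma Psi_zero (a b : R) (Z Z2 Za Zz : distr R) (W : R) : 0 < a < b ->
  bb (- a) Z W -> bb (- a) Z2 W -> bb (- a) Za W -> bb (- a) Zz W ->
  bb (- a) (Psi chi rho lam nu (fun=> 0) Z Z2 Za Zz)
    ((cmod ((1 + lam)%:C : R[i]) + cmod (- nu)) * W).
Proof.
move=> hab hZ hZ2 hZa hZz; have /andP[a0 ab] := hab; have b0 : 0 < b by lra.
have [Cr Cr0 hr] := bb_dmul_rough H hab.
have [Cs Cs0 hs] := bb_dmul_smooth H b0.
have z s : bb s (fun=> 0) 0 := bb0 chi rho s.
have zc s : bb s (dconj (fun=> 0)) 0 := bb_dconj H (z s).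
have N := hs _ _ _ _ (z b) (zc b); have S := hs _ _ _ _ (z b) (z b).
have N' : bb (- a) (dmul chi rho (fun=> 0) (dconj (fun=> 0))) (Cs * 0 * 0).
  by apply: bb_weaken N; lra.
have := bbD (bbZ (1 + lam)%:C (bbD hZ (z _))) (bbZ (- nu) (bbD (hr _ _ _ _ N' (z b)) (bbD
  (bbZ 2%:C (hr _ _ _ _ hZ N)) (bbD (hr _ _ _ _ (bb_dconj H hZ) S)
  (bbD (bbZ 2%:C (hr _ _ _ _ hZa (z b))) (bbD (hr _ _ _ _ hZ2 (zc b)) hZz)))))).
by apply: bb_le; apply: eqr_le; ring.
Qed.

(** * Picard iteration under abstract self-map and contraction bounds *)

Section Picard.
Variables (a b gam T M B : R) (Y0 : distr R) (Zq : quad R).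
Hypothesis hab : 0 < a < b.
Hypothesis gam_bound : 0 <= gam < 1 / 3.
Hypothesis hT : 0 < T <= 1.
Hypothesis M_ge0 : 0 <= M.
Hypothesis hZ : in_calZ chi rho Zq.

Definition picard (Y : R -> distr R) (t : R) : distr R :=
  dadd (semigroup mu t Y0) (duhamel mu (fun s => PsiQ (Y s) Zq s) t).

(** Measurability of coefficients is what the Duhamel integral requires and, unlike continuity, it
    survives pointwise limits; continuity is recovered for the fixed point afterwards. *)
Definition picard_dom (Y : R -> distr R) :=
  (forall k, cmeas `]0, T] (fun t => Y t k)) /\
  (forall t, 0 < t <= T -> bb b (Y t) (M * t `^ (- gam))).

Hypothesis B_ge0 : 0 <= B.
Hypothesis PsiB : forall Y, picard_dom Y ->
  forall s, 0 < s <= T -> bb (- a) (PsiQ (Y s) Zq s) (B * s `^ (- (3 * gam))).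
Hypothesis ZB : forall s, 0 < s <= T -> exists W, [/\ bb (- a) (qZ Zq s) W,
  bb (- a) (qZ2 Zq s) W & bb (- a) (qZabs2 Zq s) W].

Lemma in_oc t : `]0, T]%classic t = (0 < t <= T) :> Prop.
Proof. by rewrite /= in_itv. Qed.

Lemma cmeas_PsiQ Y k : picard_dom Y -> cmeas `]0, T] (fun s => PsiQ (Y s) Zq s k).
Proof.
move=> [mY hY].
have sub : `]0, T]%classic `<=` `]0, +oo[%classic.
  by move=> s; rewrite in_oc /= in_itv /= => /andP[-> _].
have [a0 _] := andP hab.
have [_ cZ2 cZa cZz _] := hZ a0; have [cZ _ _ _ _] := hZ a0.
have mo : open (`](0 : R), +oo[%classic) by exact: interval_open.
have cZ' : cont_path chi rho (- a) `]0, +oo[ (qZ Zq).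
  have s0 t : `]0, +oo[%classic t -> `[0, +oo[%classic t.
    by rewrite /= !in_itv /= !andbT => /ltW.
  split=> [t /s0|t /s0 t0 e e0]; first exact: cZ.1.
  have [d d0 hd] := cZ.2 t t0 e e0; exists d => // r /s0; exact: hd.
have m p : cont_path chi rho (- a) `]0, +oo[ p -> forall k, cmeas `]0, T] (p ^~ k).
  move=> cp k'; apply: cmeasS sub _; first exact: open_measurable.
  exact: cont_path_cmeas cp.
apply: (cmeas_Psi H _ _ (measurable_itv _) hab mY (m _ cZ') (m _ cZ2) (m _ cZa) (m _ cZz)).
- by move=> s; rewrite in_oc => hs; exists (M * s `^ (- gam)); exact: hY.
- by move=> s; rewrite in_oc => /ZB [W []]; exists W.
- by move=> s; rewrite in_oc => /ZB [W []]; exists W.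
- by move=> s; rewrite in_oc => /ZB [W []]; exists W.
Qed.

Lemma picard_integrable Y t k : picard_dom Y -> 0 < t <= T ->
  cintegrable 0 t (fun s => heat_mult mu (- s) k * PsiQ (Y s) Zq s k).
Proof.
move=> hY ht; have /andP[T0 T1] := hT.
apply: (cintegrable_heat_neg H mu ht T1 _ B_ge0 (cmeas_PsiQ k hY) (PsiB hY)).
by have := gam_bound; lra.
Qed.

(** By [duhamelE] each coefficient is a heat factor times a constant plus a primitive, hence
    continuous even though [Y] is only measurable. *)
Lemma picard_coefE Y k : picard_dom Y -> exists2 p, ccont `[0, T] p &
  forall t, 0 < t <= T -> picard Y t k = p t.
Proof.
move=> hY; have /andP[T0 T1] := hT.
exists (fun t => heat_mult mu t k * (Y0 k +
   cintegral 0 t (fun s => heat_mult mu (- s) k * PsiQ (Y s) Zq s k))).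
  apply: ccontM; first exact: heat_continuous.
  apply: ccontD; first exact: ccont_cst.
  by apply: ccont_cintegral; [exact: ltW|apply: picard_integrable; rewrite ?T0/=].
move=> t ht; rewrite /picard /dadd /semigroup mulrDr.
by rewrite (duhamelE (picard_integrable k hY ht)).2.
Qed.

Lemma picard_cmeas Y k : picard_dom Y -> cmeas `]0, T] (fun t => picard Y t k).
Proof.
move=> hY; have [p cp hp] := picard_coefE k hY.
have sub : `]0, T]%classic `<=` `[0, T]%classic.
  by move=> s; rewrite /= !in_itv /= => /andP[/ltW -> ->].
have [m1 m2] := cmeasS (measurable_itv _) sub (ccont_cmeas (measurable_itv _) cp).
split; [apply: eq_measurable_fun m1|apply: eq_measurable_fun m2] => t /set_mem;
  by rewrite in_oc => ht; rewrite hp.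
Qed.

Hypothesis picard_self : forall Y, picard_dom Y ->
  forall t, 0 < t <= T -> bb b (picard Y t) (M * t `^ (- gam)).
Hypothesis picard_contract : forall Y Y' d, picard_dom Y -> picard_dom Y' -> 0 <= d ->
  (forall t, 0 < t <= T -> bb b (dsub (Y t) (Y' t)) (d * t `^ (- gam))) ->
  forall t, 0 < t <= T -> bb b (dsub (picard Y t) (picard Y' t)) (d / 2 * t `^ (- gam)).

Definition picard_iter n : R -> distr R := iter n picard (fun _ _ => 0).

Lemma picard_iter_dom n : picard_dom (picard_iter n).
Proof.
elim: n => [|n ih]; last by split; [move=> k; exact: picard_cmeas|exact: picard_self].
split=> [k|t ht]; first exact: cmeas_cst.
by apply: bb_le (bb0 chi rho b); rewrite mulr_ge0 ?powR_ge0.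
Qed.

Lemma picard_iter_step n t : 0 < t <= T ->
  bb b (dsub (picard_iter n.+1 t) (picard_iter n t)) (M * 2^-1 ^+ n * t `^ (- gam)).
Proof.
elim: n t => [|n ih] t ht.
  rewrite expr0 mulr1; have := (picard_iter_dom 1).2 t ht; rewrite /picard_iter /=.
  by congr (bb b _ _); apply/funext => k; rewrite /dsub subr0.
have -> : M * 2^-1 ^+ n.+1 = M * 2^-1 ^+ n / 2 by rewrite exprSr mulrA.
apply: (picard_contract (picard_iter_dom n.+1) (picard_iter_dom n)) => //.
by rewrite mulr_ge0 ?exprn_ge0 ?invr_ge0.
Qed.

Lemma picard_iter_dist n m t : 0 < t <= T ->
  bb b (dsub (picard_iter (m + n) t) (picard_iter n t)) (2 * M * 2^-1 ^+ n * t `^ (- gam)).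
Proof.
move=> ht; set P := t `^ (- gam); have P0 : 0 <= P by exact: powR_ge0.
have Q0 j : 0 <= 2^-1 ^+ j :> R by rewrite exprn_ge0 ?invr_ge0.
(* The exact partial geometric sum is kept, so that the induction on [m] closes with equality. *)
suff h : bb b (dsub (picard_iter (m + n) t) (picard_iter n t))
    (2 * M * (2^-1 ^+ n - 2^-1 ^+ (m + n)) * P).
  apply: bb_le h; rewrite ler_wpM2r// ler_wpM2l ?mulr_ge0//.
  by rewrite gerBl.
elim: m => [|m ih].
  rewrite add0n subrr mulr0 mul0r; have := bb0 chi rho b.
  by congr (bb b _ _); apply/funext => k; rewrite /dsub subrr.
have := bbD (picard_iter_step (m + n) ht) ih.
rewrite (_ : dadd _ _ = dsub (picard_iter (m.+1 + n) t) (picard_iter n t)); last first.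
  by apply/funext => k; rewrite /dadd /dsub addrA subrK.
apply: bb_le; apply: eqr_le; rewrite addSn exprS -/P.
by move: (2^-1 ^+ (m + n)) (2^-1 ^+ n) => X Y; field.
Qed.

(** Taking the limit coefficient by coefficient replaces completeness of the path space; [bb_limit]
    transfers the estimates to it. *)
Definition picard_lim t : distr R := fun k => clim (fun n => picard_iter n t k).

Lemma picard_lim_cvg t k : 0 < t <= T -> ccvg (fun n => picard_iter n t k) (picard_lim t k).
Proof.
move=> ht; have half : 0 <= (2^-1 : R) < 1 by rewrite invr_ge0 ler0n invf_lt1// ltr1n.
apply: (@ccvg_geometric_increments _ _ (coefc b k * (M * t `^ (- gam))) 2^-1 0 half) => n _.
have := bb_coef H k (picard_iter_step n ht); rewrite /dsub => /le_trans; apply.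
by apply: eqr_le; ring.
Qed.

Lemma bb_limit s (u : nat -> distr R) (v : distr R) C : (forall n, bb s (u n) C) ->
  (forall k, ccvg (u ^~ k) (v k)) -> bb s v C.
Proof.
move=> hu huv n; apply: (@linf_ccvg _ (2 ^ n.+1) (fun m => blk chi rho n (u m))).
- by move=> m; exact: blk_suppin.
- exact: blk_suppin.
- by move=> m; exact: hu.
- by move=> k; exact: ccvgZ.
Qed.

Lemma picard_lim_dom : picard_dom picard_lim.
Proof.
split=> [k|t ht]; last first.
  apply: (bb_limit (fun n => (picard_iter_dom n).2 t ht)) => k.
  exact: picard_lim_cvg.
apply: (@cmeas_lim _ _ (fun n t => picard_iter n t k)).
  by move=> n; exact: (picard_iter_dom n).1.
by move=> t; rewrite in_oc => ht; exact: picard_lim_cvg.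
Qed.

Lemma picard_lim_dist n t : 0 < t <= T ->
  bb b (dsub (picard_lim t) (picard_iter n t)) (2 * M * 2^-1 ^+ n * t `^ (- gam)).
Proof.
move=> ht; apply: (bb_limit (fun m => picard_iter_dist n m ht)) => k.
have [h1 h2] := picard_lim_cvg k ht.
apply: ccvgB; last exact: ccvg_cst.
split; [have := h1|have := h2].
  by rewrite -(cvg_shiftn n).
by rewrite -(cvg_shiftn n).
Qed.

(** Both sides are compared with [picard_iter n.+1], which is [picard] of [picard_iter n]:
    contraction controls one distance and the convergence rate the other, both [O(2^-n)]. *)
Lemma picard_fixpoint t : 0 < t <= T -> picard picard_lim t = picard_lim t.
Proof.
move=> ht; apply/funext => k; apply/eqP; rewrite -subr_eq0; apply/eqP.
apply: (@bb_eq0 _ _ _ H b (dsub (picard picard_lim t) (picard_lim t))) => e e0.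
have half : 0 <= (2^-1 : R) < 1 by rewrite invr_ge0 ler0n invf_lt1// ltr1n.
have [n hn] := geometric_small (2 * (2 * M * t `^ (- gam))) half e0.
have h1 := picard_lim_dist n.+1 ht.
have d0 : 0 <= 2 * M * 2^-1 ^+ n by rewrite !mulr_ge0 ?exprn_ge0 ?invr_ge0.
have h2 := picard_contract picard_lim_dom (picard_iter_dom n) d0
   (fun t ht => picard_lim_dist n ht) ht.
have := bbB h2 h1.
rewrite (_ : dsub _ _ = dsub (picard picard_lim t) (picard_lim t)); last first.
  by apply/funext => j; rewrite /dsub opprB addrA subrK.
apply: bb_le; apply: le_trans (hn n (leqnn n)).
have P0 : 0 <= 2 * M * 2^-1 ^+ n * t `^ (- gam) by rewrite mulr_ge0 ?powR_ge0.
rewrite exprS; move: P0; set X := 2^-1 ^+ n; set P := t `^ _.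
have -> : 2 * M * X / 2 * P + 2 * M * (2^-1 * X) * P = 2 * M * X * P by field.
have -> : 2 * (2 * M * P) * X = 2 * (2 * M * X * P) by ring.
by lra.
Qed.

(** Boundedness in [C^b] and continuity of coefficients give norm continuity only below [b], hence
    the exponent [a1 < b] in the solution. *)
Lemma picard_solution a1 : 0 < a1 < b -> 0 < gam ->
  is_solution chi rho mu lam nu T Y0 Zq picard_lim.
Proof.
move=> /andP[a10 a1b] gam0; have /andP[_ g3] := gam_bound; have dom := picard_lim_dom.
split; last first.
  move=> t; rewrite in_itv /= => ht k.
  have [h1 h2] := @duhamelE _ mu (fun s => PsiQ (picard_lim s) Zq s) t k
    (picard_integrable k dom ht).
  by split=> //; rewrite -(picard_fixpoint ht).
exists a1, gam; split=> //; first by apply/andP; split => //; lra.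
- apply: (@cont_path_of_coef _ _ _ H a1 b gam M T) => //; [exact: ltW| |exact: dom.2].
  move=> t ht k e e0; have [p cp hp] := picard_coefE k dom.
  have tc : `[0, T]%classic t by rewrite /= in_itv /=; case/andP: ht => /ltW -> ->.
  have [del del0 hd] := ccont_eps tc cp e0.
  exists del => // r hr hrt; rewrite -!(picard_fixpoint hr) -!(picard_fixpoint ht) !hp//.
  by apply: hd => //; rewrite /= in_itv /=; case/andP: hr => /ltW -> ->.
- exists M => t; rewrite in_itv /= => ht; have /andP[t0 tT] := ht.
  rewrite -lee_pdivlMl ?powR_gt0//; apply/(besov_normP H).
  apply: bb_le (bb_weaken (ltW a1b) (dom.2 t ht)).
  rewrite powRN [leRHS]mulrC [_^-1 * M]mulrC ler_peMl//.
    by rewrite mulr_ge0 ?invr_ge0 ?powR_ge0.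
  by rewrite -[leLHS](powRr0 2) ler_powR ?ler1n// ltW.
Qed.

End Picard.

End Existence.

(** Paths are functions on all of [R], while the equation constrains them on []0, Ts]]; being a
    singleton therefore means existence together with agreement on that interval. The exponent [a]
    is fixed before all data except [a0]. *)
Theorem theorem3p2 (R : realType) (a0 : R) :
  0 < a0 < 2 / 3 ->
  exists2 a : R, 0 < a &
  forall (chi rho : R -> R -> R) (mu lam : R) (nu : R[i]),
  dyadic_partition chi rho -> 0 < mu -> 0 < complex.Re nu ->
  forall K : R, 1 <= K ->
  exists2 Ts : R, 0 < Ts &
  forall (Y0 : distr R) (Zq : quad R),
    holder chi rho (- a0) Y0 -> in_calZ chi rho Zq ->
    (besov_norm chi rho (- a0) Y0 +
       ereal_sup [set Znorm chi rho a Zq t | t in [set` (`]0, Ts])%R]] <= K%:E)%E ->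
    (exists Y : R -> distr R, is_solution chi rho mu lam nu Ts Y0 Zq Y) /\
    (forall Y1 Y2 : R -> distr R,
        is_solution chi rho mu lam nu Ts Y0 Zq Y1 ->
        is_solution chi rho mu lam nu Ts Y0 Zq Y2 ->
        forall t, t \in `]0, Ts] -> Y1 t = Y2 t).
Proof.
move=> /andP[a0_gt0 a0_lt].
(* Half of the gap to [2 / 3] is spent on the regularity of [Y], so [gam = (b + a0) / 2] stays below
   [1 / 3]. *)
have [b [b0 b3 ab0]] : exists b, [/\ 0 < b, b <= 1 / 3 & a0 + b < 2 / 3].
  by exists ((2 / 3 - a0) / 2); split; lra.
have [a aE] : exists a, a = b / 2 by exists (b / 2).
have hab : 0 < a < b by lra.
exists a; first by lra.
move=> chi rho mu lam nu H mu_gt0 _ K K1.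
have [gam gE] : exists g, g = (b - - a0) / 2 by exists ((b - - a0) / 2).
have gam0 : 0 < gam by lra.
have gam3 : 0 <= gam < 1 / 3 by lra.
have agam : a <= gam by lra.
have hg1 : 0 <= (b - - a0) / 2 <= 1 by lra.
have [C3 C30] := bb_heat H mu_gt0 hg1; rewrite -gE => heat.
have [C1 C10 lip] := Psi_lipschitz H lam nu hab.
have [th thE] : exists th, th = (b + a) / 2 by exists ((b + a) / 2).
have hth : 0 <= (b + a) / 2 <= 1 by lra.
have hth' : 0 <= th < 1 by lra.
have hka : 0 <= 3 * gam < 1 by lra.
have [C2 C20] := bb_duhamel H mu_gt0 hth hth' hka; rewrite -thE => duh.
(* The power of [t] gained by the Duhamel term over the weight [t^-gam]; it is positive since
   [th = 3 b / 4 <= 1 / 4] and [2 * gam < 2 / 3]. *)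
have [de deE] : exists de, de = 1 - th - 2 * gam by exists (1 - th - 2 * gam).
have de0 : 0 < de by lra.
have expo : 1 - th - 3 * gam = de - gam by lra.
have K0 : 0 <= K by lra.
(* The linear evolution of [Y0] uses less than half of the ball; the [+ 1] ensures
   [1 <= M * s^-gam], as [Psi_lipschitz] requires. *)
have [M [M1 ME]] : exists M, 1 <= M /\ M = 2 * (C3 * K) + 1.
  by exists (2 * (C3 * K) + 1); split=> //; have := mulr_ge0 C30 K0; lra.
have M0 : 0 <= M := le_trans ler01 M1.
pose L := cmod ((1 + lam)%:C%C : R[i]) + cmod (- nu).
have L0 : 0 <= L by rewrite addr_ge0 ?cmod_ge0.
have [E1 [E10 E1E]] : exists E, 0 <= E /\ E = C1 * (M ^+ 2 + K * M).
  by exists (C1 * (M ^+ 2 + K * M)); split=> //; rewrite mulr_ge0 ?addr_ge0 ?exprn_ge0 ?mulr_ge0.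
(* The Lipschitz bound between [Y] and [0] plus the forcing at [0]. As [M >= 1], it also dominates
   the Lipschitz constant [E1], so one time serves both Picard bounds. *)
have [B [B0 E1B BE]] : exists B, [/\ 0 <= B, E1 <= B & B = E1 * M + L * K].
  exists (E1 * M + L * K); split=> //; first by rewrite addr_ge0 ?mulr_ge0.
  by rewrite -[leLHS]addr0 lerD ?mulr_ge0// ler_peMr.
have [X [X1 XE]] : exists X, 1 <= X /\ X = 2 * (C2 * B) + 1.
  by exists (2 * (C2 * B) + 1); split=> //; have := mulr_ge0 C20 B0; lra.
have X0 : 0 < X := lt_le_trans ltr01 X1.
(* The time solves [T ^ de = 1 / X], so the Duhamel constant [C2 * B] shrinks below [1 / 2]; it
   depends on [K] and the parameters but not on the data. *)
have [T [T0 T1 TE]] : exists T, [/\ 0 < T, T <= 1 & T `^ de = X^-1].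
  exists (X `^ (- de^-1)); split; first exact: powR_gt0.
    by rewrite -[leRHS](powRr0 X) ler_powR// oppr_le0 invr_ge0 ltW.
  by rewrite -powRrM mulNr mulVf ?gt_eqF// powR_inv1// ltW.
have small E : 0 <= E -> E <= B -> C2 * E / X <= 1 / 2.
  move=> E0 EB; rewrite ler_pdivrMr// XE.
  by have := ler_wpM2l C20 EB; lra.
have decay t : 0 < t <= T -> t `^ (1 - th - 3 * gam) <= X^-1 * t `^ (- gam).
  move=> /andP[t0 tT]; rewrite expo powRD ?(gt_eqF t0) ?implybT//.
  rewrite ler_wpM2r ?powR_ge0// -TE.
  by apply: (ge0_ler_powR (ltW de0)) => //; rewrite nnegrE ltW.
have t1 t : 0 < t <= T -> 0 < t <= 1.
  by move=> /andP[-> tT]; exact: le_trans tT T1.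
exists T => // Y0 Zq _ hZ hK.
split; last first.
  by move=> Y1 Y2 s1 s2; apply: (solution_unique H mu_gt0 _ hZ s1 s2); rewrite T0.
have Zge0 t : (0 <= Znorm chi rho a Zq t)%E.
  by rewrite /Znorm le_max; apply/orP; left; exact: besov_norm_ge0.
have Zle t : 0 < t <= T -> (Znorm chi rho a Zq t <= K%:E)%E.
  move=> ht; apply: le_trans hK; apply: (@le_trans _ _ (ereal_sup
     [set Znorm chi rho a Zq t | t in [set` (`]0, T])%R]])).
    by apply: ereal_sup_ubound; exists t => //=; rewrite in_itv.
  by rewrite leeDr ?besov_norm_ge0.
have hY0 : bb chi rho (- a0) Y0 K.
  have : (besov_norm chi rho (- a0) Y0 <= K%:E)%E.
    (* Dropping the supremum from the sum requires it to be nonnegative; the endpoint [T] witnesses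
       this. *)
    apply: le_trans hK; apply: leeDl.
    apply: (@le_trans _ _ (Znorm chi rho a Zq T)) => //.
    by apply: ereal_sup_ubound; exists T => //=; rewrite in_itv /= T0 lexx.
  move=> /(besov_normP H); apply: bb_le; rewrite ler_piMr//.
  by rewrite -[leRHS](powRr0 2) ler_powR ?ler1n// oppr_le0 ltW.
have Zbb s (hs : 0 < s <= T) := Znorm_bb H (t1 s hs) (ltW (proj1 (andP hab))) (Zle s hs).
have y1 s : 0 < s <= T -> 1 <= M * s `^ (- gam).
  move=> hs; rewrite -[leLHS]mulr1; apply: ler_pM => //.
  by apply: powRN_ge1; [exact: t1|exact: ltW].
have HPsiB Y : picard_dom chi rho b gam T M Y -> forall s, 0 < s <= T ->
    bb chi rho (- a) (PsiQ chi rho lam nu (Y s) Zq s) (B * s `^ (- (3 * gam))).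
  move=> [_ hY] s hs; have [z1 z2 z3 z4] := Zbb s hs.
  have hY0' : bb chi rho b (fun=> 0) (M * s `^ (- gam)).
    by apply: bb_le (bb0 chi rho b); rewrite mulr_ge0 ?powR_ge0.
  have hd : bb chi rho b (dsub (Y s) (fun=> 0)) (M * s `^ (- gam)).
    by rewrite (_ : dsub _ _ = Y s)//; [exact: hY|apply/funext => k; rewrite /dsub subr0].
  have h1 := lip _ _ _ _ _ (qZabs2Z Zq s) _ _ _ (y1 s hs) (hY s hs) hY0' hd z1 z2 z3.
  have h2 := Psi_zero H lam nu hab z1 z2 z3 z4.
  have := bbD h1 h2; rewrite (_ : dadd _ _ = PsiQ chi rho lam nu (Y s) Zq s); last first.
    by apply/funext => k; rewrite /dadd /dsub subrK.
  apply: bb_le; rewrite BE [leRHS]mulrDl; apply: lerD.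
    have := cubic_weight (t1 s hs) agam M0 K0.
    move/(ler_wpM2l (mulr_ge0 C10 M0)); rewrite E1E; set S := s `^ (- (3 * gam)).
    move=> h; apply: le_trans (le_trans _ h) _; apply: eqr_le; ring.
  rewrite -mulrA ler_wpM2l// ler_wpM2l//; apply: powRN_mono; first exact: t1.
  by apply: le_trans agam _; rewrite ler_peMl ?ler1n//; exact: ltW.
have HZB s : 0 < s <= T -> exists W, [/\ bb chi rho (- a) (qZ Zq s) W,
    bb chi rho (- a) (qZ2 Zq s) W & bb chi rho (- a) (qZabs2 Zq s) W].
  by move=> /Zbb [z1 z2 z3 _]; exists (K * s `^ (- a)).
have hT : 0 < T <= 1 by rewrite T0.
have integ Y t k : picard_dom chi rho b gam T M Y -> 0 < t <= T ->
    cintegrable 0 t (fun s => heat_mult mu (t - s) k * PsiQ chi rho lam nu (Y s) Zq s k).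
  move=> dY ht.
  by have [] := @duhamelE _ mu (fun s => PsiQ chi rho lam nu (Y s) Zq s) t k
    (picard_integrable H mu hab gam3 hT hZ B0 HPsiB HZB k dY ht).
exists (picard_lim chi rho mu lam nu Y0 Zq).
apply: (picard_solution H hab gam3 hT M0 hZ B0 HPsiB HZB (Y0 := Y0) _ _ (a1 := b / 2) _ gam0); last by lra.
- move=> Y dY t ht.
  have h1 := heat t Y0 K (t1 t ht) hY0.
  have h2 := duh (fun s => PsiQ chi rho lam nu (Y s) Zq s) t B (fun s => B * s `^ (- (3 * gam)))
     (t1 t ht) B0 (fun k => integ Y t k dY ht).
  have {}h2 := h2 _.
  have hs s : 0 < s < t -> bb chi rho (- a) (PsiQ chi rho lam nu (Y s) Zq s) (B * s `^ (- (3 * gam))) /\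
      (t - s) `^ (- th) * (B * s `^ (- (3 * gam))) <=
      B * ((t - s) `^ (- th) * s `^ (- (3 * gam))).
    move=> /andP[s0 st]; split; last by apply: eqr_le; ring.
    by apply: HPsiB => //; rewrite s0 (ltW (lt_le_trans st (proj2 (andP ht)))).
  apply: bb_le (bbD h1 (h2 hs)).
  have := ler_wpM2l (mulr_ge0 C20 B0) (decay t ht); rewrite mulrA => h.
  apply: le_trans (lerD (lexx _) h) _; rewrite ME.
  have := ler_wpM2r (powR_ge0 t (- gam)) (small B B0 (lexx B)).
  have CK : 0 <= C3 * K * t `^ (- gam) by rewrite !mulr_ge0 ?powR_ge0.
  have P0 := powR_ge0 t (- gam).
  rewrite (_ : C3 * t `^ (- gam) * K = C3 * K * t `^ (- gam)); last by ring.
  by move: CK P0; rewrite !mulrDl mulrA; lra.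
- move=> Y Y' d dY dY' d0 hd t ht.
  have [cF dF] := duhamel_sub (fun k => integ Y t k dY ht) (fun k => integ Y' t k dY' ht).
  rewrite (_ : dsub _ _ = duhamel mu (fun s => dsub (PsiQ chi rho lam nu (Y s) Zq s)
      (PsiQ chi rho lam nu (Y' s) Zq s)) t); last first.
    by rewrite dF; apply/funext => k; rewrite /picard /dsub /dadd opprD addrACA subrr add0r.
  have h2 := duh _ t (E1 * d) (fun s => C1 * ((M * s `^ (- gam)) ^+ 2 +
     K * s `^ (- a) * (M * s `^ (- gam))) * (d * s `^ (- gam))) (t1 t ht) (mulr_ge0 E10 d0) cF.
  apply: bb_le (h2 _).
    have := ler_wpM2l (mulr_ge0 C20 (mulr_ge0 E10 d0)) (decay t ht) => /le_trans; apply.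
    have := ler_wpM2r (mulr_ge0 d0 (powR_ge0 t (- gam))) (small E1 E10 E1B).
    move=> h; apply: le_trans (le_trans _ h) _; apply: eqr_le; ring.
  move=> s /andP[s0 st].
  have hs : 0 < s <= T by rewrite s0 (ltW (lt_le_trans st (proj2 (andP ht)))).
  have [z1 z2 z3 _] := Zbb s hs.
  split; first exact: (lip _ _ _ _ _ _ _ _ _ (y1 s hs) (dY.2 s hs) (dY'.2 s hs) (hd s hs) z1 z2 z3).
  have := cubic_weight (t1 s hs) agam M0 K0.
  move/(ler_wpM2l (mulr_ge0 (mulr_ge0 C10 d0) (powR_ge0 (t - s) (- th)))); rewrite E1E => h.
  by apply: le_trans (le_trans _ h) _; apply: eqr_le; ring.
Qed.
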